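(* Let $\mathbf t=(t_1,t_2)$ be a type, $h\in\mathscr F^{\mathbf t}_{r+|\mathbf t|}$, and consider a system $\dot{\mathbf x}=\mathbf F(\mathbf x)=\mathbf X_h+\text{q-h.h.o.t.}$ Assume that the origin of this system is monodromic and that the system is formally orbital equivalent to the non-formally integrable system $$\dot{\mathbf x}=\mathbf X_h+\mu_{r+N}\mathbf D_0,$$ with $N$ a natural number and $\mu_{r+N}\in\mathrm{Cor}(\ell_{r+N})\setminus\{0\}$. Let $$I=\int_{h=\mathrm{sig}(h)}\mu_{r+N}.$$ Then the origin is: 1. a center, if $I=0$; 2. an unstable focus, if $\mathrm{sig}(h)\,I>0$; 3. a stable focus, if $\mathrm{sig}(h)\,I<0$.
   Context: Type: $\mathbf t=(t_1,t_2)$ non-null, with $t_1,t_2$ non-negative integers without common factors; $|\mathbf t|=t_1+t_2$. $\mathscr P^{\mathbf t}_k$ is the space of $f\in\mathbb C[x,y]$ with $f(\varepsilon^{t_1}x,\varepsilon^{t_2}y)=\varepsilon^kf(x,y)$. $\mathcal Q^{\mathbf t}_k$ is the space of polynomial vector fields $(P,Q)^T$ with $P\in\mathscr P^{\mathbf t}_{k+t_1}$, $Q\in\mathscr P^{\mathbf t}_{k+t_2}$. Here $r$ is an integer, $\mathbf X_h=(-\partial h/\partial y,\partial h/\partial x)^T\in\mathcal Q^{\mathbf t}_r$ and $\mathbf D_0=(t_1x,t_2y)^T$. $\mathbf F$ is a formal planar vector field (components in $\mathbb C[[x,y]]$) with a singular point at the origin; ''q-h.h.o.t.'' means quasi-homogeneous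 terms of type $\mathbf t$ of degree larger than $r$. $\ell_j:\mathscr P^{\mathbf t}_{j-r}\to\mathscr P^{\mathbf t}_j$, $\ell_j(\mu)=\frac{\partial h}{\partial x}\frac{\partial\mu}{\partial y}-\frac{\partial h}{\partial y}\frac{\partial\mu}{\partial x}$; $\mathrm{Cor}(\ell_j)$ is a complementary subspace to the range of $\ell_j$, with $\mathrm{Cor}(\ell_{j+r+|\mathbf t|})=h\,\mathrm{Cor}(\ell_j)$ for all $j>r$ with $\mathscr P^{\mathbf t}_{j-r}\ne\{0\}$. $\mathscr F^{\mathbf t}_{r+|\mathbf t|}$ is the set of $h\in\mathscr P^{\mathbf t}_{r+|\mathbf t|}$ such that (H1) the factorization of $h$ in $\mathbb C[x,y]$ has only simple factors, and (H2) $h\mathscr P^{\mathbf t}_j$ is a complementary subspace to the range of $\ell_{r+|\mathbf t|+j}$ for every $j\ge1$ with $j\le r$, or $j>r$ and $\mathscr P^{\mathbf t}_{j-r}=\{0\}$. Formally orbital equivalent: $\mathbf F$ and $\mathbf G$ are so if there are a (formal) diffeomorphism $\Phi$ and a function $\eta$ with $\eta(\mathbf 0)\ne0$ such that $\Phi_*(\eta\mathbf F)=\mathbf G$. Formally integrable: having a formal first integral. Monodromic: the singular point is surrounded by orbits of the system; for these systems this happens if and only if $h$ is zero only at the origin, so $h$ preserves its sign, denoted $\mathrm{sig}(h)\in\{1,-1\}$. When $h>0$ off the origin, the integral is $I=\int_0^T\mu_{r+N}(\mathrm{Cs}(\theta),\mathrm{Sn}(\theta))\,d\theta$, where $(\mathrm{Cs},\mathrm{Sn})$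 is the solution of $d\mathbf x/d\theta=\mathbf X_h(\mathbf x)$ parameterizing the closed curve $h=1$ and $T$ is its minimal period; the case of negative $h$ is reduced to this one by changing the time $t$ to $-t$, by which $h$ becomes $-h$.
   Formalization: The system is real with F a convergent power series near the origin, and formal orbital equivalence is taken with real Φ, η and η(0)>0 instead of η(0)≠0: with η=-1, Φ=(x,-y), h=x²+y² the literal claim confuses stable and unstable foci. *)

(* Defs.v *)
From mathcomp Require Import all_boot all_order all_algebra.
From mathcomp Require Import complex.
From mathcomp Require Import all_classical all_reals all_analysis.

Set Implicit Arguments.
Unset Strict Implicit.
Unset Printing Implicit Defensive.

Import Order.TTheory GRing.Theory Num.Theory.
Import numFieldNormedType.Exports.

Local Open Scope classical_set_scope.
Local Open Scope ring_scope.

(** * Bivariate polynomials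

   K[x,y] is {poly {poly K}} with the conventions of polyXY: the outer variable
   'X is x, the inner one 'Y is y, p.[a, b] is the value at x = a, y = b, and
   p`_i`_j is the coefficient of x^i y^j. *)

Section Polynomials.
Variable K : nzRingType.
Implicit Types p : {poly {poly K}}.

Definition dX p : {poly {poly K}} := p^`().
Definition dY p : {poly {poly K}} := map_poly (fun c : {poly K} => c^`()) p.

End Polynomials.

Section QuasiHomogeneous.
Variables (K : fieldType) (t : nat * nat).
Implicit Types (h mu p q : {poly {poly K}}) (j k r : int).

(* [coprime 0 0] is false, so a type is automatically non-null; the types
   (1, 0) and (0, 1) are allowed. *)
Definition is_type : bool := coprime t.1 t.2.

Definition wt : nat := (t.1 + t.2)%N.

Definition qhomog k : set {poly {poly K}} :=
  [set p | forall e x y : K, e != 0 ->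
     p.[e ^+ t.1 * x, e ^+ t.2 * y] = e ^ k * p.[x, y]].

Definition ell h mu : {poly {poly K}} := dX h * dY mu - dY h * dX mu.

Definition ell_range h r j : set {poly {poly K}} :=
  [set ell h mu | mu in qhomog (j - r)].

Definition is_subspace (V : set {poly {poly K}}) : Prop :=
  [/\ V 0, (forall p q, V p -> V q -> V (p + q))
         & (forall (a : K) p, V p -> V (a%:P *: p))].

Definition complementary (E U V : set {poly {poly K}}) : Prop :=
  [/\ is_subspace V, V `<=` E, U `&` V `<=` [set 0]
    & forall p, E p -> exists u v, [/\ U u, V v & p = u + v]].

Definition irreducible_elt p : Prop :=
  [/\ p != 0, p \isn't a GRing.unit
    & forall a b, p = a * b -> a \is a GRing.unit \/ b \is a GRing.unit].

Definition simple_factors h : Prop :=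
  h != 0 /\
  forall p, irreducible_elt p -> ~ exists q, h = p ^+ 2 * q.

(* The set F^t_(r + |t|). *)
Definition class_F r : set {poly {poly K}} :=
  [set h | [/\ qhomog (r + wt%:Z) h, simple_factors h
    & forall j, 1 <= j ->
        (j <= r \/ (r < j /\ qhomog (j - r) = [set 0])) ->
        complementary (qhomog (r + wt%:Z + j)) (ell_range h r (r + wt%:Z + j))
          [set h * p | p in qhomog j]]].

Definition is_Cor h r (Cor : int -> set {poly {poly K}}) : Prop :=
  (forall j, complementary (qhomog j) (ell_range h r j) (Cor j)) /\
  (forall j, r < j -> qhomog (j - r) <> [set 0] ->
     Cor (j + r + wt%:Z) = [set h * p | p in Cor j]).

Definition Xh h : {poly {poly K}} * {poly {poly K}} := (- dY h, dX h).

(* The vector field X_h + mu D_0. *)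
Definition normal_form h mu : {poly {poly K}} * {poly {poly K}} :=
  ((Xh h).1 + mu * ('X *+ t.1), (Xh h).2 + mu * ('Y *+ t.2)).

End QuasiHomogeneous.

Arguments qhomog {K} t k.

Definition toC (R : rcfType) : {poly {poly R}} -> {poly {poly R[i]}} :=
  map_poly (map_poly (real_complex R)).

(** * Formal power series in two variables

   [f i j] is the coefficient of x^i y^j. *)

Definition fps (K : Type) := nat -> nat -> K.
Definition fvf (K : Type) := (fps K * fps K)%type.

Section FormalSeries.
Variable K : nzRingType.
Implicit Types (f g u v : fps K) (F G : fvf K).

Definition fps_add f g : fps K := fun i j => f i j + g i j.
Definition fps_mul f g : fps K := fun i j =>
  \sum_(a < i.+1) \sum_(b < j.+1) f a b * g (i - a)%N (j - b)%N.
Definition fps_one : fps K := fun i j => ((i == 0%N) && (j == 0%N))%:R.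
Definition fps_exp f (n : nat) : fps K := iter n (fps_mul f) fps_one.
Definition fps_dx f : fps K := fun i j => f i.+1 j *+ i.+1.
Definition fps_dy f : fps K := fun i j => f i j.+1 *+ j.+1.

(* g(u, v); the truncation is exact when u and v have no constant term. *)
Definition fps_comp g u v : fps K := fun i j =>
  \sum_(a < (i + j).+1) \sum_(b < (i + j).+1)
    g a b * fps_mul (fps_exp u a) (fps_exp v b) i j.

Definition fps_of_poly (p : {poly {poly K}}) : fps K := fun i j => p`_i`_j.
Definition fvf_of_poly (P : {poly {poly K}} * {poly {poly K}}) : fvf K :=
  (fps_of_poly P.1, fps_of_poly P.2).

(* The derivative of the series f along the vector field F. *)
Definition fps_lie F f : fps K :=
  fps_add (fps_mul (fps_dx f) F.1) (fps_mul (fps_dy f) F.2).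

Definition formally_integrable F : Prop :=
  exists H : fps K,
    (exists i j, (i, j) != (0%N, 0%N) /\ H i j != 0) /\
    forall i j, fps_lie F H i j = 0.

(* F = P + quasi-homogeneous terms of type t of degree larger than r: the
   monomials of the i-th component of a term of degree d have t-weight
   d + t_i. *)
Definition qhhot (t : nat * nat) (r : int) F
    (P : {poly {poly K}} * {poly {poly K}}) : Prop :=
  forall a b : nat,
    ((t.1 * a + t.2 * b)%N%:Z <= r + t.1%:Z ->
       F.1 a b = fps_of_poly P.1 a b) /\
    ((t.1 * a + t.2 * b)%N%:Z <= r + t.2%:Z ->
       F.2 a b = fps_of_poly P.2 a b).

End FormalSeries.

(* Phi_*(eta F) = G is written D Phi . (eta F) = G o Phi. The equivalence is over
   the reals and keeps the sense of time, eta(0) > 0. Neither restriction can be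
   dropped when stability is at stake: for h = x^2 + y^2, the reflection (x, -y)
   with eta = -1, and the complex map i.Id with eta = 1, both transform
   X_h + h D_0 into X_h - h D_0. No condition on the sign of det D Phi(0) is
   imposed. *)
Definition formally_orbital_equivalent (R : realDomainType) (F G : fvf R) :
    Prop :=
  exists (phi : fvf R) (eta : fps R),
    [/\ phi.1 0%N 0%N = 0 /\ phi.2 0%N 0%N = 0,
        phi.1 1%N 0%N * phi.2 0%N 1%N - phi.1 0%N 1%N * phi.2 1%N 0%N != 0,
        0 < eta 0%N 0%N
      & forall i j,
          fps_lie (fps_mul eta F.1, fps_mul eta F.2) phi.1 i j
            = fps_comp G.1 phi.1 phi.2 i j /\
          fps_lie (fps_mul eta F.1, fps_mul eta F.2) phi.2 i j
            = fps_comp G.2 phi.1 phi.2 i j].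

(** * Real planar systems *)

Section Dynamics.
Variable R : realType.
Implicit Types (F : R * R -> R * R) (g : R -> R * R) (phi : R -> R)
  (A : set R) (p : R * R).

(* f is, near the origin, the sum of the convergent power series a. *)
Definition power_series_at0 (a : fps R) (f : R * R -> R) : Prop :=
  exists rho M : R,
    [/\ 0 < rho,
        forall i j, `|a i j| * rho ^+ (i + j) <= M
      & forall p, `|p| < rho ->
          (\sum_(i < n) \sum_(j < n) a i j * p.1 ^+ i * p.2 ^+ j) @[n --> \oo]
            --> f p].

Definition has_taylor F (f : fvf R) : Prop :=
  power_series_at0 f.1 (fun p => (F p).1) /\
  power_series_at0 f.2 (fun p => (F p).2).

Definition solution_on F A g : Prop :=
  forall s, A s ->
    is_derive s (1 : R) (fun u => (g u).1) (F (g s)).1 /\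
    is_derive s (1 : R) (fun u => (g u).2) (F (g s)).2.

(* phi is a continuous determination on A of the polar angle of the curve g,
   which avoids the origin. *)
Definition polar_angle A g phi : Prop :=
  {within A, continuous phi} /\
  forall s, A s -> exists2 rho : R, 0 < rho &
    g s = (rho * cos (phi s), rho * sin (phi s)).

(* g, restricted to [0, tau], is an orbit arc which starts at p, stays in the
   eps-ball and makes exactly one turn around the origin. *)
Definition one_turn F (eps : R) p g (tau : R) : Prop :=
  [/\ 0 < tau, g 0 = p, solution_on F `[0, tau] g,
      (forall s, 0 <= s <= tau -> `|g s| < eps)
    & exists2 phi, polar_angle `[0, tau] g phi & `|phi tau - phi 0| = 2 * pi].

(* The origin is surrounded by orbits. *)
Definition monodromic F : Prop :=
  forall eps : R, 0 < eps -> exists2 delta : R, 0 < delta &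
    forall p, 0 < `|p| < delta -> exists g tau, one_turn F eps p g tau.

(* The origin is surrounded by closed orbits. *)
Definition is_center F : Prop :=
  forall eps : R, 0 < eps -> exists2 delta : R, 0 < delta &
    forall p, 0 < `|p| < delta ->
      exists g tau, one_turn F eps p g tau /\ g tau = p.

(* The origin is Lyapunov stable and nearby orbits spiral towards it. *)
Definition stable_focus F : Prop :=
  forall eps : R, 0 < eps -> exists2 delta : R, 0 < delta &
    forall p, 0 < `|p| < delta -> exists g phi,
      [/\ g 0 = p, solution_on F `[0, +oo[ g,
          (forall s, 0 <= s -> `|g s| < eps),
          g s @[s --> +oo] --> (0 : R * R)
        & polar_angle `[0, +oo[ g phi /\ `|phi s| @[s --> +oo] --> +oo].

Definition unstable_focus F : Prop := stable_focus (fun p => - F p).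

(* Meaningful when h has constant sign off the origin. *)
Definition hsign (h : {poly {poly R}}) : R :=
  if `[< forall x y, 0 <= h.[x, y] >] then 1 else -1.

(* (Cs, Sn) is a solution of d x / d theta = X_h(x) which parameterizes the
   closed curve h = 1, with minimal period T. *)
Definition parameterizes_level1 (h : {poly {poly R}}) (Cs Sn : R -> R) (T : R)
    : Prop :=
  [/\ solution_on (fun p => ((Xh h).1.[p.1, p.2], (Xh h).2.[p.1, p.2])) setT
        (fun s => (Cs s, Sn s)),
      [set p : R * R | h.[p.1, p.2] = 1] = range (fun s => (Cs s, Sn s)),
      0 < T, (forall s, Cs (s + T) = Cs s /\ Sn (s + T) = Sn s)
    & forall S, 0 < S < T -> ~ (forall s, Cs (s + S) = Cs s /\ Sn (s + S) = Sn s)].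

(* The integral of mu over the curve h = hsign(h), where (Cs, Sn, T)
   parameterizes hsign(h) h = 1. When h is negative, the change of t to -t turns
   X_h + mu D_0 into X_(-h) + (- mu) D_0, so that the integrand is - mu. *)
Definition level_integral (h mu : {poly {poly R}}) (Cs Sn : R -> R) (T : R) : R :=
  Rintegral lebesgue_measure `[0, T]
    (fun s => hsign h * mu.[Cs s, Sn s]).

End Dynamics.

(* Main.v *)
Require Import Defs.
From mathcomp Require Import all_boot all_order all_algebra.
From mathcomp Require Import complex ring lra zify.
From mathcomp Require Import all_classical all_reals all_analysis.

Set Implicit Arguments.
Unset Strict Implicit.
Unset Printing Implicit Defensive.

Import Order.TTheory GRing.Theory Num.Theory.
Import numFieldNormedType.Exports.

Local Open Scope classical_set_scope.
Local Open Scope ring_scope.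

(** The polynomial h' = sig(h) h is positive off the origin and its level curve
   h' = 1 is closed, so X_h turns around the origin; everything depends on what a
   turn does to the distance to the origin. The proof computes this change twice,
   once qualitatively for the analytic field F, once quantitatively for the normal
   form, and compares. A change of sign of h and of F reduces to h > 0, and the sense
   of time is carried by a sign e, so that centers, stable and unstable foci are read
   off one dichotomy ([center_or_focus]).

   Analytic side. In weighted polar coordinates (u^t1 C(s), u^t2 S(s)), whose unit
   curve is h = 1 ([polar_frame]), the lower terms of F are absent, so F divided by
   powers of u is analytic and its leading term is X_h. Orbits satisfy an equation
   du/ds = R(s, u), analytic in u, whose terms of order 0 and 1 vanish since X_h keeps
   u constant. Its flow is analytic in the initial radius ([analytic_flow],
   [polar_flow]): Picard iteration on polynomials, with a majorant norm. Hence the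
   return map P is analytic, and P - id is identically 0 near 0, or behaves as c z^n
   with c <> 0 ([expands_isolated]). This is what excludes an accumulation of limit
   cycles and permits a formal equivalence to decide between center and focus.

   Formal side. For X_h + mu D_0 the potential
   W = (primitive of - rho^-(N+1))(radius) + (primitive of mu - mean of mu)(angle),
   with radius = h^(1/k), tends to +oo at the origin and satisfies
   dW/dt = - (mean of mu) radius^r ([spiral_potential], [dpotential_perturbed]): the
   mean of mu on the level curve is I / T. A formal equivalence, truncated at a high
   order, is a polynomial change of variables which conjugates F to the normal form up
   to an error of high order ([equivalence_estimate]); through it, W becomes a function w of the
   radius on a section with w(P z) - w(z) = O(z^n), n arbitrary, if I = 0, and with
   w(P z) - w(z) of the sign of - e I otherwise ([spiral_comparison]).

   Comparison ([return_map]). If P z < z near 0, the iterates of P tend to 0; if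
   P z > z, backward iterates do. Along them w cannot stay bounded ([no_blowup]). For
   I = 0 and P - id of order n exactly, the increments of w would be dominated by the
   decrements of the iterates, whose sum converges: so P = id, and nearby orbits are
   closed. For e I < 0, w increases at each turn, which excludes P = id and P z > z: so
   P z < z and orbits spiral towards the origin. What remains is to pass from the angle to
   the time ([orbit_time]) and from the weighted to the Euclidean polar angle
   ([angle_shiftP]). *)

(** * Calculus on the real line *)

Section Calculus.
Variable R : realType.
Implicit Types (f g : R -> R) (x y a b c d : R).

Definition der f x d := is_derive x (1 : R) f d.

Lemma der_eq f x d d' : der f x d -> d = d' -> der f x d'.
Proof. by move=> h <-. Qed.

Lemma der_ext f g x d : (forall y, f y = g y) -> der f x d -> der g x d.
Proof. by move=> /funext ->. Qed.

Lemma der_cst c x : der (fun=> c) x 0.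
Proof. exact: is_derive_cst. Qed.

Lemma der_id x : der (fun y => y) x 1.
Proof. exact: is_derive_id. Qed.

Lemma der_D f g x d e : der f x d -> der g x e ->
  der (fun y => f y + g y) x (d + e).
Proof. exact: is_deriveD. Qed.

Lemma der_N f x d : der f x d -> der (fun y => - f y) x (- d).
Proof. exact: is_deriveN. Qed.

Lemma der_B f g x d e : der f x d -> der g x e ->
  der (fun y => f y - g y) x (d - e).
Proof. by move=> df dg; apply: der_D => //; apply: der_N. Qed.

Lemma der_M f g x d e : der f x d -> der g x e ->
  der (fun y => f y * g y) x (d * g x + f x * e).
Proof.
move=> df dg; have := @is_deriveM _ _ f g x 1 d e df dg.
by move=> /der_eq; apply; rewrite /GRing.scale /=; ring.
Qed.

Lemma der_Z f x c d : der f x d -> der (fun y => c * f y) x (c * d).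
Proof.
by move=> df; apply: der_eq (der_M (der_cst c x) df) _; rewrite mul0r add0r.
Qed.

Lemma der_X f x d n : der f x d ->
  der (fun y => f y ^+ n) x (n%:R * f x ^+ n.-1 * d).
Proof.
move=> df; have -> : (fun y => f y ^+ n) = f ^+ n.
  by apply/funext => y; rewrite exprfctE.
by apply: der_eq (@is_deriveX _ _ f n x 1 d df) _.
Qed.

Lemma der_V f x d : f x != 0 -> der f x d ->
  der (fun y => (f y)^-1) x (- d / f x ^+ 2).
Proof.
move=> f0 df; apply: der_eq (is_deriveV f0 df) _.
by rewrite /GRing.scale /= !mulNr mulrC.
Qed.

Lemma der_comp f g x d e : der f (g x) d -> der g x e ->
  der (fun y => f (g y)) x (d * e).
Proof. exact: is_derive1_comp. Qed.

Lemma der_sum n (f : 'I_n -> R -> R) x (d : 'I_n -> R) :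
  (forall i, der (f i) x (d i)) ->
  der (fun y => \sum_(i < n) f i y) x (\sum_(i < n) d i).
Proof.
move=> h; have := @is_derive_sum _ _ _ n f x 1 d h.
have -> // : \sum_(i < n) f i = fun y => \sum_(i < n) f i y.
by apply/funext => y; rewrite fct_sumE.
Qed.

Lemma der_cont f x d : der f x d -> {for x, continuous f}.
Proof.
by move=> [df _]; apply/differentiable_continuous/derivable1_diffP.
Qed.

Lemma der_MVT f (df : R -> R) a b : a <= b ->
  (forall x, a <= x <= b -> der f x (df x)) ->
  exists2 c, a <= c <= b & f b - f a = df c * (b - a).
Proof.
move=> ab h.
have [||c cab ->] := @MVT_segment R f df a b ab.
- by move=> x /[!in_itv]/= /andP[ax xb]; apply: h; rewrite !ltW.
- apply: continuous_in_subspaceT => x; rewrite inE /= in_itv /= => xab.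
  exact: der_cont (h x xab).
- by exists c => //; move: cab; rewrite in_itv.
Qed.

Lemma der_bound f (df : R -> R) a b M :
  (forall x, Num.min a b <= x <= Num.max a b -> der f x (df x)) ->
  (forall x, Num.min a b <= x <= Num.max a b -> `|df x| <= M) ->
  `|f b - f a| <= M * `|b - a|.
Proof.
wlog ab : a b / a <= b.
  move=> H; case/orP: (le_total a b); first exact: H.
  move=> ba h1 h2; rewrite distrC (distrC b).
  by apply: H => // x; rewrite minC maxC; auto.
rewrite min_l // max_r // => h1 h2.
have [c cab ->] := der_MVT ab h1.
by rewrite normrM ler_wpM2r // h2.
Qed.

Lemma der_ge0_le f (df : R -> R) a b : a <= b ->
  (forall x, a <= x <= b -> der f x (df x)) ->
  (forall x, a <= x <= b -> 0 <= df x) -> f a <= f b.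
Proof.
move=> ab h1 h2; have [c cab e] := der_MVT ab h1.
by rewrite -subr_ge0 e mulr_ge0 ?h2 // subr_ge0.
Qed.

Lemma der_eq_diff f g (d : R -> R) a b : a <= b ->
  (forall x, a <= x <= b -> der f x (d x)) ->
  (forall x, a <= x <= b -> der g x (d x)) -> f b - f a = g b - g a.
Proof.
move=> ab h1 h2.
have [c cab e] := @der_MVT (fun x => f x - g x) (fun x => d x - d x) a b ab
  (fun x xab => der_B (h1 x xab) (h2 x xab)).
by move: e; rewrite subrr mul0r => e; lra.
Qed.

Lemma contP f x : {for x, continuous f} <->
  forall e, 0 < e -> exists2 d, 0 < d & forall y, `|y - x| < d -> `|f y - f x| < e.
Proof.
split.
- move=> fx e e0.
  have /cvgrPdist_lt/(_ e e0) := fx => /nbhs_ballP[d d0 h].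
  exists d => // y yx; rewrite distrC; apply: h.
  by rewrite /ball /= distrC.
- move=> h; apply/cvgrPdist_lt => e e0.
  have [d d0 hd] := h e e0; apply/nbhs_ballP; exists d => // y.
  by rewrite /ball /= distrC => yx; rewrite distrC; exact: hd.
Qed.

Lemma derP f x d : der f x d <->
  forall e, 0 < e -> exists2 r, 0 < r & forall y, `|y - x| < r ->
    `|f y - f x - d * (y - x)| <= e * `|y - x|.
Proof.
split.
- move=> /is_derive1_caratheodory[g [fg /contP cg <-]] e e0.
  have [r r0 hr] := cg e e0; exists r => // y yx.
  by rewrite fg -mulrBl normrM ler_wpM2r // ltW // hr.
- move=> h; apply/is_derive1_caratheodory.
  exists (fun y => if y == x then d else (f y - f x) / (y - x)); split.
  + move=> y; case: eqP => [->|/eqP]; first by rewrite !subrr mulr0.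
    by rewrite -subr_eq0 => yx; rewrite divfK.
  + apply/contP => e e0; have [r r0 hr] := h (e / 2) ltac:(lra).
    exists r => // y yx; rewrite eqxx; case: eqP => [_|/eqP].
      by rewrite subrr normr0.
    rewrite -subr_eq0 => yx0; rewrite -(ltr_pM2r (x := `|y - x|)) ?normr_gt0 //.
    rewrite -normrM mulrBl divfK //; apply: le_lt_trans (hr y yx) _.
    by rewrite ltr_pM2r ?normr_gt0 //; lra.
  + by rewrite eqxx.
Qed.
End Calculus.

Section Continuity.
Variable R : realType.
Implicit Types (f g : R -> R) (x y a b c d : R).

Lemma contD f g x : {for x, continuous f} -> {for x, continuous g} ->
  {for x, continuous (fun y => f y + g y)}.
Proof. exact: continuousD. Qed.

Lemma contN f x : {for x, continuous f} -> {for x, continuous (fun y => - f y)}.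
Proof. exact: continuousN. Qed.

Lemma contB f g x : {for x, continuous f} -> {for x, continuous g} ->
  {for x, continuous (fun y => f y - g y)}.
Proof. exact: continuousB. Qed.

Lemma contM f g x : {for x, continuous f} -> {for x, continuous g} ->
  {for x, continuous (fun y => f y * g y)}.
Proof. exact: continuousM. Qed.

Lemma contV f x : f x != 0 -> {for x, continuous f} ->
  {for x, continuous (fun y => (f y)^-1)}.
Proof. exact: continuousV. Qed.

Lemma cont_cst c x : {for x, continuous (fun=> c)}.
Proof. exact: cst_continuous. Qed.

Lemma cont_id x : {for x, continuous (fun y : R => y)}.
Proof. by []. Qed.

Lemma contX f n x : {for x, continuous f} -> {for x, continuous (fun y => f y ^+ n)}.
Proof.
move=> cf; elim: n => [|n IH].
  have -> : (fun y => f y ^+ 0) = fun=> 1 by apply/funext => y; rewrite expr0.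
  exact: cont_cst.
have -> : (fun y => f y ^+ n.+1) = fun y => f y * f y ^+ n.
  by apply/funext => y; rewrite exprS.
exact: contM.
Qed.

Lemma cont_comp f g x : {for x, continuous g} -> {for g x, continuous f} ->
  {for x, continuous (fun y => f (g y))}.
Proof. exact: continuous_comp. Qed.

Lemma der_local f g x d r : 0 < r -> (forall y, `|y - x| < r -> f y = g y) ->
  der f x d -> der g x d.
Proof.
move=> r0 fg /derP h; apply/derP => e e0; have [s s0 hs] := h e e0.
exists (Num.min r s); first by rewrite lt_min r0.
move=> y; rewrite lt_min => /andP[yr ys].
by rewrite -!fg //; [exact: hs | rewrite subrr normr0].
Qed.

(** For orbits made of several arcs. *)
Lemma der_glue f g1 g2 a d :
  (forall y, y <= a -> f y = g1 y) -> (forall y, a <= y -> f y = g2 y) ->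
  der g1 a d -> der g2 a d -> der f a d.
Proof.
move=> e1 e2 /derP h1 /derP h2; apply/derP => e e0.
have [r r0 hr] := h1 e e0; have [s s0 hs] := h2 e e0.
exists (Num.min r s); first by rewrite lt_min r0.
move=> y; rewrite lt_min => /andP[yr ys].
case/orP: (le_total y a) => ya.
- by rewrite !e1 //; exact: hr.
- by rewrite !e2 //; exact: hs.
Qed.

Lemma IVTle f a b v : a <= b ->
  (forall x, a <= x <= b -> {for x, continuous f}) -> f a <= v <= f b ->
  exists2 c, a <= c <= b & f c = v.
Proof.
move=> ab cf /andP[av vb].
have [||c cab fc] := @IVT R f a b v ab.
- apply: continuous_in_subspaceT => x; rewrite inE /= in_itv /=; exact: cf.
- by rewrite min_l ?max_r ?av //; apply: le_trans vb.
- by exists c => //; move: cab; rewrite in_itv.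
Qed.

Lemma EVTbound f a b : a <= b -> (forall x, a <= x <= b -> {for x, continuous f}) ->
  exists2 M, 0 < M & forall x, a <= x <= b -> `|f x| <= M.
Proof.
move=> ab cf.
have [|c _ hc] := @EVT_max R (fun x => `|f x|) a b ab.
  apply: continuous_in_subspaceT => x; rewrite inE /= in_itv /= => xab.
  by apply: continuous_comp; [exact: cf | exact: norm_continuous].
exists (`|f c| + 1); first by rewrite ltr_wpDl.
move=> x xab; apply: le_trans (hc x _) _; first by rewrite in_itv.
by rewrite lerDl.
Qed.

Lemma EVTpos f a b : a <= b -> (forall x, a <= x <= b -> {for x, continuous f}) ->
  (forall x, a <= x <= b -> 0 < f x) ->
  exists2 m, 0 < m & forall x, a <= x <= b -> m <= f x.
Proof.
move=> ab cf f0.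
have [|c cab hc] := @EVT_min R f a b ab.
  apply: continuous_in_subspaceT => x; rewrite inE /= in_itv /=; exact: cf.
exists (f c); first by apply: f0; move: cab; rewrite in_itv.
by move=> x xab; apply: hc; rewrite in_itv.
Qed.

Lemma prim_segment f a b : a < b -> continuous f ->
  exists G : R -> R, forall x, a < x < b -> der G x (f x).
Proof.
move=> ab cf.
exists (fun x => (\int[lebesgue_measure]_(s in `[a, x]) f s)%R) => x /andP[ax xb].
have [|df e] := @continuous_FTC1_closed R f a x b xb _ ax (cf x).
  apply: continuous_compact_integrable; first exact: segment_compact.
  exact: continuous_subspaceT.
by apply: (@DeriveDef _ _ _ _ _ _ _ df); rewrite -derive1E.
Qed.

(** Integrals from the left end of growing intervals have the right derivative there;
   normalized at 0, they agree on overlaps. *)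
Lemma primitive f : continuous f ->
  exists2 G : R -> R, G 0 = 0 & forall x, der G x (f x).
Proof.
move=> cf.
have /choice[G hG] : forall n : nat, exists G : R -> R,
    forall x, - n.+1%:R < x < n.+1%:R -> der G x (f x).
  by move=> n; apply: prim_segment => //; rewrite gtrN.
have key n m x : `|x| < n.+1%:R -> `|x| < m.+1%:R ->
    G n x - G n 0 = G m x - G m 0.
  rewrite !ltr_norml => /andP[n1 n2] /andP[m1 m2].
  have h0 k : 0 < k.+1%:R :> R by [].
  have := h0 n; have := h0 m; move=> m0 n0.
  case/orP: (le_total 0 x) => x0.
  - by apply: (der_eq_diff (d := f) x0) => y /andP[y0 yx]; apply: hG; lra.
  - suff : G n 0 - G n x = G m 0 - G m x by move=> e; lra.
    by apply: (der_eq_diff (d := f) x0) => y /andP[y0 yx]; apply: hG; lra.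
have hb (x : R) : `|x| < (Num.bound x).+1%:R.
  have := Num.Theory.archi_boundP (normr_ge0 x); rewrite -natr1.
  have -> : Num.bound `|x| = Num.bound x by rewrite /Num.bound normr_id.
  lra.
exists (fun x => G (Num.bound x) x - G (Num.bound x) 0); first by rewrite subrr.
move=> x; have [n hn] : exists n : nat, `|x| + 1 < n.+1%:R.
  exists (Num.bound (`|x| + 1)); apply: le_lt_trans (hb _).
  exact: ler_norm.
apply: (@der_local (fun y => G n y - G n 0) _ _ _ 1) => //.
  move=> y yx; apply: key => //; apply: lt_trans hn.
  have -> : y = x + (y - x) by ring.
  by apply: le_lt_trans (ler_normD _ _) _; rewrite ltrD2l.
rewrite -[f x]subr0; apply: der_B; last exact: der_cst.
by apply: hG; rewrite -ltr_norml; lra.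
Qed.

Lemma gronwall_ge0 (d d' : R -> R) L b : 0 <= b ->
  (forall x, 0 <= x <= b -> der d x (d' x)) ->
  (forall x, 0 <= x <= b -> d' x <= L * d x) -> d 0 <= 0 -> d b <= 0.
Proof.
move=> b0 hd hL d0.
have dexp x : der (fun y => expR (- (L * y))) x (expR (- (L * x)) * - L).
  apply: (@der_comp _ (@expR R) (fun y => - (L * y))); first exact: is_derive_expR.
  by apply: der_eq (der_N (der_Z L (der_id x))) _; rewrite mulr1.
have h : d b * expR (- (L * b)) <= d 0 * expR (- (L * 0)).
  rewrite -lerN2; pose g' x := - (d' x * expR (- (L * x)) + d x * (expR (- (L * x)) * - L)).
  apply: (@der_ge0_le _ (fun x => - (d x * expR (- (L * x)))) g' 0 b) => // x x0b.
    by apply: der_N; apply: der_M; [exact: hd | exact: dexp].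
  have -> : g' x = (L * d x - d' x) * expR (- (L * x)) by rewrite /g'; ring.
  by rewrite mulr_ge0 ?expR_ge0 // subr_ge0 hL.
have : d b * expR (- (L * b)) <= 0.
  by apply: le_trans h _; rewrite mulr0 oppr0 expR0 mulr1.
by rewrite pmulr_lle0 // expR_gt0.
Qed.

(** Multiplied by exp (- L x), d does not increase to the right of 0; the left side is
   obtained by reversing x. *)
Lemma gronwall (d d' : R -> R) L b : (forall x, 0 <= d x) ->
  (forall x, Num.min 0 b <= x <= Num.max 0 b -> der d x (d' x)) ->
  (forall x, Num.min 0 b <= x <= Num.max 0 b -> `|d' x| <= L * d x) ->
  d 0 = 0 -> d b = 0.
Proof.
move=> dge hd hL d0; apply/le_anti; rewrite dge andbT.
case/orP: (le_total 0 b) => b0.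
- rewrite min_l ?max_r // in hd hL.
  apply: (gronwall_ge0 (d' := d') (L := L)) => //; last by rewrite d0.
  by move=> x xb; apply: le_trans (hL x xb); exact: ler_norm.
- rewrite min_r ?max_l // in hd hL.
  rewrite -[b]opprK.
  apply: (@gronwall_ge0 (fun x => d (- x)) (fun x => d' (- x) * -1) L).
  + by rewrite oppr_ge0.
  + move=> x xb; apply: (@der_comp _ d (fun y => - y)); last exact: der_N (der_id _).
    by apply: hd; lra.
  + move=> x xb; have := hL (- x); rewrite ler_norml mulrN1 => h.
    have h' : b <= - x <= 0 by lra.
    by have /andP[h1 h2] := h h'; lra.
  + by rewrite oppr0 d0.
Qed.

(** The mean value inequality for f_ n - g x * id bounds its increments near x by a
   small slope which does not depend on n, and the bound passes to the limit. *)
Lemma der_uniform_limit (f_ g_ : nat -> R -> R) f g x r : 0 < r ->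
  (forall n y, `|y - x| < r -> der (f_ n) y (g_ n y)) ->
  (forall n, {for x, continuous (g_ n)}) ->
  (forall e, 0 < e -> exists n, forall y, `|y - x| < r ->
     `|f_ n y - f y| <= e /\ `|g_ n y - g y| <= e) ->
  der f x (g x).
Proof.
move=> r0 hd hc hl; apply/derP => e e0.
have e80 : 0 < e / 8 by lra.
have [m hm] := hl _ e80.
have /contP/(_ _ e80)[s s0 hs] := hc m.
exists (Num.min r s); first by rewrite lt_min r0.
move=> y; rewrite lt_min => /andP[yr ys].
have xx : `|x - x| < r by rewrite subrr normr0.
have [->|yx] := eqVneq y x; first by rewrite !subrr mulr0 subrr normr0 mulr0.
have yx0 : 0 < `|y - x| by rewrite normr_gt0 subr_eq0.
have e'0 : 0 < Num.min (e / 8) (e / 8 * `|y - x|) by rewrite lt_min e80 mulr_gt0.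
have [n hn] := hl _ e'0.
have hxx : `|g_ n x - g x| <= e / 8.
  by apply: le_trans (hn x xx).2 _; rewrite ge_min lexx.
have step : `|(f_ n y - g x * y) - (f_ n x - g x * x)| <= (e / 2) * `|y - x|.
  apply: (@der_bound _ (fun z => f_ n z - g x * z) (fun z => g_ n z - g x * 1)).
    move=> z hz; apply: der_B; last by apply: der_Z; exact: der_id.
    apply: hd; move: hz yr; rewrite ltr_norml ltr_norml.
    by case/orP: (le_total x y) => xy;
      rewrite ?(min_l xy) ?(max_r xy) ?(min_r xy) ?(max_l xy); lra.
  move=> z hz.
  have zz : `|z - x| < r /\ `|z - x| < s.
    move: hz yr ys; rewrite !ltr_norml.
    by case/orP: (le_total x y) => xy;
      rewrite ?(min_l xy) ?(max_r xy) ?(min_r xy) ?(max_l xy); lra.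
  have h1 := (hn z zz.1).2; have h2 := (hm z zz.1).2; have h3 := hs z zz.2.
  have h4 := (hm x xx).2.
  have h1' : `|g_ n z - g z| <= e / 8.
    by apply: le_trans h1 _; rewrite ge_min lexx.
  move: h1' h2 h3 h4; rewrite !ler_norml !ltr_norml; lra.
have hy := (hn y yr).1; have hx := (hn x xx).1.
have hm' (w : R) : `|w| <= Num.min (e / 8) (e / 8 * `|y - x|) -> `|w| <= e / 8 * `|y - x|.
  by move=> h; apply: le_trans h _; rewrite ge_min lexx orbT.
move: (hm' _ hy) (hm' _ hx) step; set D := `|y - x|.
by rewrite !ler_norml mulrBr; lra.
Qed.

(** The bound below on the slope makes tau unbounded on both sides, hence onto by the
   intermediate value theorem. *)
Lemma increasing_inverse (tau k : R -> R) k0 : 0 < k0 ->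
  (forall x, k0 <= k x) -> (forall x, der tau x (k x)) ->
  exists psi : R -> R, [/\ forall s, tau (psi s) = s, forall x, psi (tau x) = x,
    {homo psi : x y / x < y} & forall s, der psi s (k (psi s))^-1].
Proof.
move=> k00 hk hd.
have ctau x : {for x, continuous tau} by apply: der_cont (hd x).
have grow a b : a <= b -> k0 * (b - a) <= tau b - tau a.
  move=> ab; have [c _ ->] := der_MVT ab (fun x _ => hd x).
  by rewrite ler_wpM2r ?subr_ge0.
have surj s : exists x, tau x = s.
  pose B := (`|s| + `|tau 0|) / k0 + 1.
  have B0 : 0 <= B by rewrite addr_ge0 // divr_ge0 ?addr_ge0 // ltW.
  have kB : `|s| + `|tau 0| <= k0 * B.
    by rewrite /B mulrDr mulr1 mulrCA divff ?gt_eqF // mulr1 lerDl ltW.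
  have B1 : - B <= B by lra.
  have [|c _ hc] := @IVTle tau (- B) B s B1 (fun x _ => ctau x).
    have h1 := grow 0 B B0; have h2 : k0 * B <= tau 0 - tau (- B).
      by have := grow (- B) 0; rewrite sub0r opprK; apply; lra.
    rewrite subr0 in h1.
    have n1 := ler_norm s; have n2 := ler_norm (tau 0).
    have n3 := ler_norm (- s); have n4 := ler_norm (- tau 0).
    rewrite normrN in n3; rewrite normrN in n4.
    by apply/andP; split; lra.
  by exists c.
have [psi hpsi] := choice surj.
have inj0 x y : tau x = tau y -> x <= y -> x = y.
  move=> e xy; have := grow _ _ xy; rewrite e subrr pmulr_rle0 // subr_le0 => yx.
  by apply/le_anti; rewrite xy.
have inj x y : tau x = tau y -> x = y.
  by move=> e; case/orP: (le_total x y) => xy; [|apply/esym]; apply: inj0.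
have psiK x : psi (tau x) = x by apply: inj; rewrite hpsi.
exists psi; split => //.
- move=> x y xy; rewrite ltNge; apply/negP => yx.
  by have := grow _ _ yx; rewrite !hpsi; have : 0 <= k0 * (psi x - psi y);
    [rewrite mulr_ge0 ?subr_ge0 // ltW | lra].
- move=> s; rewrite -{1}[s]hpsi; apply: (@is_derive_inverse R tau psi).
  + by near=> y; exact: psiK.
  + by near=> y; exact: ctau.
  + exact: hd.
  + by rewrite gt_eqF // (lt_le_trans k00).
Unshelve. all: by end_near. Qed.
End Continuity.

(** * Bivariate polynomials *)

Section BivariatePolynomials.
Variable R : realType.
Implicit Types (p q : {poly {poly R}}) (x y a b c : R).

Lemma evD p q x y : (p + q).[x, y] = p.[x, y] + q.[x, y].
Proof. by rewrite !hornerD. Qed.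
Lemma evN p x y : (- p).[x, y] = - p.[x, y].
Proof. by rewrite !hornerN. Qed.
Lemma evB p q x y : (p - q).[x, y] = p.[x, y] - q.[x, y].
Proof. by rewrite evD evN. Qed.
Lemma evM p q x y : (p * q).[x, y] = p.[x, y] * q.[x, y].
Proof. by rewrite !hornerM. Qed.
Lemma evXn p n x y : (p ^+ n).[x, y] = p.[x, y] ^+ n.
Proof. by rewrite !horner_exp. Qed.
Lemma evMn p n x y : (p *+ n).[x, y] = p.[x, y] *+ n.
Proof. by rewrite !hornerMn. Qed.
Lemma evX x y : ('X : {poly {poly R}}).[x, y] = x.
Proof. by rewrite hornerX hornerC. Qed.
Lemma evY x y : ('Y : {poly {poly R}}).[x, y] = y.
Proof. by rewrite hornerC hornerX. Qed.
Lemma evC c x y : (c%:P%:P : {poly {poly R}}).[x, y] = c.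
Proof. by rewrite !hornerC. Qed.
Lemma evZ c p x y : (c%:P *: p).[x, y] = c * p.[x, y].
Proof. by rewrite hornerZ hornerM hornerC. Qed.
Lemma ev_sum I (s : seq I) P (F : I -> {poly {poly R}}) x y :
  (\sum_(i <- s | P i) F i).[x, y] = \sum_(i <- s | P i) (F i).[x, y].
Proof. by rewrite !horner_sum. Qed.

Lemma dX_coef p i j : (dX p)`_i`_j = p`_i.+1`_j *+ i.+1.
Proof. by rewrite /dX coef_deriv coefMn. Qed.
Lemma dY_coef p i j : (dY p)`_i`_j = p`_i`_j.+1 *+ j.+1.
Proof. by rewrite /dY coef_map_id0 ?deriv0 // coef_deriv. Qed.

Lemma bipoly_eqP p q : (forall i j, p`_i`_j = q`_i`_j) -> p = q.
Proof. by move=> h; apply/polyP => i; apply/polyP => j; exact: h. Qed.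

Lemma bipoly_ind (P : {poly {poly R}} -> Prop) :
  (forall c, P c%:P%:P) -> P 'X -> P 'Y ->
  (forall p q, P p -> P q -> P (p + q)) ->
  (forall p q, P p -> P q -> P (p * q)) -> forall p, P p.
Proof.
move=> hC hX hY hD hM; apply: poly_ind => [|p c hp].
  by have := hC 0; rewrite !polyC0.
apply: (hD); first exact: (hM).
elim/poly_ind: c => [|c a hc]; first by have := hC 0; rewrite polyC0.
by rewrite polyCD polyCM; apply: hD => //; exact: hM.
Qed.

Lemma der_ev p (u v : R -> R) s du dv : der u s du -> der v s dv ->
  der (fun s => p.[u s, v s]) s
      ((dX p).[u s, v s] * du + (dY p).[u s, v s] * dv).
Proof.
move=> hu hv; elim/poly_ind: p => [|p c hp].
  apply: der_ext (der_eq (der_cst 0 s) _) => [y|]; first by rewrite !horner0.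
  rewrite /dX /dY deriv0 map_poly0 !horner0; ring.
have eY : dY (p * 'X + c%:P) = dY p * 'X + (c^`())%:P.
  apply: bipoly_eqP => i j; rewrite dY_coef !coefD !coefMX !coefC.
  by case: i => [|i] /=; rewrite ?coefD ?add0r ?addr0 ?coef0 ?add0r ?addr0
    ?dY_coef ?coef_deriv.
have eX : dX (p * 'X + c%:P) = dX p * 'X + p.
  by rewrite /dX derivD derivM derivX derivC addr0 mulr1.
have e z : (p * 'X + c%:P).[u z, v z] = p.[u z, v z] * u z + c.[v z].
  by rewrite evD evM evX hornerC.
apply: (@der_ext _ (fun z => p.[u z, v z] * u z + c.[v z])) => [z|]; first by rewrite e.
have hc : der (fun z => c.[v z]) s (c^`().[v s] * dv).
  by apply: (@der_comp _ (horner c) v) => //; exact: is_derive_poly.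
apply: der_eq (der_D (der_M hp hu) hc) _.
by rewrite eX eY !evD !evM !evX hornerC; ring.
Qed.

Lemma continuous_ev p (u v : R -> R) s : {for s, continuous u} ->
  {for s, continuous v} -> {for s, continuous (fun s => p.[u s, v s])}.
Proof.
move=> cu cv; elim/bipoly_ind: p => [c|||p q hp hq|p q hp hq].
- have -> : (fun s => (c%:P%:P).[u s, v s]) = cst c by apply/funext => z; rewrite evC.
  exact: cst_continuous.
- by have -> : (fun s => 'X.[u s, v s]) = u by apply/funext => z; rewrite evX.
- by have -> : (fun s => 'Y.[u s, v s]) = v by apply/funext => z; rewrite evY.
- have -> : (fun s => (p + q).[u s, v s]) =
    (fun s => p.[u s, v s]) + (fun s => q.[u s, v s]).
    by apply/funext => z; rewrite evD.
  exact: continuousD.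
- have -> : (fun s => (p * q).[u s, v s]) =
    (fun s => p.[u s, v s]) * (fun s => q.[u s, v s]).
    by apply/funext => z; rewrite evM.
  exact: continuousM.
Qed.

Lemma ev_bounded p B : exists2 M, 0 <= M & forall x y, `|x| <= B -> `|y| <= B ->
  `|p.[x, y]| <= M.
Proof.
elim/bipoly_ind: p => [c|||p q [M M0 hM] [N N0 hN]|p q [M M0 hM] [N N0 hN]].
- by exists `|c| => // x y _ _; rewrite evC.
- by exists `|B| => // x y xB _; rewrite evX (le_trans xB) // ler_norm.
- by exists `|B| => // x y _ yB; rewrite evY (le_trans yB) // ler_norm.
- exists (M + N); first exact: addr_ge0.
  by move=> x y xB yB; rewrite evD (le_trans (ler_normD _ _)) // lerD ?hM ?hN.
- exists (M * N); first exact: mulr_ge0.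
  by move=> x y xB yB; rewrite evM normrM ler_pM ?hM ?hN.
Qed.

Lemma ev_lipschitz p B : exists2 L, 0 <= L & forall x y a b,
  `|x| <= B -> `|y| <= B -> `|a| <= B -> `|b| <= B ->
  `|p.[x, y] - p.[a, b]| <= L * (`|x - a| + `|y - b|).
Proof.
elim/bipoly_ind: p => [c|||p q [L L0 hL] [M M0 hM]|p q [L L0 hL] [M M0 hM]].
- by exists 0 => // x y a b _ _ _ _; rewrite !evC subrr normr0 mul0r.
- by exists 1 => // x y a b _ _ _ _; rewrite !evX mul1r lerDl.
- by exists 1 => // x y a b _ _ _ _; rewrite !evY mul1r lerDr.
- exists (L + M); first exact: addr_ge0.
  move=> x y a b h1 h2 h3 h4; rewrite !evD opprD addrACA mulrDl.
  by rewrite (le_trans (ler_normD _ _)) // lerD ?hL ?hM.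
- have [K K0 hK] := ev_bounded p B; have [N N0 hN] := ev_bounded q B.
  exists (L * N + K * M); first by rewrite addr_ge0 ?mulr_ge0.
  move=> x y a b h1 h2 h3 h4; rewrite !evM.
  have -> : p.[x, y] * q.[x, y] - p.[a, b] * q.[a, b] =
    (p.[x, y] - p.[a, b]) * q.[x, y] + p.[a, b] * (q.[x, y] - q.[a, b]) by ring.
  rewrite (le_trans (ler_normD _ _)) // !normrM mulrDl lerD //.
    by rewrite mulrAC ler_pM ?hL ?hN.
  by rewrite -mulrA ler_pM ?hK ?hM.
Qed.

Lemma bipoly_bound p : exists N, forall m, (N <= m)%N ->
  [/\ (size p <= m)%N, forall i, (size (p`_i)%R <= m)%N
    & forall x y, p.[x, y] = \sum_(i < m) \sum_(j < m) p`_i`_j * x ^+ i * y ^+ j].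
Proof.
pose N := (size p + \max_(i < size p) size (p`_i)%R)%N.
exists N => m Nm.
have h1 : (size p <= m)%N by apply: leq_trans Nm; rewrite leq_addr.
have h2 i : (size (p`_i)%R <= m)%N.
  case: (ltnP i (size p)) => hi; last by rewrite nth_default // size_poly0.
  apply: leq_trans Nm; rewrite /N.
  have := leq_bigmax (F := fun i : 'I_(size p) => size (p`_i)%R) (Ordinal hi).
  by move=> /= h; apply: leq_trans h _; rewrite leq_addl.
split=> // x y.
rewrite (horner_coef_wide _ h1) horner_sum; apply: eq_bigr => i _.
rewrite hornerM -polyC_exp hornerC (horner_coef_wide _ (h2 i)) mulr_suml.
by apply: eq_bigr => j _; rewrite -!mulrA [y ^+ j * _]mulrC.
Qed.

Lemma poly_nat_eq0 (A : idomainType) (p : {poly A}) :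
  injective (fun n : nat => n%:R : A) -> (forall n : nat, p.[n%:R] = 0) -> p = 0.
Proof.
move=> inj h; apply/eqP; apply/negPn/negP => p0.
pose s := [seq n%:R : A | n <- iota 0 (size p)].
have := max_poly_roots (rs := s) p0; rewrite size_map size_iota ltnn.
have -> : all (root p) s by apply/allP => z /mapP[n _ ->]; apply/rootP.
by rewrite map_inj_uniq // iota_uniq => /(_ isT isT).
Qed.

(** A polynomial has fewer roots than there are integers, first in x and then in y. *)
Lemma bipoly_eq0 p : (forall x y, p.[x, y] = 0) -> p = 0.
Proof.
have injR : injective (fun n : nat => n%:R : R).
  by move=> m n /eqP; rewrite eqr_nat => /eqP.
move=> h; apply: poly_nat_eq0 => [m n|n].
  by rewrite -!polyC_natr => /polyC_inj; exact: injR.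
by apply: poly_nat_eq0 => // m; rewrite -polyC_natr h.
Qed.

(** * Quasi-homogeneous polynomials *)

(** Quasi-homogeneity read on the support; over the reals it amounts to qhomog with a
   natural degree. *)
Definition whomog (t : nat * nat) (n : nat) p :=
  forall i j, p`_i`_j != 0 -> (t.1 * i + t.2 * j)%N = n.

Lemma whomog_ev t n p e x y : whomog t n p ->
  p.[e ^+ t.1 * x, e ^+ t.2 * y] = e ^+ n * p.[x, y].
Proof.
move=> hp; have [N /(_ N (leqnn N))[_ _ hN]] := bipoly_bound p.
rewrite !hN mulr_sumr; apply: eq_bigr => i _; rewrite mulr_sumr.
apply: eq_bigr => j _; have [->|pij] := eqVneq p`_i`_j 0; first by rewrite !mul0r mulr0.
by rewrite -(hp i j pij) !exprMn -!exprM exprD; ring.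
Qed.

Lemma whomog_dX t n p : whomog t (n + t.1) p -> whomog t n (dX p).
Proof.
move=> hp i j; rewrite dX_coef mulrn_eq0 /= => pij.
by have := hp i.+1 j pij; rewrite mulnS; lia.
Qed.

Lemma whomog_dY t n p : whomog t (n + t.2) p -> whomog t n (dY p).
Proof.
move=> hp i j; rewrite dY_coef mulrn_eq0 /= => pij.
by have := hp i j.+1 pij; rewrite mulnS; lia.
Qed.

Lemma euler t n p x y : whomog t n p ->
  t.1%:R * x * (dX p).[x, y] + t.2%:R * y * (dY p).[x, y] = n%:R * p.[x, y].
Proof.
move=> hp.
have e : ('X * dX p) *+ t.1 + ('Y * dY p) *+ t.2 = p *+ n.
  apply: bipoly_eqP => i j; rewrite coefD !coefMn coefD !coefMn.
  have -> : ('X * dX p)`_i`_j = p`_i`_j *+ i.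
    rewrite mulrC coefMX; case: i => [|i] /=; first by rewrite coef0.
    by rewrite dX_coef.
  have -> : ('Y * dY p)`_i`_j = p`_i`_j *+ j.
    rewrite coefCM mulrC coefMX; case: j => [|j] //=.
    by rewrite dY_coef.
  have [->|pij] := eqVneq p`_i`_j 0; first by rewrite !mul0rn addr0.
  by rewrite -!mulrnA -mulrnDr -(hp i j pij) [(i * _)%N]mulnC [(j * _)%N]mulnC.
have := congr1 (fun q : {poly {poly R}} => q.[x, y]) e.
rewrite evD !evMn !evM evX evY -(mulr_natl _ t.1) -(mulr_natl _ t.2) -(mulr_natl _ n) => <-.
by rewrite !mulrA.
Qed.

(** At e = 2 each coefficient is multiplied by a power of 2, and 2 is not a root of unity. *)
Lemma qhomog_coef t (k : int) p : qhomog t k p ->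
  forall i j, p`_i`_j != 0 -> (t.1 * i + t.2 * j)%N%:Z = k.
Proof.
move=> hp; have [N /(_ N (leqnn N))[sz1 sz2 hN]] := bipoly_bound p.
have two : (2 : R) != 0 by [].
pose q : {poly {poly R}} := \poly_(i < N) \poly_(j < N)
   ((2 ^+ t.1) ^+ i * (2 ^+ t.2) ^+ j * p`_i`_j - 2 ^ k * p`_i`_j).
have q0 : q = 0.
  apply: bipoly_eq0 => x y.
  have -> : q.[x, y] = p.[2 ^+ t.1 * x, 2 ^+ t.2 * y] - 2 ^ k * p.[x, y].
    rewrite !hN horner_poly horner_sum mulr_sumr -sumrB; apply: eq_bigr => i _.
    rewrite hornerM -polyC_exp hornerC horner_poly mulr_suml mulr_sumr -sumrB.
    by apply: eq_bigr => j _; rewrite !exprMn; ring.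
  by rewrite hp // subrr.
move=> i j pij.
have iN : (i < N)%N.
  by rewrite ltnNge; apply: contra pij => Ni; rewrite (nth_default _ (leq_trans sz1 Ni)) coef0.
have jN : (j < N)%N.
  by rewrite ltnNge; apply: contra pij => Nj; rewrite (nth_default _ (leq_trans (sz2 i) Nj)).
have : q`_i`_j = 0 by rewrite q0 !coef0.
rewrite coef_poly iN coef_poly jN -mulrBl => /eqP.
rewrite mulf_eq0 (negPf pij) orbF subr_eq0 -!exprM -exprD => /eqP e.
have : (2 : R) ^ (t.1 * i + t.2 * j)%N%:Z = 2 ^ k by rewrite -exprnP.
by apply: (@ieexprIz R 2) => //; rewrite pnatr_eq1.
Qed.

End BivariatePolynomials.

Section Realification.
Variable R : realType.

Lemma ev_toC (p : {poly {poly R}}) (x y : R) :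
  (toC p).[real_complex R x, real_complex R y] = real_complex R p.[x, y].
Proof.
rewrite /toC; have -> : (real_complex R x)%:P = map_poly (real_complex R) x%:P.
  by rewrite map_polyC.
by rewrite horner_map horner_map.
Qed.

Lemma qhomog_toC (t : nat * nat) (k : int) (p : {poly {poly R}}) :
  qhomog t k (toC p) -> qhomog t k p.
Proof.
move=> hp e x y e0.
have := hp (real_complex R e) (real_complex R x) (real_complex R y).
rewrite fmorph_eq0 => /(_ e0).
rewrite -!rmorphXn -!rmorphM ev_toC ev_toC -fmorphXz -rmorphM.
exact: complexI.
Qed.
End Realification.

(** * A norm on polynomials *)

Section PolynomialNorms.
Variable R : realType.
Implicit Types (p q : {poly R}) (z u : R).

Definition pabs p : {poly R} := \poly_(i < size p) `|p`_i|.
(** The l1 norm of the coefficients weighted by powers of z: it is submultiplicative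
   and dominates the values on the disc of radius z. *)
Definition pnorm z p : R := (pabs p).[z].

Lemma pabs_coef p i : (pabs p)`_i = `|p`_i|.
Proof.
by rewrite coef_poly; case: ltnP => // h; rewrite nth_default // normr0.
Qed.

Lemma horner_le p q z : 0 <= z -> (forall i, p`_i <= q`_i) -> p.[z] <= q.[z].
Proof.
move=> z0 h.
rewrite (horner_coef_wide _ (leq_maxl (size p) (size q))).
rewrite (horner_coef_wide _ (leq_maxr (size p) (size q))).
by apply: ler_sum => i _; rewrite ler_wpM2r ?exprn_ge0.
Qed.

Lemma pnormE z p n : (size p <= n)%N -> pnorm z p = \sum_(i < n) `|p`_i| * z ^+ i.
Proof.
move=> pn; rewrite /pnorm (@horner_coef_wide _ n).
  by apply: eq_bigr => i _; rewrite pabs_coef.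
exact: leq_trans (size_poly _ _) pn.
Qed.

Lemma pnorm_ge0 z p : 0 <= z -> 0 <= pnorm z p.
Proof.
by move=> z0; rewrite (pnormE _ (leqnn _)) sumr_ge0 // => i _; rewrite mulr_ge0 ?exprn_ge0.
Qed.

Lemma pnormD z p q : 0 <= z -> pnorm z (p + q) <= pnorm z p + pnorm z q.
Proof.
move=> z0; rewrite /pnorm -hornerD; apply: horner_le => // i.
by rewrite coefD !pabs_coef coefD ler_normD.
Qed.

Lemma pnormN z p : pnorm z (- p) = pnorm z p.
Proof. by congr horner; apply/polyP => i; rewrite !pabs_coef coefN normrN. Qed.

Lemma pnormB z p q : 0 <= z -> pnorm z (p - q) <= pnorm z p + pnorm z q.
Proof. by move=> z0; rewrite -(pnormN z q); exact: pnormD. Qed.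

Lemma pnormZ z c p : pnorm z (c *: p) = `|c| * pnorm z p.
Proof.
by rewrite /pnorm -hornerZ; congr horner; apply/polyP => i;
  rewrite coefZ !pabs_coef coefZ normrM.
Qed.

Lemma pnormM z p q : 0 <= z -> pnorm z (p * q) <= pnorm z p * pnorm z q.
Proof.
move=> z0; rewrite /pnorm -hornerM; apply: horner_le => // i.
rewrite pabs_coef !coefM (le_trans (ler_norm_sum _ _ _)) //.
by apply: ler_sum => j _; rewrite !pabs_coef normrM.
Qed.

Lemma pnorm0 z : pnorm z 0 = 0.
Proof. by rewrite /pnorm (_ : pabs 0 = 0) ?horner0 //; apply/polyP => i; rewrite pabs_coef coef0 normr0. Qed.

Lemma pnormC z c : pnorm z c%:P = `|c|.
Proof.
rewrite /pnorm (_ : pabs c%:P = `|c|%:P) ?hornerC //.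
by apply/polyP => i; rewrite pabs_coef !coefC; case: ifP; rewrite ?normr0.
Qed.

Lemma pnormX z : pnorm z 'X = z.
Proof.
rewrite /pnorm (_ : pabs 'X = 'X) ?hornerX //.
by apply/polyP => i; rewrite pabs_coef coefX; case: (_ == _); rewrite ?normr0 ?normr1.
Qed.

Lemma pnorm_exp z p n : 0 <= z -> pnorm z (p ^+ n) <= pnorm z p ^+ n.
Proof.
move=> z0; elim: n => [|n IH]; first by rewrite !expr0 pnormC normr1.
rewrite !exprS (le_trans (pnormM _ _ z0)) // ler_wpM2l //; exact: pnorm_ge0.
Qed.

Lemma pnorm_sum z n (P : 'I_n -> {poly R}) : 0 <= z ->
  pnorm z (\sum_(i < n) P i) <= \sum_(i < n) pnorm z (P i).
Proof.
move=> z0; elim/big_ind2: _ => [|p a q b pa qb|//]; first by rewrite pnorm0.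
by rewrite (le_trans (pnormD _ _ z0)) // lerD.
Qed.

Lemma pnorm_take z n p : 0 <= z -> pnorm z (take_poly n p) <= pnorm z p.
Proof.
move=> z0; apply: horner_le => // i; rewrite !pabs_coef coef_take_poly.
by case: ifP => // _; rewrite normr0.
Qed.

Lemma coef_le_pnorm z p i : 0 <= z -> `|p`_i| * z ^+ i <= pnorm z p.
Proof.
move=> z0; case: (ltnP i (size p)) => ip; last first.
  by rewrite nth_default // normr0 mul0r pnorm_ge0.
rewrite (pnormE _ (leqnn _)) (bigD1 (Ordinal ip)) //= lerDl sumr_ge0 // => j _.
by rewrite mulr_ge0 ?exprn_ge0.
Qed.

(** Divisibility by a power of the variable, which yields the decay of [horner_tail]. *)
Definition ordp n p := forall i, (i < n)%N -> p`_i = 0.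

Lemma ordpM m n p q : ordp m p -> ordp n q -> ordp (m + n) (p * q).
Proof.
move=> hp hq i imn; rewrite coefM big1 // => j _.
case: (ltnP j m) => jm; first by rewrite hp // mul0r.
by rewrite hq ?mulr0 //; have := ltn_ord j; lia.
Qed.

Lemma ordpD n p q : ordp n p -> ordp n q -> ordp n (p + q).
Proof. by move=> hp hq i ip; rewrite coefD hp ?hq ?addr0. Qed.

Lemma ordp_exp p j : ordp 1 p -> ordp j (p ^+ j).
Proof.
move=> hp; elim: j => [|j IH]; first by move=> i.
by rewrite exprS -add1n; exact: ordpM.
Qed.

Lemma ordp_subX n p q j : ordp n.+1 (p - q) -> ordp 1 p -> ordp 1 q ->
  ordp (n + j) (p ^+ j - q ^+ j).
Proof.
move=> h hp hq; elim: j => [|j IH]; first by rewrite !expr0 subrr => i _; rewrite coef0.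
have -> : p ^+ j.+1 - q ^+ j.+1 = p * (p ^+ j - q ^+ j) + (p - q) * q ^+ j.
  by rewrite !exprS; ring.
apply: ordpD; first by rewrite (_ : (n + j.+1)%N = (1 + (n + j))%N); [exact: ordpM | lia].
rewrite (_ : (n + j.+1)%N = (n.+1 + j)%N); last lia.
by apply: ordpM => //; exact: ordp_exp.
Qed.

Lemma horner_tail n p z u : 0 < z -> `|u| <= z -> ordp n p ->
  `|p.[u]| <= (`|u| / z) ^+ n * pnorm z p.
Proof.
move=> z0 uz hp; rewrite horner_coef (pnormE _ (leqnn _)) mulr_sumr.
rewrite (le_trans (ler_norm_sum _ _ _)) //; apply: ler_sum => i _.
case: (ltnP i n) => ip; first by rewrite hp // mul0r !normr0 mul0r mulr0.
rewrite normrM normrX mulrCA ler_wpM2l // -(subnKC ip) !exprD mulrA -exprMn.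
rewrite divfK ?gt_eqF // ler_wpM2l ?exprn_ge0 // lerXn2r ?nnegrE //.
exact: ltW.
Qed.

Lemma horner_le_pnorm p z u : 0 < z -> `|u| <= z -> `|p.[u]| <= pnorm z p.
Proof.
move=> z0 uz; have := @horner_tail 0 p z u z0 uz.
by rewrite expr0 mul1r; apply.
Qed.

Lemma geo_half_sum (q : R) n : 0 <= q <= 1 / 2 -> \sum_(i < n) q ^+ i <= 2.
Proof.
move=> /andP[q0 q1].
suff : \sum_(i < n) q ^+ i <= 2 - 2 * q ^+ n.
  by move=> h; apply: le_trans h _; rewrite gerBl mulr_ge0 ?exprn_ge0.
elim: n => [|n IH]; first by rewrite big_ord0 expr0; lra.
rewrite big_ord_recr /= exprS.
have : 0 <= q ^+ n by apply: exprn_ge0.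
have : q * q ^+ n <= 1 / 2 * q ^+ n by rewrite ler_wpM2r ?exprn_ge0.
lra.
Qed.

Lemma half_exp_small (e : R) : 0 < e -> exists n : nat, (1 / 2) ^+ n <= e.
Proof.
move=> e0; have h2 : `|1 / 2 : R| < 1 by rewrite ger0_norm; lra.
have := @cvg_expr R (1 / 2) h2.
move=> /cvgrPdist_lt/(_ e e0) [n _ hn]; exists n.
have := hn n (leqnn n); rewrite sub0r normrN ger0_norm; first exact: ltW.
by apply: exprn_ge0; lra.
Qed.

Lemma rate_limit (a e : nat -> R) K : 0 <= K ->
  (forall n m, (n <= m)%N -> `|a m - a n| <= e n) ->
  (forall n, e n <= K * (1 / 2) ^+ n) ->
  exists l, forall n, `|l - a n| <= e n.
Proof.
move=> K0 h he.
have /cvg_ex[l hl] : cvg (a @ \oo).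
  apply/cauchy_cvgP/cauchy_exP => d d0.
  have dK0 : 0 < d / (2 * (K + 1)) by rewrite divr_gt0 //; lra.
  have [n hn] := half_exp_small dK0.
  have hb m : (n <= m)%N -> `|a m - a n| < d / 2.
    move=> nm; apply: le_lt_trans (le_trans (h n m nm) (he n)) _.
    apply: (@le_lt_trans _ _ (K * (d / (2 * (K + 1))))); first by rewrite ler_wpM2l.
    have -> : d / 2 = (K + 1) * (d / (2 * (K + 1))) by field; lra.
    by rewrite ltr_pM2r //; lra.
  exists (a n), n => // m /= nm; rewrite /ball /= distrC.
  by apply: lt_trans (hb m nm) _; lra.
exists l => n; apply/ler_addgt0Pr => d d0.
have /cvgrPdist_lt/(_ d d0)[m _ hm] := hl.
have h1 := hm (maxn m n) (leq_maxl _ _); have h2 := h n (maxn m n) (leq_maxr _ _).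
have -> : l - a n = (l - a (maxn m n)) + (a (maxn m n) - a n) by ring.
by apply: le_trans (ler_normD _ _) _; lra.
Qed.

Lemma half_exp_eq0 (x K : R) : 0 <= K -> (forall n, `|x| <= K * (1 / 2) ^+ n) -> x = 0.
Proof.
move=> K0 h; apply/eqP; rewrite -normr_le0; apply/ler_addgt0Pr => e e0; rewrite add0r.
have eK : 0 < e / (K + 1) by rewrite divr_gt0 //; lra.
have [n hn] := half_exp_small eK.
apply: le_trans (h n) _; apply: (@le_trans _ _ ((K + 1) * (e / (K + 1)))).
  by apply: ler_pM => //; do ?[by apply: exprn_ge0; lra]; lra.
by rewrite mulrC divfK //; lra.
Qed.

Lemma subX_bound (b x y : R) j : 0 < b -> `|x| <= b -> `|y| <= b ->
  `|x ^+ j - y ^+ j| <= (2 * b) ^+ j / b * `|x - y|.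
Proof.
move=> b0 xb yb; elim: j => [|j IH].
  by rewrite !expr0 subrr normr0 mulr_ge0 // divr_ge0 // ltW.
have -> : x ^+ j.+1 - y ^+ j.+1 = x * (x ^+ j - y ^+ j) + (x - y) * y ^+ j.
  by rewrite !exprS; ring.
apply: le_trans (ler_normD _ _) _; rewrite !normrM.
have h1 : `|x| * `|x ^+ j - y ^+ j| <= b * ((2 * b) ^+ j / b * `|x - y|).
  by apply: ler_pM.
have h2 : `|y ^+ j| <= (2 * b) ^+ j.
  rewrite normrX; apply: lerXn2r; rewrite ?nnegrE //; first by rewrite mulr_ge0 ?ltW.
  by apply: le_trans yb _; lra.
have h3 : `|x - y| * `|y ^+ j| <= `|x - y| * (2 * b) ^+ j by apply: ler_wpM2l.
apply: le_trans (lerD h1 h3) _; rewrite exprS.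
have -> : 2 * b * (2 * b) ^+ j / b * `|x - y| = 2 * ((2 * b) ^+ j * `|x - y|).
  by field; rewrite gt_eqF.
have -> : b * ((2 * b) ^+ j / b * `|x - y|) = (2 * b) ^+ j * `|x - y|.
  by field; rewrite gt_eqF.
lra.
Qed.
End PolynomialNorms.

(** * Quantitative expansions in power series *)

Section Expansions.
Variable R : realType.
Implicit Types (p q : {poly R}) (z u : R).

(** Analyticity of f on the right of 0, expressed by the rate of convergence of the
   partial sums rather than by a limit: uniformity in a parameter is then uniformity of
   C and k. *)
Definition expands (C k : R) (a : nat -> R) (f : R -> R) : Prop :=
  (forall n, `|a n| <= C * k ^+ n) /\
  (forall u n, 0 < u -> k * u <= 1 ->
     `|f u - (\poly_(i < n) a i).[u]| <= C * (k * u) ^+ n).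

Lemma continuous_ext (f g : R -> R) : (forall s, f s = g s) ->
  continuous f -> continuous g.
Proof. by move=> /funext ->. Qed.

Lemma continuous_bigsum n (F : 'I_n -> R -> R) : (forall j, continuous (F j)) ->
  continuous (fun s => \sum_(j < n) F j s).
Proof.
elim: n F => [|n IH] F hF.
  apply: (@continuous_ext (fun=> 0)); last by move=> s; exact: cst_continuous.
  by move=> s; rewrite big_ord0.
apply: (@continuous_ext (F ord0 + (fun s => \sum_(j < n) F (lift ord0 j) s))).
  by move=> s; rewrite big_ord_recl.
move=> s; apply: contD; first exact: hF.
by apply: IH => j; exact: hF.
Qed.

Definition coefs_cont (P : R -> {poly R}) : Prop :=
  forall i, continuous (fun s => (P s)`_i).

Lemma coefs_cont_ext P Q : (forall s, P s = Q s) -> coefs_cont P -> coefs_cont Q.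
Proof. by move=> /funext ->. Qed.

Lemma coefs_cont_cst p : coefs_cont (fun=> p).
Proof. by move=> i s; exact: cst_continuous. Qed.

Lemma coefs_contM P Q : coefs_cont P -> coefs_cont Q ->
  coefs_cont (fun s => P s * Q s).
Proof.
move=> hP hQ i.
apply: (@continuous_ext (fun s => \sum_(j < i.+1) (P s)`_j * (Q s)`_(i - j))).
  by move=> s; rewrite coefM.
apply: continuous_bigsum => j s.
by apply: contM; [exact: hP | exact: hQ].
Qed.

Lemma coefs_contX P n : coefs_cont P -> coefs_cont (fun s => P s ^+ n).
Proof.
move=> hP; elim: n => [|n IH]; first exact: coefs_cont_cst.
apply: (@coefs_cont_ext (fun s => P s * P s ^+ n)) => [s|]; first by rewrite exprS.
exact: coefs_contM.
Qed.

Lemma coefs_contD P Q : coefs_cont P -> coefs_cont Q ->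
  coefs_cont (fun s => P s + Q s).
Proof.
move=> hP hQ i.
apply: (@continuous_ext ((fun s => (P s)`_i) + (fun s => (Q s)`_i))).
  by move=> s; rewrite coefD.
by move=> s; apply: contD; [exact: hP | exact: hQ].
Qed.

Lemma coefs_contN P : coefs_cont P -> coefs_cont (fun s => - P s).
Proof.
move=> hP i; apply: (@continuous_ext (- (fun s => (P s)`_i))).
  by move=> s; rewrite coefN.
by move=> s; apply: contN; exact: hP.
Qed.

Lemma coefs_contZ (c : R -> R) P : continuous c -> coefs_cont P ->
  coefs_cont (fun s => c s *: P s).
Proof.
move=> hc hP i; apply: (@continuous_ext (c * (fun s => (P s)`_i))).
  by move=> s; rewrite coefZ.
by move=> s; apply: contM; [exact: hc | exact: hP].
Qed.

Lemma coefs_cont_take n P : coefs_cont P -> coefs_cont (fun s => take_poly n (P s)).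
Proof.
move=> hP i; apply: (@continuous_ext (fun s => if (i < n)%N then (P s)`_i else 0)).
  by move=> s; rewrite coef_take_poly.
by case: (i < n)%N; [exact: hP | move=> s; exact: cst_continuous].
Qed.

Lemma coefs_cont_poly n (a : nat -> R -> R) : (forall i, continuous (a i)) ->
  coefs_cont (fun s => \poly_(i < n) a i s).
Proof.
move=> ha i; apply: (@continuous_ext (fun s => if (i < n)%N then a i s else 0)).
  by move=> s; rewrite coef_poly.
by case: (i < n)%N; [exact: ha | move=> s; exact: cst_continuous].
Qed.

Lemma coefs_cont_sum n (P : 'I_n -> R -> {poly R}) : (forall j, coefs_cont (P j)) ->
  coefs_cont (fun s => \sum_(j < n) P j s).
Proof.
move=> hP i; apply: (@continuous_ext (fun s => \sum_(j < n) (P j s)`_i)).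
  by move=> s; rewrite coef_sum.
by apply: continuous_bigsum => j; exact: hP.
Qed.

Lemma pnorm_psum C k (a : nat -> R) n z : 0 <= z -> 0 <= C -> 0 <= k ->
  (forall n, `|a n| <= C * k ^+ n) -> k * z <= 1 / 2 ->
  pnorm z (\poly_(i < n) a i) <= 2 * C.
Proof.
move=> z0 C0 k0 ha kz; rewrite (pnormE _ (size_poly _ _)).
apply: (@le_trans _ _ (\sum_(i < n) C * (k * z) ^+ i)).
  apply: ler_sum => i _; rewrite coef_poly ltn_ord exprMn mulrA.
  by rewrite ler_wpM2r ?exprn_ge0.
rewrite -mulr_sumr mulrC ler_wpM2r //; apply: geo_half_sum.
by rewrite mulr_ge0.
Qed.

Lemma pnorm_psum1 C k (a : nat -> R) n z : 0 <= z -> 0 <= C -> 0 <= k ->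
  (forall n, `|a n| <= C * k ^+ n) -> a 0%N = 0 -> k * z <= 1 / 2 ->
  pnorm z (\poly_(i < n) a i) <= 2 * C * (k * z).
Proof.
move=> z0 C0 k0 ha a0 kz; rewrite (pnormE _ (size_poly _ _)).
have kz0 : 0 <= k * z by rewrite mulr_ge0.
case: n => [|n]; first by rewrite big_ord0 !mulr_ge0.
rewrite big_ord_recl coef_poly /= a0 normr0 mul0r add0r.
apply: (@le_trans _ _ (\sum_(i < n) (C * (k * z)) * (k * z) ^+ i)).
  apply: ler_sum => i _; rewrite coef_poly /bump /= add1n ltnS ltn_ord.
  by rewrite -mulrA -exprS exprMn mulrA ler_wpM2r ?exprn_ge0.
rewrite -mulr_sumr.
have := geo_half_sum n (q := k * z); rewrite kz0 kz => /(_ isT) h.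
have -> : 2 * C * (k * z) = C * (k * z) * 2 by ring.
by apply: ler_wpM2l => //; exact: mulr_ge0.
Qed.

Lemma coef_psumM n (a : nat -> R) p i : (i < n)%N ->
  ((\poly_(j < n) a j) * p)`_i = \sum_(j < i.+1) a j * p`_(i - j).
Proof.
move=> ni; rewrite coefM; apply: eq_bigr => j _; rewrite coef_poly.
by rewrite (leq_trans (ltn_ord j)).
Qed.

(** * Quotients of expansions *)

(** Division by increasing powers: each step determines one more coefficient. *)
Fixpoint quot_poly (num den : nat -> R) (n : nat) : {poly R} :=
  if n is m.+1 then
    (den 0%N)^-1 *: take_poly m.+1 (\poly_(i < m.+1) num i -
      (\poly_(i < m.+1) (if i is 0 then 0 else den i)) * quot_poly num den m)
  else 0.

Definition quot_series (num den : nat -> R) (n : nat) : R :=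
  (quot_poly num den n.+1)`_n.

Lemma quot_poly_coefS num den n i : (i <= n)%N ->
  (quot_poly num den n.+1)`_i = (den 0%N)^-1 * (num i -
    \sum_(j < i.+1) (if (j : nat) is 0 then 0 else den j) * (quot_poly num den n)`_(i - j)).
Proof.
move=> ni; rewrite /= coefZ coef_take_poly ltnS ni coefB coef_poly ltnS ni.
by rewrite (@coef_psumM n.+1 (fun j => if j is 0 then 0 else den j)).
Qed.

Lemma quot_poly_stable num den n i : (i < n)%N ->
  (quot_poly num den n.+1)`_i = (quot_poly num den n)`_i.
Proof.
elim: n i => [//|n IH] i ni.
rewrite (quot_poly_coefS _ _ (ltnW ni)) (quot_poly_coefS _ _ (n := n) (i := i)) //.
congr (_ * (_ - _)); apply: eq_bigr => -[[|j] hj] _ /=; first by rewrite !mul0r.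
by rewrite IH //; lia.
Qed.

Lemma quot_poly_series num den n i : (i < n)%N ->
  (quot_poly num den n)`_i = quot_series num den i.
Proof.
elim: n => [//|n IH]; rewrite ltnS leq_eqVlt => /orP[/eqP -> //|ni].
by rewrite quot_poly_stable // IH.
Qed.

Lemma quot_polyE num den n :
  quot_poly num den n = \poly_(i < n) quot_series num den i.
Proof.
apply/polyP => i; rewrite coef_poly; case: ltnP => ni; first exact: quot_poly_series.
case: n ni => [|n] ni; first by rewrite coef0.
by rewrite /= coefZ coef_take_poly ltnNge ni mulr0.
Qed.

Lemma quot_poly_ord num den n : den 0%N != 0 ->
  ordp n ((\poly_(i < n) den i) * quot_poly num den n - \poly_(i < n) num i).
Proof.
move=> d0 i ni; rewrite coefB coef_psumM // coef_poly ni.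
rewrite big_ord_recl subn0 -(quot_poly_stable _ _ ni) quot_poly_coefS; last exact: ltnW.
rewrite big_ord_recl mul0r add0r mulrA divff // mul1r.
by rewrite subrK subrr.
Qed.

Lemma quot_series_cont (num den : nat -> R -> R) :
  (forall n, continuous (num n)) -> (forall n, continuous (den n)) ->
  (forall s, den 0%N s != 0) ->
  forall n, continuous (fun s => quot_series (num^~ s) (den^~ s) n).
Proof.
move=> hn hd d0 n.
suff h m : coefs_cont (fun s => quot_poly (num^~ s) (den^~ s) m) by exact: h.
elim: m => [|m IH] /=; first exact: coefs_cont_cst.
apply: coefs_contZ.
  by move=> s; apply: contV; [exact: d0 | exact: hd].
apply: coefs_cont_take; apply: coefs_contD.
  exact: coefs_cont_poly.
apply: coefs_contN; apply: coefs_contM => //.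
apply: (@coefs_cont_poly m.+1 (fun i s => if i is 0 then 0 else den i s)).
by case => [|i]; [move=> s; exact: cst_continuous | exact: hd].
Qed.

(** On the disc of radius z0 the part of positive order of the denominator is at most
   half of its constant term, so the partial quotients are bounded by induction in the
   weighted norm. *)
Lemma expands_quot (C k m : R) : 0 < C -> 0 < k -> 0 < m ->
  exists C' k', [/\ 0 < C', 0 < k' & forall num fn den fd,
    expands C k num fn -> expands C k den fd -> m <= `|den 0%N| ->
    expands C' k' (quot_series num den) (fun u => fn u / fd u) /\
    (forall u, 0 < u -> k' * u <= 1 -> m / 2 <= `|fd u|)].
Proof.
move=> C0 k0 m0.
pose z0 := Num.min (1 / 2) (m / (4 * C)) / k.
have mC : 0 < m / (4 * C) by rewrite divr_gt0 // mulr_gt0.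
have z00 : 0 < z0 by rewrite divr_gt0 // lt_min mC andbT; lra.
have kz : k * z0 = Num.min (1 / 2) (m / (4 * C)) by rewrite mulrC divfK ?gt_eqF.
have kz1 : k * z0 <= 1 / 2 by rewrite kz ge_min lexx.
have kz2 : C * (k * z0) <= m / 4.
  have -> : m / 4 = C * (m / (4 * C)) by field; rewrite gt_eqF.
  by rewrite ler_pM2l // kz ge_min lexx orbT.
pose S := 4 * C / m.
have S0 : 0 < S by rewrite divr_gt0 // mulr_gt0.
have mS : m * S = 4 * C by rewrite mulrC divfK ?gt_eqF.
pose C' := S + (2 / m) * (3 * C + 3 * (C * S)).
have CS0 : 0 < C * S by rewrite mulr_gt0.
have C'0 : 0 < (2 / m) * (3 * C + 3 * (C * S)).
  by rewrite mulr_gt0 ?divr_gt0 //; lra.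
exists C', z0^-1; split; [rewrite /C'; lra | by rewrite invr_gt0 |].
move=> num fn den fd [hn1 hn2] [hd1 hd2] hm.
have hQ n : pnorm z0 (quot_poly num den n) <= S.
  elim: n => [|n IH] /=; first by rewrite pnorm0 ltW.
  rewrite pnormZ normfV ler_pdivrMl; last exact: lt_le_trans m0 hm.
  rewrite (le_trans (pnorm_take _ _ (ltW z00))) //.
  rewrite (le_trans (pnormB _ _ (ltW z00))) //.
  have h1 := pnorm_psum n.+1 (ltW z00) (ltW C0) (ltW k0) hn1 kz1.
  have h2 : pnorm z0 ((\poly_(i < n.+1) (if i is 0 then 0 else den i)) *
     quot_poly num den n) <= m / 2 * S.
    rewrite (le_trans (pnormM _ _ (ltW z00))) // ler_pM ?pnorm_ge0 ?(ltW z00) //.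
    have := @pnorm_psum1 C k (fun i => if i is 0 then 0 else den i) n.+1 z0
      (ltW z00) (ltW C0) (ltW k0) _ erefl kz1.
    move=> h; apply: le_trans (h _) _; last lra.
    by case => [|i]; [rewrite normr0 mulr_ge0 ?exprn_ge0 ?ltW | exact: hd1].
  have h3 : m * S <= `|den 0%N| * S by rewrite ler_pM2r.
  lra.
have k'k : k <= z0^-1 by rewrite -[_^-1]mul1r ler_pdivlMr //; lra.
have hfd u : 0 < u -> z0^-1 * u <= 1 -> m / 2 <= `|fd u|.
  move=> u0 zu; have := hd2 u 1%N u0 (le_trans (ler_wpM2r (ltW u0) k'k) zu).
  have uz : u <= z0 by move: zu; rewrite mulrC ler_pdivrMr // mul1r.
  rewrite horner_poly big_ord1 expr0 mulr1 expr1 => h.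
  have h2 : C * (k * u) <= m / 4.
    by apply: le_trans kz2; rewrite ler_pM2l // ler_pM2l.
  have := ler_normB (fd u) (fd u - den 0%N).
  have -> : fd u - (fd u - den 0%N) = den 0%N by ring.
  lra.
split=> //; split=> [n|u n u0 zu].
  have := coef_le_pnorm (quot_poly num den n.+1) n (ltW z00).
  rewrite quot_poly_series // => h.
  rewrite exprVn ler_pdivlMr ?exprn_gt0 //.
  by apply: le_trans h _; apply: le_trans (hQ _) _; rewrite /C'; lra.
have uz : `|u| <= z0 by move: zu; rewrite mulrC ler_pdivrMr // mul1r ger0_norm // ltW.
have d0 : den 0%N != 0 by rewrite -normr_gt0 (lt_le_trans m0).
have fdu := hfd u u0 zu.
have fd0 : fd u != 0 by rewrite -normr_gt0; lra.
have ku : k * u <= 1 by apply: le_trans (ler_wpM2r (ltW u0) k'k) zu.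
have kun : (k * u) ^+ n <= (z0^-1 * u) ^+ n.
  apply: lerXn2r; rewrite ?nnegrE ?ler_pM2r //.
    by rewrite mulr_ge0 ?ltW.
  by rewrite mulr_ge0 ?invr_ge0 ?ltW.
rewrite -quot_polyE; set Q := quot_poly num den n.
have -> : fn u / fd u - Q.[u] = (fn u - fd u * Q.[u]) / fd u.
  by rewrite mulrBl mulrAC divff // mul1r.
rewrite normrM normfV ler_pdivrMr; last by rewrite normr_gt0.
set X := (z0^-1 * u) ^+ n in kun *.
have X0 : 0 <= X by rewrite exprn_ge0 // mulr_ge0 ?invr_ge0 ?ltW.
suff h : `|fn u - fd u * Q.[u]| <= (3 * C + 3 * (C * S)) * X.
  apply: le_trans h _; rewrite mulrAC; apply: ler_wpM2r => //.
  have : C' * (m / 2) <= C' * `|fd u| by rewrite ler_pM2l // /C'; lra.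
  have -> : C' * (m / 2) = S * (m / 2) + (3 * C + 3 * (C * S)).
    by rewrite /C'; field; rewrite gt_eqF.
  have : 0 <= S * (m / 2) by rewrite mulr_ge0 ?ltW // divr_gt0.
  lra.
pose N := \poly_(i < n) num i; pose D := \poly_(i < n) den i.
have -> : fn u - fd u * Q.[u] =
   (fn u - N.[u]) - (fd u - D.[u]) * Q.[u] - (D * Q - N).[u].
  by rewrite hornerD hornerN hornerM; ring.
have h1 : `|fn u - N.[u]| <= C * X.
  by apply: le_trans (hn2 u n u0 ku) _; rewrite ler_pM2l.
have h2 : `|fd u - D.[u]| * `|Q.[u]| <= C * X * S.
  apply: ler_pM => //.
    by apply: le_trans (hd2 u n u0 ku) _; rewrite ler_pM2l.
  by apply: le_trans (hQ n); exact: horner_le_pnorm.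
have h3 : `|(D * Q - N).[u]| <= X * (2 * C * S + 2 * C).
  apply: le_trans (horner_tail z00 uz (@quot_poly_ord num den n d0)) _.
  have -> : `|u| / z0 = z0^-1 * u by rewrite ger0_norm ?ltW // mulrC.
  rewrite -/X; apply: ler_wpM2l => //.
  apply: le_trans (pnormB _ _ (ltW z00)) _; apply: lerD.
    apply: le_trans (pnormM _ _ (ltW z00)) _.
    apply: ler_pM; rewrite ?pnorm_ge0 ?(ltW z00) //.
    exact: (pnorm_psum n (ltW z00) (ltW C0) (ltW k0) hd1 kz1).
  exact: (pnorm_psum n (ltW z00) (ltW C0) (ltW k0) hn1 kz1).
apply: le_trans (ler_normB _ _) _.
have := ler_normB (fn u - N.[u]) ((fd u - D.[u]) * Q.[u]).
rewrite normrM => h4.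
have -> : (3 * C + 3 * (C * S)) * X = C * X + C * X * S + X * (2 * C * S + 2 * C) by ring.
lra.
Qed.
End Expansions.

(** * Analytic dependence on the initial condition *)

Section FormalFlow.
Variable R : realType.
Variable Rj : nat -> R -> R.
Hypothesis Rj_cont : forall j, continuous (Rj j).
Hypothesis Rj0 : forall s, Rj 0%N s = 0.
Hypothesis Rj1 : forall s, Rj 1%N s = 0.

Definition formal_rhs n (p : {poly R}) (s : R) : {poly R} :=
  \sum_(j < n) Rj j s *: p ^+ j.

(** Picard iteration. As the right-hand side starts at order 2, each step determines one
   more coefficient in the initial condition, and the coefficients of low order no
   longer change. *)
Lemma formal_flow : exists u : nat -> R -> {poly R},
  [/\ forall n s, (size (u n s) <= n.+2)%N, forall n, u n 0 = 'X,
      forall n, coefs_cont (u n),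
      forall n s i, der (fun s => (u n.+1 s)`_i) s
                      (take_poly n.+3 (formal_rhs n.+3 (u n s) s))`_i
    & (forall n s, ordp 1 (u n s)) /\ forall n s, ordp n.+2 (u n.+1 s - u n s)].
Proof.
have /choice[P hP] : forall f : R -> R, exists G : R -> R,
    continuous f -> G 0 = 0 /\ forall x, der G x (f x).
  move=> f; have [cf|ncf] := pselect (continuous f); last by exists f.
  by have [G G0 hG] := primitive cf; exists G.
pose fix u (n : nat) : R -> {poly R} := if n is m.+1 then fun s =>
  'X + \poly_(i < m.+3) P (fun s => (formal_rhs m.+3 (u m s) s)`_i) s
  else fun=> 'X.
have uS n s : u n.+1 s = 'X + \poly_(i < n.+3) P (fun s => (formal_rhs n.+3 (u n s) s)`_i) s by [].
have rhs_cont n m : coefs_cont (u n) -> coefs_cont (fun s => formal_rhs m (u n s) s).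
  move=> h; apply: coefs_cont_sum => j; apply: coefs_contZ => //; exact: coefs_contX.
have uc n : coefs_cont (u n).
  elim: n => [|n IH]; first exact: coefs_cont_cst.
  apply: (@coefs_contD _ (fun=> 'X)); first exact: coefs_cont_cst.
  apply: coefs_cont_poly => i s.
  exact: der_cont ((hP _ (rhs_cont n n.+3 IH i)).2 s).
have hu n i := hP _ (rhs_cont n n.+3 (uc n) i).
have prim0 (f : R -> R) : (forall s, f s = 0) -> P f = fun=> 0.
  move=> f0; have ef : f = fun=> 0 by apply/funext.
  have cf : continuous f by rewrite ef => s; exact: cst_continuous.
  have [h0 h1] := hP f cf; apply/funext => s; rewrite -h0.
  apply: is_derive_0_is_cst => x; have := h1 x; by rewrite f0.
have stab n s : [/\ ordp 1 (u n s), ordp 1 (u n.+1 s) & ordp n.+2 (u n.+1 s - u n s)].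
  elim: n s => [|n IH] s.
    have o : ordp 2 (u 1%N s - u 0%N s).
      move=> i i2; rewrite uS /= addrC addKr coef_poly (ltn_trans i2) //.
      rewrite prim0 // => s'; rewrite /formal_rhs coef_sum big1 // => j _.
      rewrite coefZ; case: j => [[|[|j]] hj] /=; rewrite ?Rj0 ?Rj1 ?mul0r //.
      by rewrite coefXn; case: eqP => [e|]; [lia | rewrite mulr0].
    have o0 : ordp 1 (u 0%N s) by move=> [|//] _; rewrite /= coefX.
    split=> // i i1; rewrite -(subrK (u 0%N s) (u 1%N s)) coefD o ?o0 ?addr0 //.
    exact: leq_trans i1 _.
  have [a1 a2 a3] := IH s.
  have o' : ordp n.+3 (u n.+2 s - u n.+1 s).
    move=> i hi; rewrite (uS n.+1) (uS n) coefB !coefD !coef_poly hi (ltn_trans hi) //.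
    rewrite opprD addrACA subrr add0r.
    suff -> : (fun s => (formal_rhs n.+4 (u n.+1 s) s)`_i) =
              (fun s => (formal_rhs n.+3 (u n s) s)`_i) by rewrite subrr.
    apply/funext => s'; apply/eqP; rewrite -subr_eq0 -coefB; apply/eqP.
    have [p1 p2 p3] := IH s'.
    rewrite /formal_rhs big_ord_recr /= addrAC -sumrB coefD coef_sum big1 => [|j _].
      by rewrite add0r coefZ (ordp_exp p2) ?mulr0.
    rewrite -scalerBr coefZ.
    case: j => [[|[|j]] hj] /=; rewrite ?Rj0 ?Rj1 ?mul0r //.
    rewrite (@ordp_subX _ n.+1 _ _ j.+2) ?mulr0 //; lia.
  split=> // i i1; rewrite -(subrK (u n.+1 s) (u n.+2 s)) coefD o' ?a2 ?addr0 //.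
  exact: leq_trans i1 _.
exists u; split=> //.
- case=> [|n] s; first by rewrite size_polyX.
  rewrite uS; apply: leq_trans (size_polyD _ _) _.
  by rewrite geq_max size_polyX /= size_poly.
- case=> [//|n]; rewrite uS; apply/polyP => i; rewrite coefD coef_poly.
  by case: ifP => _; rewrite ?addr0 // (hu n i).1 addr0.
- move=> n s i; rewrite coef_take_poly.
  case: (ltnP i n.+3) => hi.
    apply: (@der_ext _ (fun s => ('X : {poly R})`_i + P (fun s => (formal_rhs n.+3 (u n s) s)`_i) s)).
      by move=> y; rewrite uS coefD coef_poly hi.
    rewrite -[X in der _ _ X]add0r; apply: der_D; first exact: der_cst.
    exact: (hu n i).2.
  apply: (@der_ext _ (fun s => ('X : {poly R})`_i)); last exact: der_cst.
  by move=> y; rewrite uS coefD coef_poly ltnNge hi addr0.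
- by split=> n s; have [] := stab n s.
Qed.

(** The l1 norm at the end point is the value of the linear form with coefficients
   sgn * z^i, to which the mean value inequality applies. *)
Lemma pnorm_primitive (p c : R -> {poly R}) m (z L B phi : R) : 0 <= z ->
  (forall s, size (p s) <= m)%N -> (forall s, size (c s) <= m)%N ->
  (forall i s, der (fun s => (p s)`_i) s (c s)`_i) -> p 0 = 0 ->
  (forall s, `|s| <= L -> pnorm z (c s) <= B) -> `|phi| <= L ->
  pnorm z (p phi) <= B * L.
Proof.
move=> z0 sp sc hd p0 hB hphi.
pose e i := Num.sg (p phi)`_i * z ^+ i.
pose F s := \sum_(i < m) e i * (p s)`_i.
have hF s : der F s (\sum_(i < m) e i * (c s)`_i).
  by apply: der_sum => i; exact: der_Z.
have B0 : 0 <= B.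
  apply: le_trans (hB 0 _); first exact: pnorm_ge0.
  by rewrite normr0 (le_trans _ hphi).
have -> : pnorm z (p phi) = F phi - F 0.
  rewrite (pnormE _ (sp _)) /F p0 [X in _ - X]big1 ?subr0 => [|i _]; last by rewrite coef0 mulr0.
  by apply: eq_bigr => i _; rewrite /e mulrAC -normrEsg.
apply: le_trans (ler_norm _) _.
apply: (@le_trans _ _ (B * `|phi - 0|)); last by rewrite subr0 ler_wpM2l.
apply: (@der_bound _ F (fun s => \sum_(i < m) e i * (c s)`_i)) => [x _|x hx]; first exact: hF.
apply: le_trans (hB x _).
  rewrite (pnormE _ (sc _)); apply: le_trans (ler_norm_sum _ _ _) _.
  apply: ler_sum => i _; rewrite /e normrM mulrC ler_wpM2l // normrM.
  rewrite (ger0_norm (exprn_ge0 _ z0)) ler_piMl ?exprn_ge0 //.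
  by rewrite normr_sg; case: (_ != 0).
apply: le_trans hphi; move: hx.
case/orP: (le_total 0 phi) => h; rewrite ?(min_l h) ?(max_r h) ?(min_r h) ?(max_l h) => /andP[a b].
  by rewrite !ger0_norm.
by rewrite !ler0_norm // lerN2.
Qed.

End FormalFlow.

Section AnalyticFlow.
Variable R : realType.

Lemma take_ord n (p : {poly R}) : ordp n (take_poly n p - p).
Proof. by move=> i hi; rewrite coefB coef_take_poly hi subrr. Qed.

Lemma coefs_cont_eval m (P : R -> {poly R}) z : (forall s, size (P s) <= m)%N ->
  coefs_cont P -> continuous (fun s => (P s).[z]).
Proof.
move=> sP cP; apply: (@continuous_ext R (fun s => \sum_(i < m) (P s)`_i * z ^+ i)).
  by move=> s; rewrite -horner_coef_wide.
apply: continuous_bigsum => i s.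
by apply: (@contM R (fun s => (P s)`_i) (fun=> z ^+ i)); [exact: cP | exact: cont_cst].
Qed.

(** The factor b^2, from the absence of terms of order 0 and 1, is what closes the
   majorant estimates of the iteration. *)
Lemma pnorm_rhs (Rj : nat -> R -> R) C k n (p : {poly R}) s z b :
  0 <= C -> 0 <= k -> 0 <= z -> (forall j s, `|Rj j s| <= C * k ^+ j) ->
  Rj 0%N s = 0 -> Rj 1%N s = 0 -> pnorm z p <= b -> k * b <= 1 / 2 ->
  pnorm z (formal_rhs Rj n p s) <= 2 * C * (k * b) ^+ 2.
Proof.
move=> C0 k0 z0 hR R0 R1 pb kb.
have b0 : 0 <= b by apply: le_trans (pnorm_ge0 _ z0) pb.
have kb0 : 0 <= k * b by rewrite mulr_ge0.
apply: le_trans (pnorm_sum _ z0) _.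
have term (j : nat) : pnorm z (Rj j s *: p ^+ j) <= C * (k * b) ^+ j.
  rewrite pnormZ exprMn mulrA; apply: ler_pM => //; first exact: pnorm_ge0.
  apply: le_trans (pnorm_exp _ _ z0) _.
  by apply: lerXn2r => //; rewrite nnegrE ?pnorm_ge0.
case: n => [|[|n]].
- by rewrite big_ord0 !mulr_ge0 ?exprn_ge0.
- by rewrite big_ord1 R0 scale0r pnorm0 !mulr_ge0 ?exprn_ge0.
rewrite big_ord_recl big_ord_recl /= R0 R1 !scale0r pnorm0 !add0r.
apply: (@le_trans _ _ (\sum_(i < n) (C * (k * b) ^+ 2) * (k * b) ^+ i)).
  apply: ler_sum => i _; rewrite /bump /= !add1n -mulrA -exprD; exact: term.
rewrite -mulr_sumr.
have -> : 2 * C * (k * b) ^+ 2 = (C * (k * b) ^+ 2) * 2 by ring.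
by apply: ler_wpM2l; [rewrite mulr_ge0 ?exprn_ge0 | apply: geo_half_sum; rewrite kb0].
Qed.

(** The Picard iterates satisfy pnorm z (u n s - X) <= z / 2 for small z: by induction,
   the right-hand side is O(z^2). So they converge geometrically on a disc, uniformly in
   s, together with their derivatives in s. *)
Lemma analytic_flow (Rj : nat -> R -> R) (f : R -> R -> R) (C k L : R) :
  0 < C -> 0 < k -> 0 < L -> (forall j, continuous (Rj j)) ->
  (forall s, Rj 0%N s = 0) -> (forall s, Rj 1%N s = 0) ->
  (forall s, expands C k (Rj^~ s) (f s)) ->
  exists z1 K (U : R -> R -> R) (v : nat -> R -> R),
  [/\ 0 < z1, 0 < K,
      forall z s, 0 < z <= z1 -> `|s| < L -> der (U z) s (f s (U z s)),
      (forall z, 0 < z <= z1 -> U z 0 = z) /\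
      (forall z s, 0 < z <= z1 -> `|s| <= L -> `|U z s - z| <= z / 2 /\ k * U z s <= 1)
    & forall s, `|s| <= L -> expands K z1^-1 (v^~ s) (U^~ s)].
Proof.
move=> C0 k0 L0 cR R0 R1 hf.
have hRj j s : `|Rj j s| <= C * k ^+ j by exact: (hf s).1.
have [u [su u0 uc ud [uo us]]] := formal_flow cR R0 R1.
(* So that k (2 z) <= 1 / 4 and 2 C (k (2 z))^2 L <= z / 2 for z <= z0. *)
pose z0 := Num.min (1 / (8 * k)) (1 / (16 * L * C * k ^+ 2)).
have k80 : 0 < 8 * k by rewrite mulr_gt0.
have LCk : 0 < 16 * L * C * k ^+ 2 by rewrite !mulr_gt0 ?exprn_gt0.
have z00 : 0 < z0 by rewrite lt_min !divr_gt0.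
have kz0 : k * z0 <= 1 / 8.
  have -> : 1 / 8 = k * (1 / (8 * k)) by field; rewrite gt_eqF.
  by rewrite ler_pM2l // ge_min lexx.
have Lz0 z : 0 <= z <= z0 -> 16 * L * C * k ^+ 2 * z <= 1.
  move=> /andP[zp zz]; rewrite mulrC -ler_pdivlMr //; apply: le_trans zz _.
  by rewrite ge_min lexx orbT.
(* The formal flow is close to the identity in every norm of radius z <= z0. *)
have close z n s : 0 <= z <= z0 -> `|s| <= L -> pnorm z (u n s - 'X) <= z / 2.
  move=> /andP[zp zz]; elim: n s => [|n IH] s sL.
    rewrite (_ : u 0%N s = 'X) ?subrr ?pnorm0 ?divr_ge0 //.
    have e i : (u 0%N s)`_i = (u 1%N s)`_i - (u 1%N s - u 0%N s)`_i by rewrite coefB; ring.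
    apply/polyP => i; rewrite coefX; case: (ltnP i 2) => i2; last first.
      rewrite nth_default ?(leq_trans (su _ _)) //.
      by case: i i2 => [|[|]].
    have hz x : der (fun s => (u 1%N s)`_i) x 0.
      apply: der_eq (ud 0%N x i) _; rewrite coef_take_poly (ltn_trans i2) //.
      rewrite /formal_rhs coef_sum big1 // => j _; rewrite coefZ.
      case: j => [[|[|j]] hj] /=; rewrite ?R0 ?R1 ?mul0r //.
      by rewrite (ordp_exp (uo 0%N x)) ?mulr0 //; exact: leq_trans i2 _.
    have := @is_derive_0_is_cst R (fun s => (u 1%N s)`_i) s 0 hz.
    have := us 0%N s i i2; rewrite coefB => /eqP; rewrite subr_eq0 => /eqP -> ->.
    by rewrite u0 coefX.
  have b0 : `|s| <= L by [].
  have hB x : `|x| <= L ->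
      pnorm z (take_poly n.+3 (formal_rhs Rj n.+3 (u n x) x)) <= 2 * C * (k * (2 * z)) ^+ 2.
    move=> xL; apply: le_trans (pnorm_take _ _ zp) _.
    apply: (pnorm_rhs _ (ltW C0) (ltW k0) zp hRj (R0 x) (R1 x)).
      have -> : u n x = (u n x - 'X) + 'X by rewrite subrK.
      apply: le_trans (pnormD _ _ zp) _; rewrite pnormX.
      by have := IH x xL; lra.
    have : k * z <= k * z0 by rewrite ler_pM2l.
    by lra.
  have h : pnorm z (u n.+1 s - 'X) <= 2 * C * (k * (2 * z)) ^+ 2 * L.
    apply: (@pnorm_primitive R (fun s => u n.+1 s - 'X)
      (fun s => take_poly n.+3 (formal_rhs Rj n.+3 (u n s) s)) n.+3) => //.
  + move=> x; apply: leq_trans (size_polyD _ _) _.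
      by rewrite geq_max size_polyN size_polyX su.
  + by move=> x; exact: size_take_poly.
  + move=> i x; rewrite -[X in der _ _ X]subr0.
      apply: (@der_ext _ (fun s => (u n.+1 s)`_i - ('X : {poly R})`_i)).
        by move=> y; rewrite coefB.
      by apply: der_B; [exact: ud | exact: der_cst].
  + by rewrite u0 subrr.
  apply: le_trans h _.
  have -> : 2 * C * (k * (2 * z)) ^+ 2 * L = (16 * L * C * k ^+ 2 * z) * (z / 2) by field.
    by rewrite ler_piMl ?divr_ge0 // Lz0 // zp.
have close2 z n s : 0 <= z <= z0 -> `|s| <= L -> pnorm z (u n s) <= 2 * z.
  move=> /andP[zp zz] sL; have -> : u n s = (u n s - 'X) + 'X by rewrite subrK.
  apply: le_trans (pnormD _ _ zp) _; rewrite pnormX.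
  by have := close z n s; rewrite zp zz => /(_ isT sL); lra.
have stab n m s : (n <= m)%N -> ordp n.+2 (u m s - u n s).
  move=> /subnKC <-; elim: (m - n)%N => [|d IH]; first by rewrite addn0 subrr => i _; rewrite coef0.
  rewrite addnS; have -> : u (n + d).+1 s - u n s =
    (u (n + d).+1 s - u (n + d)%N s) + (u (n + d)%N s - u n s) by ring.
  by apply: ordpD => // i hi; apply: us; apply: leq_trans hi _; rewrite !ltnS leq_addr.
pose z1 := z0 / 2; have z10 : 0 < z1 by rewrite divr_gt0.
have zz1 z : 0 < z <= z1 -> [/\ 0 <= z <= z0, 0 < z, `|z| <= z0 & 0 <= z / z0 <= 1 / 2].
  move=> /andP[zp zz]; have zz0 : z <= z0 by rewrite /z1 in zz; lra.
  split=> //; first by rewrite zz0 ltW.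
    by rewrite ger0_norm // ltW.
  apply/andP; split; first by rewrite divr_ge0 // ltW.
  by rewrite ler_pdivrMr //; rewrite /z1 in zz; lra.
have rate z s n m : 0 < z <= z1 -> `|s| <= L -> (n <= m)%N ->
    `|(u m s).[z] - (u n s).[z]| <= 4 * z0 * (z / z0) ^+ n.+2.
  move=> hz sL nm; have [zb zp zn zr] := zz1 z hz.
  rewrite -hornerN -hornerD.
  apply: le_trans (horner_tail z00 zn (stab n m s nm)) _.
  rewrite (ger0_norm (ltW zp)) mulrC; apply: ler_wpM2r.
    by rewrite exprn_ge0 // divr_ge0 // ltW.
  apply: le_trans (pnormB _ _ (ltW z00)) _.
  have zz : 0 <= z0 <= z0 by rewrite ltW /=.
  by have := close2 z0 m s zz sL; have := close2 z0 n s zz sL; lra.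
have halfexp z n m : 0 < z <= z1 -> (n <= m)%N -> (z / z0) ^+ m <= (1 / 2) ^+ n.
  move=> hz nm; have [zb zp zn /andP[r0 r1]] := zz1 z hz.
  apply: (@le_trans _ _ ((z / z0) ^+ n)).
    by rewrite ler_wiXn2l //; lra.
  by apply: lerXn2r => //; rewrite nnegrE //; lra.
have /choice[U hU] : forall z, exists Uz : R -> R, forall s, 0 < z <= z1 -> `|s| <= L ->
    forall n, `|Uz s - (u n s).[z]| <= 4 * z0 * (z / z0) ^+ n.+2.
  move=> z; suff /choice[Uz hUz] : forall s, exists l, 0 < z <= z1 -> `|s| <= L ->
    forall n, `|l - (u n s).[z]| <= 4 * z0 * (z / z0) ^+ n.+2 by exists Uz.
  move=> s.
  have [hz|nz] := pselect (0 < z <= z1); last by exists 0.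
  have [sL|nsL] := pselect (`|s| <= L); last by exists 0.
  have [||l hl] := @rate_limit R (fun n => (u n s).[z])
      (fun n => 4 * z0 * (z / z0) ^+ n.+2) (4 * z0) _ (fun n m => rate z s n m hz sL).
  - by rewrite mulr_ge0 ?ltW.
  - by move=> n; rewrite ler_pM2l ?mulr_gt0 //; apply: halfexp => //; exact: leqW (leqnSn n).
  by exists l.
have approx z s : 0 < z <= z1 -> `|s| <= L -> forall n, `|U z s - (u n s).[z]| <= 4 * z0 * (1 / 2) ^+ n.
  move=> hz sL n; apply: le_trans (hU z s hz sL n) _.
  by rewrite ler_pM2l ?mulr_gt0 //; apply: halfexp => //; exact: leqW (leqnSn n).
have Uz z s : 0 < z <= z1 -> `|s| <= L -> `|U z s - z| <= z / 2.
  move=> hz sL; have [zb zp zn zr] := zz1 z hz.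
  apply/ler_addgt0Pr => e e0.
  have e1 : 0 < e / (4 * z0) by rewrite divr_gt0 ?mulr_gt0.
  have [n hn] := half_exp_small e1.
  have h1 : `|U z s - (u n s).[z]| <= e.
    apply: le_trans (approx z s hz sL n) _.
    by rewrite mulrC -ler_pdivlMr ?mulr_gt0.
  have h2 : `|(u n s - 'X).[z]| <= z / 2.
    apply: le_trans (close z n s zb sL).
    by apply: horner_le_pnorm => //; rewrite ger0_norm // ltW.
  have -> : U z s - z = (U z s - (u n s).[z]) + (u n s - 'X).[z].
    by rewrite hornerD hornerN hornerX; ring.
  by apply: le_trans (ler_normD _ _) _; lra.
have kU z s : 0 < z <= z1 -> `|s| <= L -> [/\ 0 < U z s, U z s <= z0 & k * U z s <= 1 / 2].
  move=> hz sL; have [zb zp zn zr] := zz1 z hz.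
  have := Uz z s hz sL; rewrite ler_norml => /andP[h1 h2].
  have Uz0 : U z s <= z0 by case/andP: hz => _; rewrite /z1; lra.
  split=> //; first lra.
  apply: (@le_trans _ _ (k * z0)); first by rewrite ler_pM2l.
  lra.
exists z1, (4 * z0), U, (fun i s => (u i s)`_i); split => //.
- by rewrite mulr_gt0.
- move=> z s hz sL; have [zb zp zn zr] := zz1 z hz.
  pose r := L - `|s|; have r0 : 0 < r by rewrite subr_gt0.
  have inL y : `|y - s| < r -> `|y| <= L.
    move=> ys; have -> : y = s + (y - s) by ring.
    by apply: le_trans (ler_normD _ _) _; rewrite /r in ys; lra.
  pose rhs n s := formal_rhs Rj n.+3 (u n s) s.
  apply: (@der_uniform_limit R (fun n y => (u n.+1 y).[z])
     (fun n y => (take_poly n.+3 (rhs n y)).[z]) _ (fun y => f y (U z y)) s r) => //.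
  + move=> n y _.
    apply: (@der_ext _ (fun y => \sum_(i < n.+3) (u n.+1 y)`_i * z ^+ i)).
      by move=> x; rewrite (horner_coef_wide _ (su n.+1 x)).
    rewrite (@horner_coef_wide _ n.+3) ?size_take_poly //.
    apply: der_sum => i; rewrite -[X in der _ _ X]addr0.
    apply: der_eq (der_M (ud n y i) (der_cst (z ^+ i) y)) _.
    by rewrite mulr0.
  + move=> n; apply: (@coefs_cont_eval n.+3) => [y|]; first exact: size_take_poly.
    apply: coefs_cont_take; apply: coefs_cont_sum => j.
    by apply: coefs_contZ => //; exact: coefs_contX.
  + move=> e e0.
    pose K := 4 * z0 + 4 * C + 8 * C + C.
    have K0 : 0 < K by rewrite /K !addr_gt0 ?mulr_gt0.
    have eK : 0 < e / K by rewrite divr_gt0.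
    have [n hn] := half_exp_small eK.
    have hK : K * (1 / 2) ^+ n <= e by rewrite mulrC -ler_pdivlMr.
    have hp : 0 <= (1 / 2 : R) ^+ n by apply: exprn_ge0; lra.
    exists n => y ys; have yL := inL y ys.
    have KE : K * (1 / 2) ^+ n = 4 * z0 * (1 / 2) ^+ n + 4 * C * (1 / 2) ^+ n +
      8 * C * (1 / 2) ^+ n + C * (1 / 2) ^+ n by rewrite /K; ring.
    have Chp : 0 <= C * (1 / 2) ^+ n by rewrite mulr_ge0 // ltW.
    have zhp : 0 <= z0 * (1 / 2) ^+ n by rewrite mulr_ge0 // ltW.
    split.
      rewrite distrC; apply: le_trans (hU z y hz yL n.+1) _.
      apply: (@le_trans _ _ (4 * z0 * (1 / 2) ^+ n)); last by lra.
      by rewrite ler_pM2l ?mulr_gt0 //; apply: halfexp => //; exact: leqW (leqW (leqnSn n)).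
    have [U0 UZ kUz] := kU z y hz yL.
    have h1 : `|(take_poly n.+3 (rhs n y) - rhs n y).[z]| <= 4 * C * (1 / 2) ^+ n.
      apply: le_trans (horner_tail z00 zn (@take_ord n.+3 (rhs n y))) _.
      rewrite (ger0_norm (ltW zp)) mulrC.
      apply: ler_pM; rewrite ?pnorm_ge0 ?exprn_ge0 ?divr_ge0 ?(ltW z00) ?(ltW zp) //; last first.
        by apply: halfexp => //; exact: leqW (leqW (leqnSn n)).
      apply: le_trans (pnormB _ _ (ltW z00)) _.
      have zz : 0 <= z0 <= z0 by rewrite ltW /=.
      have hb : k * (2 * z0) <= 1 / 2 by lra.
      have hr : pnorm z0 (rhs n y) <= 2 * C * (k * (2 * z0)) ^+ 2.
        by apply: (pnorm_rhs _ (ltW C0) (ltW k0) (ltW z00) hRj (R0 y) (R1 y)) => //; exact: close2.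
      have := pnorm_take n.+3 (rhs n y) (ltW z00).
      have kz00 : 0 <= k * (2 * z0) by rewrite !mulr_ge0 ?ltW.
      have : 2 * C * (k * (2 * z0)) ^+ 2 <= 2 * C * 1.
        rewrite ler_pM2l ?mulr_gt0 //; apply: exprn_ile1 => //; lra.
      lra.
    pose psum := \poly_(j < n.+3) Rj j y.
    have h2 : `|(rhs n y).[z] - psum.[U z y]| <= 8 * C * (1 / 2) ^+ n.
      rewrite /rhs /formal_rhs horner_sum horner_poly -sumrB.
      apply: le_trans (ler_norm_sum _ _ _) _.
      have hx : `|(u n y).[z]| <= z0.
        apply: le_trans (horner_le_pnorm _ zp _) _; first by rewrite ger0_norm // ltW.
        by apply: le_trans (close2 z n y zb yL) _; case/andP: hz => _; rewrite /z1; lra.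
      have hy : `|U z y| <= z0 by rewrite ger0_norm // ltW.
      have h4 := approx z y hz yL n.
      apply: (@le_trans _ _ (\sum_(j < n.+3) (C / z0 * (4 * z0 * (1 / 2) ^+ n)) * (k * (2 * z0)) ^+ j)).
        apply: ler_sum => j _.
        rewrite hornerZ horner_exp -mulrBr normrM.
        have h5 := subX_bound j z00 hx hy.
        have h6 : `|(u n y).[z] ^+ j - U z y ^+ j| <=
            (2 * z0) ^+ j / z0 * (4 * z0 * (1 / 2) ^+ n).
          apply: le_trans h5 _; rewrite ler_wpM2l //; last by rewrite distrC.
          by rewrite divr_ge0 ?exprn_ge0 ?mulr_ge0 ?ltW.
        apply: le_trans (ler_pM _ _ (hRj j y) h6) _ => //.
        rewrite (exprMn _ k) [X in X <= _](_ : _ =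
          C / z0 * (4 * z0 * (1 / 2) ^+ n) * (k ^+ j * (2 * z0) ^+ j)) //; ring.
      rewrite -mulr_sumr.
      have -> : C / z0 * (4 * z0 * (1 / 2) ^+ n) = 4 * C * (1 / 2) ^+ n.
        by field; rewrite gt_eqF.
      have -> : 8 * C * (1 / 2) ^+ n = 4 * C * (1 / 2) ^+ n * 2 by ring.
      apply: ler_wpM2l; first by rewrite !mulr_ge0 ?ltW.
      apply: geo_half_sum; apply/andP; split; [by rewrite !mulr_ge0 ?ltW | lra].
    have h3 : `|f y (U z y) - psum.[U z y]| <= C * (1 / 2) ^+ n.
      have kU1 : k * U z y <= 1 by lra.
      apply: le_trans ((hf y).2 (U z y) n.+3 U0 kU1) _.
      have kU0 : 0 <= k * U z y by rewrite mulr_ge0 ?ltW.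
      rewrite ler_pM2l //; apply: (@le_trans _ _ ((k * U z y) ^+ n)).
        by rewrite ler_wiXn2l //; exact: leqW (leqW (leqnSn n)).
      by apply: lerXn2r; rewrite ?nnegrE //; lra.
    have -> : (take_poly n.+3 (rhs n y)).[z] - f y (U z y) =
      (take_poly n.+3 (rhs n y) - rhs n y).[z] + ((rhs n y).[z] - psum.[U z y]) -
      (f y (U z y) - psum.[U z y]) by rewrite hornerD hornerN; ring.
    apply: le_trans (ler_normB _ _) _.
    have := ler_normD (take_poly n.+3 (rhs n y) - rhs n y).[z] ((rhs n y).[z] - psum.[U z y]).
    lra.
- split=> z.
    move=> hz; have L0' : `|0 : R| <= L by rewrite normr0 ltW.
    apply/eqP; rewrite -subr_eq0; apply/eqP; apply: (@half_exp_eq0 R _ (4 * z0)).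
      by rewrite mulr_ge0 ?ltW.
    by move=> n; have := approx z 0 hz L0' n; rewrite u0 hornerX.
  move=> s hz sL; split; first exact: Uz.
  by have [_ _] := kU z s hz sL; lra.
- move=> s sL; have z0z1 : z0^-1 <= z1^-1 by rewrite lef_pV2 ?posrE // /z1; lra.
  split=> [n|z n zp].
    have zz : 0 <= z0 <= z0 by rewrite ltW /=.
    have := coef_le_pnorm (u n s) n (ltW z00) => h.
    have h1 : `|(u n s)`_n| <= 4 * z0 * z0^-1 ^+ n.
      rewrite exprVn ler_pdivlMr ?exprn_gt0 //.
      by apply: le_trans h _; apply: le_trans (close2 z0 n s zz sL) _; lra.
    apply: le_trans h1 _; rewrite ler_pM2l ?mulr_gt0 //.
    by apply: lerXn2r => //; rewrite nnegrE invr_ge0 ltW.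
  rewrite mulrC ler_pdivrMr // mul1r => zz.
  have hz : 0 < z <= z1 by rewrite zp.
  have [zb _ zn /andP[r0 r1]] := zz1 z hz.
  have zr : z / z0 <= z1^-1 * z by rewrite mulrC ler_pM2r.
  have hrn : (z / z0) ^+ n <= (z / z1) ^+ n.
    rewrite [z / z1]mulrC; apply: lerXn2r => //.
    by rewrite nnegrE mulr_ge0 ?invr_ge0 ?ltW.
  apply: (@le_trans _ _ (4 * z0 * (z / z0) ^+ n)); last by rewrite ler_pM2l ?mulr_gt0.
  have small : `|U z s| <= 2 * z.
    have := Uz z s hz sL; have := ler_normB (U z s) (U z s - z).
    have := ler_normD (U z s - z) z; rewrite subrK (ger0_norm (ltW zp)); lra.
  case: n {hrn} => [|[|n]].
  + rewrite horner_poly big_ord0 subr0 expr0 mulr1; apply: le_trans small _.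
    by case/andP: zb; lra.
  + rewrite horner_poly big_ord1 (uo 0%N s) // mul0r subr0 expr1 -mulrA [z0 * _]mulrC divfK ?gt_eqF //.
    by apply: le_trans small _; lra.
  + have -> : \poly_(i < n.+2) (u i s)`_i = u n s.
      apply/polyP => i; rewrite coef_poly; case: ltnP => hi; last first.
        by rewrite nth_default // (leq_trans (su _ _)).
      apply/eqP; rewrite -subr_eq0 -coefB; apply/eqP.
      case: (leqP n i) => ni; first exact: (stab n i s ni).
      rewrite -[X in X = _]opprK -coefN opprB.
      by rewrite (stab i n s (ltnW ni)) ?oppr0 //; exact: leqW.
    exact: hU.
Qed.
End AnalyticFlow.

(** * Periodic functions and level curves *)

Section Periodicity.
Variable R : realType.
Implicit Types (f : R -> R) (s T : R).

Lemma periodic_int f T (m : int) s : (forall s, f (s + T) = f s) -> f (s + m%:~R * T) = f s.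
Proof.
move=> hf; have hn n x : f (x + n%:R * T) = f x.
  elim: n => [|n IH]; first by rewrite mul0r addr0.
  by rewrite -natr1 mulrDl mul1r addrA hf.
case: m => n; first exact: hn.
have := hn n.+1 (s + (Negz n)%:~R * T); rewrite -addrA -mulrDl => <-.
by rewrite NegzE mulrNz addNr mul0r addr0.
Qed.

Lemma mod_period s T : 0 < T -> exists2 m : int, 0 <= s - m%:~R * T & s - m%:~R * T < T.
Proof.
move=> T0; exists (Num.floor (s / T)).
  by rewrite subr_ge0 -ler_pdivlMr // ge_floor // num_real.
have := floorD1_gt (s / T).
by rewrite -(ltr_pM2r T0) divfK ?gt_eqF // intrD mulrDl mul1r; lra.
Qed.

Lemma periodic_bounded f T : 0 < T -> (forall s, f (s + T) = f s) ->
  continuous f -> exists2 M, 0 < M & forall s, `|f s| <= M.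
Proof.
move=> T0 hf cf; have [M M0 hM] := EVTbound (ltW T0) (fun x _ => cf x).
exists M => // s; have [m m1 m2] := mod_period s T0.
rewrite -(subrK (m%:~R * T) s) periodic_int //; apply: hM.
by rewrite m1 ltW.
Qed.

Lemma IVTany f a b v : continuous f -> f a <= v <= f b -> exists c, f c = v.
Proof.
move=> cf hv; case/orP: (le_total a b) => ab.
  by have [c _ <-] := IVTle ab (fun x _ => cf x) hv; exists c.
have ab' : - a <= - b by rewrite lerN2.
have [||c _ <-] := @IVTle R (fun x => f (- x)) (- a) (- b) v ab'.
- by move=> x _; apply: cont_comp; [apply: contN; exact: cont_id | exact: cf].
- by rewrite !opprK.
- by exists (- c).
Qed.

Lemma unit_circle_angle (c s : R) : c ^+ 2 + s ^+ 2 = 1 ->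
  exists2 phi, 0 <= phi <= 2 * pi & c = cos phi /\ s = sin phi.
Proof.
move=> e; have c1 : -1 <= c <= 1.
  rewrite -ler_norml -(@expr_le1 _ 2) // -normrX ger0_norm ?sqr_ge0 //.
  by rewrite -e lerDl sqr_ge0.
have p0 := @pi_ge0 R; have a0 := acos_ge0 c1; have ap := acos_lepi c1.
have ca : cos (acos c) = c by apply: acosK; rewrite in_itv.
have sa : sin (acos c) = `|s|.
  by rewrite sin_acos // -e addrC addKr sqrtr_sqr.
case/orP: (le_total 0 s) => s0.
  exists (acos c); first by apply/andP; split; lra.
  by rewrite ca sa ger0_norm.
exists (- acos c + 2 * pi); first by apply/andP; split; lra.
have e2 : 2 * pi = pi *+ 2 :> R by rewrite mulr_natl.
by rewrite e2 cosD2pi sinD2pi cosN sinN ca sa ler0_norm // opprK.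
Qed.

(** The intermediate value theorem scales the point to the unit circle along the
   weighted dilations. *)
Lemma weighted_polar (t : nat * nat) (x y : R) : (0 < t.1)%N -> (0 < t.2)%N ->
  (x, y) != (0, 0) -> exists rho phi, [/\ 0 < rho, 0 <= phi <= 2 * pi,
    x = rho ^+ t.1 * cos phi & y = rho ^+ t.2 * sin phi].
Proof.
move=> t1 t2 xy0.
pose f v := x ^+ 2 * v ^+ t.1 ^+ 2 + y ^+ 2 * v ^+ t.2 ^+ 2.
have cf : continuous f.
  have cX n v : {for v, continuous (fun v : R => v ^+ n ^+ 2)}.
    by apply: (@contX R (fun v => v ^+ n)); apply: (@contX R (fun v => v)); exact: cont_id.
  move=> v; apply: (@contD R (fun v => x ^+ 2 * v ^+ t.1 ^+ 2)
                             (fun v => y ^+ 2 * v ^+ t.2 ^+ 2)).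
    by apply: (@contM R (fun=> x ^+ 2)); [exact: cont_cst | exact: cX].
  by apply: (@contM R (fun=> y ^+ 2)); [exact: cont_cst | exact: cX].
have f0 : f 0 = 0 by rewrite /f !expr0n !gtn_eqF //= expr0n /= !mulr0 addr0.
pose V := 1 + x^-2 + y^-2.
have x2 : 0 <= x ^- 2 by rewrite invr_ge0 sqr_ge0.
have y2 : 0 <= y ^- 2 by rewrite invr_ge0 sqr_ge0.
have V1 : 1 <= V by rewrite /V; lra.
have Vn n : (0 < n)%N -> V <= V ^+ n ^+ 2.
  move=> n0; rewrite -exprM -{1}[V]expr1; apply: ler_weXn2l => //.
  by rewrite muln_gt0 n0.
have fV : 1 <= f V.
  have [x0|x0] := eqVneq x 0.
    have y0 : y != 0 by apply: contra xy0 => /eqP ->; rewrite x0.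
    have y20 : 0 < y ^+ 2 by rewrite exprn_even_gt0.
    rewrite /f x0 expr0n /= mul0r add0r.
    have := Vn _ t2; have : y ^+ 2 * y ^- 2 = 1 by rewrite divff // gt_eqF.
    have h : y ^+ 2 * y ^- 2 <= y ^+ 2 * V ^+ t.2 ^+ 2.
      by rewrite ler_pM2l //; apply: le_trans (Vn _ t2); rewrite /V; lra.
    lra.
  have x20 : 0 < x ^+ 2 by rewrite exprn_even_gt0.
  have h : x ^+ 2 * x ^- 2 <= x ^+ 2 * V ^+ t.1 ^+ 2.
    by rewrite ler_pM2l //; apply: le_trans (Vn _ t1); rewrite /V; lra.
  have : x ^+ 2 * x ^- 2 = 1 by rewrite divff // gt_eqF.
  have : 0 <= y ^+ 2 * V ^+ t.2 ^+ 2 by rewrite mulr_ge0 ?sqr_ge0.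
  rewrite /f; lra.
have hv : f 0 <= 1 <= f V by rewrite f0 fV ler01.
have V0 : 0 <= V by lra.
have [v /andP[v0 _] fv] := IVTle V0 (fun x _ => cf x) hv.
have {}v0 : 0 < v.
  by rewrite lt_def v0 andbT; apply/eqP => e; move: fv; rewrite e f0 => /eqP; rewrite eq_sym oner_eq0.
have [phi hphi [ec es]] := @unit_circle_angle (x * v ^+ t.1) (y * v ^+ t.2)
  ltac:(by rewrite !exprMn).
exists v^-1, phi; split=> //; first by rewrite invr_gt0.
- by rewrite -ec exprVn mulrCA mulVf ?mulr1 // expf_neq0 // gt_eqF.
- by rewrite -es exprVn mulrCA mulVf ?mulr1 // expf_neq0 // gt_eqF.
Qed.

Lemma nat_root (a : R) k : 0 < a -> (0 < k)%N -> exists2 b, 0 < b & b ^+ k = a.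
Proof.
move=> a0 k0; exists (expR (ln a / k%:R)); first exact: expR_gt0.
rewrite -expRM_natl mulrCA divff ?mulr1 ?lnK //.
by rewrite pnatr_eq0 -lt0n.
Qed.
End Periodicity.

Section LevelCurve.
Variables (R : realType) (t : nat * nat) (k : nat) (h : {poly {poly R}}).
Variables (Cs Sn : R -> R) (T : R).
Hypothesis ht : is_type t.
Hypothesis hh : whomog t k h.
Hypothesis hpar : parameterizes_level1 h Cs Sn T.

Lemma level_T : 0 < T.
Proof. by case: hpar. Qed.

Lemma level_der s : der Cs s (- (dY h).[Cs s, Sn s]) /\ der Sn s (dX h).[Cs s, Sn s].
Proof.
case: hpar => hs _ _ _ _; have [] := hs s I.
by rewrite /= !hornerN.
Qed.

Lemma level_cont : continuous Cs /\ continuous Sn.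
Proof.
by split=> s; [exact: der_cont (level_der s).1 | exact: der_cont (level_der s).2].
Qed.

Lemma level_periodic s : Cs (s + T) = Cs s /\ Sn (s + T) = Sn s.
Proof. by case: hpar. Qed.

Lemma level_on s : h.[Cs s, Sn s] = 1.
Proof.
case: hpar => _ e _ _ _.
by have : range (fun s => (Cs s, Sn s)) (Cs s, Sn s); [exists s | rewrite -e].
Qed.

Lemma level_surj x y : h.[x, y] = 1 -> exists s, x = Cs s /\ y = Sn s.
Proof.
case: hpar => _ e _ _ _ hxy.
have : [set p : R * R | h.[p.1, p.2] = 1] (x, y) by [].
by rewrite e => -[s _ [<- <-]]; exists s.
Qed.

Lemma level_bounded : exists2 B, 0 < B & forall x y, h.[x, y] = 1 ->
  `|x| <= B /\ `|y| <= B.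
Proof.
have [c1 c2] := level_cont.
have [B B0 hB] := periodic_bounded level_T (fun s => (level_periodic s).1) c1.
have [D D0 hD] := periodic_bounded level_T (fun s => (level_periodic s).2) c2.
exists (B + D); first exact: addr_gt0.
move=> x y /level_surj[s [-> ->]]; have := hB s; have := hD s.
by split; lra.
Qed.

(** If t1 = 0 then t2 = 1, and Euler's identity reads y h_y = k h. For k > 0 it keeps
   Cs' = - h_y away from 0 along the curve, against Rolle's theorem; for k = 0, h does
   not depend on y and its level set is unbounded. *)
Lemma level_t_gt0 : (0 < t.1)%N /\ (0 < t.2)%N.
Proof.
have [B B0 hB] := level_bounded; have T0 := level_T.
have := ht; rewrite /is_type => cop.
split; rewrite lt0n; apply/eqP => t0.
- have t21 : t.2 = 1%N by move: cop; rewrite t0 /coprime gcd0n => /eqP.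
  case: (posnP k) => k0.
    have dY0 : dY h = 0.
      apply: bipoly_eqP => i j; rewrite dY_coef !coef0.
      have [->|/hh] := eqVneq h`_i`_j.+1 0; first by rewrite mul0rn.
      by rewrite t0 t21 k0.
    have e : h.[Cs 0, Sn 0] = h.[Cs 0, B + 1].
      apply: (@is_derive_0_is_cst R (fun y => h.[Cs 0, y])) => y.
      apply: der_eq (der_ev h (der_cst (Cs 0) y) (der_id y)) _.
      by rewrite dY0 !horner0; ring.
    have [_] := hB (Cs 0) (B + 1) ltac:(by rewrite -e level_on).
    by rewrite ger0_norm; lra.
  have [|c _ hc] := @der_MVT R Cs (fun s => - (dY h).[Cs s, Sn s]) 0 T (ltW T0).
    by move=> x _; case: (level_der x).
  move: hc; rewrite -{1}[T]add0r (level_periodic 0).1 subrr => /esym/eqP.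
  rewrite mulf_eq0 subr0 (gt_eqF T0) orbF oppr_eq0 => /eqP d0.
  have := euler (Cs c) (Sn c) hh; rewrite t0 t21 d0 level_on !mul0r !mulr0 addr0 mulr1.
  by move=> /eqP; rewrite eq_sym pnatr_eq0 -leqn0 leqNgt k0.
- have t11 : t.1 = 1%N by move: cop; rewrite t0 /coprime gcdn0 => /eqP.
  case: (posnP k) => k0.
    have dX0 : dX h = 0.
      apply: bipoly_eqP => i j; rewrite dX_coef !coef0.
      have [->|/hh] := eqVneq h`_i.+1`_j 0; first by rewrite mul0rn.
      by rewrite t0 t11 k0.
    have e : h.[Cs 0, Sn 0] = h.[B + 1, Sn 0].
      apply: (@is_derive_0_is_cst R (fun x => h.[x, Sn 0])) => y.
      apply: der_eq (der_ev h (der_id y) (der_cst (Sn 0) y)) _.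
      by rewrite dX0 !horner0; ring.
    have [] := hB (B + 1) (Sn 0) ltac:(by rewrite -e level_on).
    by rewrite ger0_norm; lra.
  have [|c _ hc] := @der_MVT R Sn (fun s => (dX h).[Cs s, Sn s]) 0 T (ltW T0).
    by move=> x _; case: (level_der x).
  move: hc; rewrite -{1}[T]add0r (level_periodic 0).2 subrr => /esym/eqP.
  rewrite mulf_eq0 subr0 (gt_eqF T0) orbF => /eqP d0.
  have := euler (Cs c) (Sn c) hh; rewrite t0 t11 d0 level_on !mul0r !mulr0 add0r mulr1.
  by move=> /eqP; rewrite eq_sym pnatr_eq0 -leqn0 leqNgt k0.
Qed.

Lemma level_k_gt0 : (0 < k)%N.
Proof.
have [B B0 hB] := level_bounded; have [t1 t2] := level_t_gt0.
rewrite lt0n; apply/eqP => k0.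
have e x y : h.[0, 0] = h.[x, y].
  have z n : (0 < n)%N -> 0 ^+ n = 0 :> R by move=> n0; rewrite expr0n gtn_eqF.
  have := whomog_ev 0 x y hh.
  by rewrite z // z // k0 expr0 !mul0r mul1r.
have [] := hB (B + 1) 0 ltac:(by rewrite -(e (B + 1)) (e (Cs 0) (Sn 0)) level_on).
by rewrite ger0_norm; lra.
Qed.

(** Near a direction where h vanishes the level set would escape to infinity. So on the
   circle h takes no value in some interval ]0, m[, and it is positive at some point:
   by the intermediate value theorem it is positive everywhere. *)
Lemma level_pos x y : (x, y) != (0, 0) -> 0 < h.[x, y].
Proof.
have [B B0 hB] := level_bounded; have [t1 t2] := level_t_gt0; have k0 := level_k_gt0.
pose f phi := h.[cos phi, sin phi].
have cf : continuous f.
  by move=> s; apply: continuous_ev; [exact: continuous_cos | exact: continuous_sin].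
pose P := Num.max 1 (2 * B).
have P1 : 1 <= P by rewrite le_max lexx.
have gap phi : 0 < f phi -> P ^- k <= f phi.
  move=> fp; have [b b0 bk] := nat_root fp k0.
  have hl : h.[b^-1 ^+ t.1 * cos phi, b^-1 ^+ t.2 * sin phi] = 1.
    by rewrite (whomog_ev _ _ _ hh) -/(f phi) -bk -exprMn mulVf ?expr1n // gt_eqF.
  have [h1 h2] := hB _ _ hl.
  suff bP : b^-1 <= P.
    rewrite -bk -exprVn; apply: lerXn2r; rewrite ?nnegrE.
    - by rewrite invr_ge0; lra.
    - exact: ltW.
    - by rewrite -[b]invrK lef_pV2 ?posrE ?invr_gt0 //; lra.
  rewrite leNgt; apply/negP => Pb.
  have b1 : 1 <= b^-1 by lra.
  have B2 : 2 * B < b^-1 by apply: le_lt_trans Pb; rewrite le_max lexx orbT.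
  have pw n : (0 < n)%N -> b^-1 <= b^-1 ^+ n.
    by move=> n0; rewrite -{1}[b^-1]expr1; apply: ler_weXn2l.
  have hc : `|cos phi| < 1 / 2.
    rewrite ltNge; apply/negP => hc; move: h1; apply/negP; rewrite -ltNge normrM.
    apply: (@lt_le_trans _ _ (b^-1 * (1 / 2))); first lra.
    apply: ler_pM => //; try lra.
    by apply: le_trans (pw _ t1) _; exact: ler_norm.
  have hs : `|sin phi| < 1 / 2.
    rewrite ltNge; apply/negP => hs; move: h2; apply/negP; rewrite -ltNge normrM.
    apply: (@lt_le_trans _ _ (b^-1 * (1 / 2))); first lra.
    apply: ler_pM => //; try lra.
    by apply: le_trans (pw _ t2) _; exact: ler_norm.
  have := cos2Dsin2 phi; rewrite -(real_normK (num_real (cos phi))) -(real_normK (num_real (sin phi))).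
  have : `|cos phi| ^+ 2 <= (1 / 2) ^+ 2.
    by apply: lerXn2r; rewrite ?nnegrE //; lra.
  have : `|sin phi| ^+ 2 <= (1 / 2) ^+ 2.
    by apply: lerXn2r; rewrite ?nnegrE //; lra.
  rewrite !expr2; lra.
have polar (a b : R) : (a, b) != (0, 0) -> exists rho phi, 0 < rho /\ h.[a, b] = rho ^+ k * f phi.
  move=> ab; have [rho [phi [r0 _ -> ->]]] := weighted_polar t1 t2 ab.
  by exists rho, phi; split=> //; exact: whomog_ev.
have h00 : h.[0, 0] = 0.
  have := whomog_ev 0 0 0 hh; rewrite !mulr0 => ->.
  by rewrite expr0n gtn_eqF //= mul0r.
have [|r1 [phi1 [r10 e1]]] := polar (Cs 0) (Sn 0).
  by apply/eqP => -[e1 e2]; have := level_on 0; rewrite e1 e2 h00 => /eqP; rewrite eq_sym oner_eq0.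
have f1 : 0 < f phi1.
  have : 0 < r1 ^+ k * f phi1 by rewrite -e1 level_on.
  by rewrite pmulr_rgt0 // exprn_gt0.
move=> xy; have [r2 [phi2 [r20 ->]]] := polar x y xy.
rewrite pmulr_rgt0 ?exprn_gt0 // ltNge; apply/negP => f2.
have m0 : 0 < P ^- k by rewrite invr_gt0 exprn_gt0 //; lra.
have g1 := gap _ f1.
have [|c fc] := @IVTany R f phi2 phi1 (P ^- k / 2) cf.
  by apply/andP; split; lra.
have fc0 : 0 < f c by rewrite fc; lra.
by have := gap c fc0; rewrite fc; lra.
Qed.

(** If k < 2 t1 then x has degree at most 1 in h(x, 0), which cannot be positive on both
   sides of 0. *)
Lemma level_k_ge : (t.1 + t.2 <= k)%N.
Proof.
have [t1 t2] := level_t_gt0; have k0 := level_k_gt0.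
have [N /(_ N (leqnn N))[_ _ hN]] := bipoly_bound h.
suff [h1 h2] : (2 * t.1 <= k)%N /\ (2 * t.2 <= k)%N by lia.
have one : (1 : R) != 0 by exact: oner_neq0.
split; rewrite leqNgt; apply/negP => hk.
- have p1 : 0 < h.[1, 0] by apply: level_pos; apply/eqP => -[/eqP]; rewrite oner_eq0.
  have p2 : 0 < h.[-1, 0] by apply: level_pos; apply/eqP => -[/eqP]; rewrite oppr_eq0 oner_eq0.
  suff : h.[1, 0] + h.[-1, 0] = 0 by lra.
  rewrite !hN -big_split big1 //= => i _; rewrite -big_split big1 //= => j _.
  have [->|pij] := eqVneq h`_i`_j 0; first by rewrite !mul0r addr0.
  case: (posnP j) => j0; last by rewrite expr0n gtn_eqF // !mulr0 addr0.
  have := hh pij; rewrite j0 muln0 addn0 => ek.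
  have -> : (i : nat) = 1%N by nia.
  by rewrite !expr1 expr0; ring.
- have p1 : 0 < h.[0, 1] by apply: level_pos; apply/eqP => -[/eqP]; rewrite oner_eq0.
  have p2 : 0 < h.[0, -1] by apply: level_pos; apply/eqP => -[/eqP]; rewrite oppr_eq0 oner_eq0.
  suff : h.[0, 1] + h.[0, -1] = 0 by lra.
  rewrite !hN -big_split big1 //= => i _; rewrite -big_split big1 //= => j _.
  have [->|pij] := eqVneq h`_i`_j 0; first by rewrite !mul0r addr0.
  case: (posnP i) => i0; last by rewrite expr0n gtn_eqF // !mulr0 !mul0r addr0.
  have := hh pij; rewrite i0 muln0 add0n => ek.
  have -> : (j : nat) = 1%N by nia.
  by rewrite !expr1 expr0; ring.
Qed.
End LevelCurve.

(** * Weighted polar coordinates *)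

Section PolarFrame.
Variables (R : realType) (t : nat * nat) (k : nat) (h : {poly {poly R}}).
Hypothesis t1 : (0 < t.1)%N.
Hypothesis t2 : (0 < t.2)%N.
Hypothesis k0 : (0 < k)%N.
Hypothesis hh : whomog t k h.
Hypothesis hpos : forall x y, (x, y) != (0, 0) -> 0 < h.[x, y].

(** Weighted polar coordinates whose unit curve is the level curve h = 1. The parameter
   s is e times the Euclidean polar angle, so e is the sense of rotation; lam ds
   is the time of X_h. *)
Record polar_frame (e : R) (C S lam E : R -> R) : Prop := PolarFrame {
  pf_level : forall s, h.[C s, S s] = 1;
  pf_C : forall s, der C s (- (lam s * (dY h).[C s, S s]));
  pf_S : forall s, der S s (lam s * (dX h).[C s, S s]);
  pf_lam : continuous lam;
  pf_perC : forall s, C (s + 2 * pi) = C s;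
  pf_perS : forall s, S (s + 2 * pi) = S s;
  pf_perl : forall s, lam (s + 2 * pi) = lam s;
  pf_lam0 : forall s, 0 < e * lam s;
  pf_polC : forall s, C s = E s ^+ t.1 * cos (e * s);
  pf_polS : forall s, S s = E s ^+ t.2 * sin (e * s);
  pf_E : forall s, 0 < E s;
  pf_Ec : continuous E;
  pf_surj : forall x y, (x, y) != (0, 0) -> exists u s, [/\ 0 < u, 0 <= s <= 2 * pi,
     x = u ^+ t.1 * C s & y = u ^+ t.2 * S s] }.

(** The unit circle is pushed onto the level curve along the weighted dilations, by
   E = h^(-1/k). By Euler's identity, the velocity of the resulting curve is
   proportional to X_h. *)
Lemma polar_frame_exists (e : R) : e = 1 \/ e = -1 ->
  exists C S lam E, polar_frame e C S lam E.
Proof.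
move=> he; have ee : e * e = 1 by case: he => ->; rewrite ?mulr1 ?mulrNN ?mulr1.
have kR : (k%:R : R) != 0 by rewrite pnatr_eq0 -lt0n.
pose c s := cos (e * s); pose d s := sin (e * s).
have cd s : c s ^+ 2 + d s ^+ 2 = 1 by exact: cos2Dsin2.
have dc s : der c s (- (e * d s)).
  have := @der_comp R (@cos R) (fun s => e * s) s _ _ (is_derive_cos _) (der_Z e (der_id s)).
  by move/der_eq; apply; rewrite /d; ring.
have dd s : der d s (e * c s).
  have := @der_comp R (@sin R) (fun s => e * s) s _ _ (is_derive_sin _) (der_Z e (der_id s)).
  by move/der_eq; apply; rewrite /c; ring.
have percd s : c (s + 2 * pi) = c s /\ d (s + 2 * pi) = d s.
  rewrite /c /d mulrDr; case: he => ->.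
    by rewrite !mul1r mulr_natl cosD2pi sinD2pi.
  have e3 : -1 * s + -1 * (2 * pi) + pi *+ 2 = -1 * s by ring.
  by rewrite -[cos (_ + _)]cosD2pi -[sin (_ + _)]sinD2pi e3.
pose sig s := h.[c s, d s].
have sig0 s : 0 < sig s.
  apply: hpos; apply/eqP => -[c0 d0]; have := cd s.
  by rewrite c0 d0 expr0n /= addr0 => /eqP; rewrite eq_sym oner_eq0.
have dsig s : der sig s (e * (c s * (dY h).[c s, d s] - d s * (dX h).[c s, d s])).
  by apply: der_eq (der_ev h (dc s) (dd s)) _; ring.
pose E s := expR (- (k%:R^-1 * ln (sig s))).
have E0 s : 0 < E s by exact: expR_gt0.
have Ek s : E s ^+ k * sig s = 1.
  rewrite /E -expRM_natl mulrN mulrA divff // mul1r expRN lnK ?posrE //.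
  by rewrite mulVf // gt_eqF.
have dE s : der E s (E s * - (k%:R^-1 * ((sig s)^-1 *
     (e * (c s * (dY h).[c s, d s] - d s * (dX h).[c s, d s]))))).
  apply: (@der_comp R (@expR R) (fun s => - (k%:R^-1 * ln (sig s)))).
    exact: is_derive_expR.
  apply: der_N; apply: der_Z; apply: (@der_comp R (@ln R) sig) => //.
  exact: is_derive1_ln.
pose C s := E s ^+ t.1 * c s; pose S s := E s ^+ t.2 * d s.
pose Del s := t.1%:R * c s ^+ 2 + t.2%:R * d s ^+ 2.
pose lam s := e * (Del s * (E s ^+ (t.1 + t.2) / k%:R)).
have eul s := euler (c s) (d s) hh.
have hdX s : E s ^+ t.1 * (dX h).[C s, S s] = E s ^+ k * (dX h).[c s, d s].
  have [kt|kt] := leqP t.1 k.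
    have hk : whomog t (k - t.1 + t.1) h by rewrite subnK.
    by rewrite (whomog_ev _ _ _ (whomog_dX hk)) mulrA -exprD subnKC.
  suff -> : dX h = 0 by rewrite !horner0 !mulr0.
  apply: bipoly_eqP => i j; rewrite dX_coef !coef0.
  have [->|/hh] := eqVneq h`_i.+1`_j 0; first by rewrite mul0rn.
  by rewrite mulnS; move: kt; clear; lia.
have hdY s : E s ^+ t.2 * (dY h).[C s, S s] = E s ^+ k * (dY h).[c s, d s].
  have [kt|kt] := leqP t.2 k.
    have hk : whomog t (k - t.2 + t.2) h by rewrite subnK.
    by rewrite (whomog_ev _ _ _ (whomog_dY hk)) mulrA -exprD subnKC.
  suff -> : dY h = 0 by rewrite !horner0 !mulr0.
  apply: bipoly_eqP => i j; rewrite dY_coef !coef0.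
  have [->|/hh] := eqVneq h`_i`_j.+1 0; first by rewrite mul0rn.
  by rewrite mulnS; move: kt; clear; lia.
have En0 s n : E s ^+ n != 0 by rewrite expf_neq0 // gt_eqF.
have sn0 s : sig s != 0 by rewrite gt_eqF.
have Esig s : E s ^+ k = (sig s)^-1 by rewrite -[RHS]mul1r -(Ek s) mulfK.
have Epred s n : (0 < n)%N -> E s ^+ n.-1 * E s = E s ^+ n.
  by move=> n0; rewrite mulrC -exprS prednK.
have natS n : (0 < n)%N -> n%:R = n.-1%:R + 1 :> R by move=> n0; rewrite natr1 prednK.
have cont f' g' : (forall s : R, der f' s (g' s)) -> continuous f'.
  by move=> hf s; exact: der_cont (hf s).
exists C, S, lam, E; split.
- by move=> s; rewrite (whomog_ev _ _ _ hh) -/(sig s) Ek.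
- move=> s; have dEt := der_X t.1 (dE s).
  apply: der_eq (der_M dEt (dc s)) _.
  have -> : lam s * (dY h).[C s, S s] =
     e * Del s / k%:R * E s ^+ t.1 * (E s ^+ t.2 * (dY h).[C s, S s]).
    by rewrite /lam exprD; ring.
  rewrite hdY Esig.
  have -> : t.1%:R * E s ^+ t.1.-1 * (E s * - (k%:R^-1 * ((sig s)^-1 *
     (e * (c s * (dY h).[c s, d s] - d s * (dX h).[c s, d s]))))) * c s =
     - (t.1%:R * (E s ^+ t.1.-1 * E s) * (k%:R^-1 * ((sig s)^-1 *
     (e * (c s * (dY h).[c s, d s] - d s * (dX h).[c s, d s])))) * c s) by ring.
  rewrite Epred //.
  have -> : E s ^+ t.1 * - (e * d s) =
    - (E s ^+ t.1 * (k%:R^-1 * ((sig s)^-1 * (e * d s * (k%:R * sig s))))).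
    by field; rewrite kR sn0.
  rewrite -/(sig s) in eul; rewrite -(eul s) /Del; ring.
- move=> s; have dEt := der_X t.2 (dE s).
  apply: der_eq (der_M dEt (dd s)) _.
  have -> : lam s * (dX h).[C s, S s] =
     e * Del s / k%:R * E s ^+ t.2 * (E s ^+ t.1 * (dX h).[C s, S s]).
    by rewrite /lam exprD; ring.
  rewrite hdX Esig.
  have -> : t.2%:R * E s ^+ t.2.-1 * (E s * - (k%:R^-1 * ((sig s)^-1 *
     (e * (c s * (dY h).[c s, d s] - d s * (dX h).[c s, d s]))))) * d s =
     - (t.2%:R * (E s ^+ t.2.-1 * E s) * (k%:R^-1 * ((sig s)^-1 *
     (e * (c s * (dY h).[c s, d s] - d s * (dX h).[c s, d s])))) * d s) by ring.
  rewrite Epred //.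
  have -> : E s ^+ t.2 * (e * c s) =
    E s ^+ t.2 * (k%:R^-1 * ((sig s)^-1 * (e * c s * (k%:R * sig s)))).
    by field; rewrite kR sn0.
  rewrite -/(sig s) in eul; rewrite -(eul s) /Del; ring.
- have cc := cont _ _ dc; have cdd := cont _ _ dd; have cE := cont _ _ dE.
  move=> s; apply: (@contM R (fun=> e) (fun s => Del s * (E s ^+ (t.1 + t.2) / k%:R))); first exact: cont_cst.
  apply: (@contM R Del (fun s => E s ^+ (t.1 + t.2) / k%:R)).
    apply: (@contD R (fun s => t.1%:R * c s ^+ 2) (fun s => t.2%:R * d s ^+ 2)).
      by apply: (@contM R (fun=> t.1%:R) (fun s => c s ^+ 2)); [exact: cont_cst | apply: (@contX R c); exact: cc].
    by apply: (@contM R (fun=> t.2%:R) (fun s => d s ^+ 2)); [exact: cont_cst | apply: (@contX R d); exact: cdd].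
  apply: (@contM R (fun s => E s ^+ (t.1 + t.2)) (fun=> k%:R^-1)); last exact: cont_cst.
  by apply: (@contX R E); exact: cE.
- by move=> s; rewrite /C /E /sig; have [-> ->] := percd s.
- by move=> s; rewrite /S /E /sig; have [-> ->] := percd s.
- by move=> s; rewrite /lam /Del /E /sig; have [-> ->] := percd s.
- move=> s; rewrite /lam mulrA ee mul1r.
  have D0 : 0 < Del s.
    have h1 : 1 <= t.1%:R :> R by rewrite ler1n.
    have h2 : 1 <= t.2%:R :> R by rewrite ler1n.
    apply: (@lt_le_trans _ _ (c s ^+ 2 + d s ^+ 2)); first by rewrite cd.
    by apply: lerD; rewrite ler_peMl ?sqr_ge0.
  by rewrite mulr_gt0 // divr_gt0 ?exprn_gt0 // ltr0n.
- by [].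
- by [].
- by [].
- exact: cont _ _ dE.
- move=> x y xy; have [rho [phi [r0 hphi -> ->]]] := weighted_polar t1 t2 xy.
  have [s0 hs0 [cs0 ds0]] : exists2 s0, 0 <= s0 <= 2 * pi & c s0 = cos phi /\ d s0 = sin phi.
    case: he => e1; [exists phi => // | exists (2 * pi - phi); first by lra].
      by rewrite /c /d e1 !mul1r.
    have e3 : e * (2 * pi - phi) + pi *+ 2 = phi by rewrite e1; ring.
    by rewrite /c /d -[cos (e * _)]cosD2pi -[sin (e * _)]sinD2pi e3.
  exists (rho / E s0), s0; split=> //.
  + by rewrite divr_gt0.
  + by rewrite /C cs0 mulrA -exprMn divfK // gt_eqF.
  + by rewrite /S ds0 mulrA -exprMn divfK // gt_eqF.
Qed.
End PolarFrame.

(** * Expansion by weighted degree *)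

Section WeightedExpansion.
Variable R : realType.
Implicit Types (a : fps R) (b : nat -> R) (C k c s u : R).

(** The coefficient of u^n in the series a at (u^t1 c, u^t2 s). *)
Definition wcoef (t : nat * nat) a c s n : R :=
  \sum_(i < n.+1) \sum_(j < n.+1)
    (if (t.1 * i + t.2 * j == n)%N then a i j * c ^+ i * s ^+ j else 0).

Lemma sum_widen (F : nat -> R) n N : (n <= N)%N ->
  (forall i, (n <= i)%N -> F i = 0) -> \sum_(i < n) F i = \sum_(i < N) F i.
Proof.
move=> nN h; rewrite (big_ord_widen N F nN) [RHS](bigID (fun i : 'I_N => (i < n)%N)) /=.
by rewrite [X in _ + X]big1 ?addr0 // => i; rewrite -leqNgt => /h.
Qed.

Lemma weight_ge (t : nat * nat) i j : (0 < t.1)%N -> (0 < t.2)%N ->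
  (i + j <= t.1 * i + t.2 * j)%N.
Proof. by move=> t1 t2; rewrite leq_add ?leq_pmull. Qed.

Lemma wcoef_widen t a c s n N : (0 < t.1)%N -> (0 < t.2)%N -> (n < N)%N ->
  wcoef t a c s n = \sum_(i < N) \sum_(j < N)
    (if (t.1 * i + t.2 * j == n)%N then a i j * c ^+ i * s ^+ j else 0).
Proof.
move=> t1 t2 nN; rewrite /wcoef.
pose F (i j : nat) := if (t.1 * i + t.2 * j == n)%N then a i j * c ^+ i * s ^+ j else 0.
have F0 i j : (n < i + j)%N -> F i j = 0.
  by move=> h; rewrite /F; case: eqP => // e; have := weight_ge i j t1 t2; rewrite e leqNgt h.
transitivity (\sum_(i < n.+1) \sum_(j < N) F i j).
  by apply: eq_bigr => i _; apply: (@sum_widen (F i)) => // j nj; apply: F0; rewrite (leq_trans nj) ?leq_addl.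
apply: (@sum_widen (fun i => \sum_(j < N) F i j)) => // i ni.
by apply: big1 => j _; apply: F0; rewrite (leq_trans ni) ?leq_addr.
Qed.

Lemma sum_wcoef t a c s u n N : (0 < t.1)%N -> (0 < t.2)%N -> (n <= N)%N ->
  \sum_(m < n) wcoef t a c s m * u ^+ m = \sum_(i < N) \sum_(j < N)
    (if (t.1 * i + t.2 * j < n)%N
     then a i j * (u ^+ t.1 * c) ^+ i * (u ^+ t.2 * s) ^+ j else 0).
Proof.
move=> t1 t2 nN.
transitivity (\sum_(m < n) \sum_(i < N) \sum_(j < N)
   (if (t.1 * i + t.2 * j == m)%N then
     a i j * (u ^+ t.1 * c) ^+ i * (u ^+ t.2 * s) ^+ j else 0)).
  apply: eq_bigr => m _; rewrite (@wcoef_widen t a c s m N) //; last exact: leq_trans nN.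
  rewrite mulr_suml; apply: eq_bigr => i _; rewrite mulr_suml; apply: eq_bigr => j _.
  case: eqP => [e|_]; last by rewrite mul0r.
  by rewrite !exprMn -!exprM -e exprD; ring.
rewrite exchange_big; apply: eq_bigr => i _; rewrite exchange_big; apply: eq_bigr => j _ /=.
case: ltnP => hw.
  rewrite (bigD1 (Ordinal hw)) //= eqxx big1 ?addr0 // => m mw.
  by case: eqP => // e; case/eqP: mw; apply/val_inj.
by rewrite big1 // => m _; case: eqP => // e; have := ltn_ord m; rewrite -e ltnNge hw.
Qed.

Lemma double_geo_sum N : \sum_(i < N) \sum_(j < N) (1 / 2 : R) ^+ i * (1 / 2) ^+ j <= 4.
Proof.
have g : \sum_(i < N) (1 / 2 : R) ^+ i <= 2 by apply: geo_half_sum; apply/andP; split; lra.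
have g0 : 0 <= \sum_(i < N) (1 / 2 : R) ^+ i by rewrite sumr_ge0 // => i _; rewrite exprn_ge0 //; lra.
have -> : \sum_(i < N) \sum_(j < N) (1 / 2 : R) ^+ i * (1 / 2) ^+ j =
    (\sum_(i < N) (1 / 2 : R) ^+ i) * (\sum_(j < N) (1 / 2) ^+ j).
  by rewrite mulr_suml; apply: eq_bigr => i _; rewrite mulr_sumr.
have -> : 4 = 2 * 2 :> R by ring.
exact: ler_pM.
Qed.

(** Both weights being positive, a term of weight n has degree at most n, and geometric
   bounds on a give geometric bounds in n. *)
Lemma weighted_expansion (t : nat * nat) a (g : R * R -> R) B :
  (0 < t.1)%N -> (0 < t.2)%N -> power_series_at0 a g ->
  exists C0 k0, [/\ 0 < C0, 0 < k0 & forall c s, `|c| <= B -> `|s| <= B ->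
    expands C0 k0 (wcoef t a c s) (fun u => g (u ^+ t.1 * c, u ^+ t.2 * s))].
Proof.
move=> t1 t2 [rho [M [rho0 hM hg]]].
pose r1 := Num.min rho 1; pose B1 := Num.max B 1.
have r10 : 0 < r1 by rewrite lt_min rho0 ltr01.
have r11 : r1 <= 1 by rewrite ge_min lexx orbT.
have B11 : 1 <= B1 by rewrite le_max lexx orbT.
have B10 : 0 < B1 by lra.
pose be := B1 / r1.
have be1 : 1 <= be by rewrite ler_pdivlMr // mul1r; lra.
have be0 : 0 < be by lra.
have M0 : 0 <= M by apply: le_trans (hM 0%N 0%N); rewrite mulr_ge0 // exprn_ge0 // ltW.
have ha i j : `|a i j| * r1 ^+ (i + j) <= M.
  apply: le_trans (hM i j); rewrite ler_wpM2l //.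
  by apply: lerXn2r; rewrite ?nnegrE ?ge_min ?lexx // ltW.
exists (4 * M + 1), (4 * be); split; [lra | lra |] => c s cB sB.
have cB1 : `|c| <= B1 by rewrite le_max cB.
have sB1 : `|s| <= B1 by rewrite le_max sB.
have term i j : `|a i j| * `|c| ^+ i * `|s| ^+ j <= M * be ^+ (i + j).
  have h1 : `|c| ^+ i * `|s| ^+ j <= B1 ^+ i * B1 ^+ j.
    by apply: ler_pM; rewrite ?exprn_ge0 //; apply: lerXn2r => //; rewrite nnegrE ltW.
  rewrite -mulrA; apply: le_trans (ler_wpM2l _ h1) _ => //.
  rewrite /be expr_div_n -exprD [M * (_ / _)]mulrA ler_pdivlMr ?exprn_gt0 // mulrAC.
  by apply: ler_wpM2r; [rewrite exprn_ge0 // ltW | exact: ha].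
have bew (i j w : nat) : (i + j <= w)%N -> be ^+ (i + j) <= be ^+ w.
  by move=> h; apply: ler_weXn2l.
split=> [n|u n u0 ku].
  have hterm (i j : 'I_n.+1) :
     `|if (t.1 * i + t.2 * j == n)%N then a i j * c ^+ i * s ^+ j else 0| <= M * be ^+ n.
    case: eqP => [e|_]; last by rewrite normr0 mulr_ge0 // exprn_ge0 // ltW.
    rewrite !normrM !normrX; apply: le_trans (term i j) _; rewrite ler_wpM2l //.
    by apply: bew; have := weight_ge i j t1 t2; rewrite e.
  apply: le_trans (ler_norm_sum _ _ _) _.
  apply: (@le_trans _ _ (\sum_(i < n.+1) \sum_(j < n.+1) M * be ^+ n)).
    by apply: ler_sum => i _; apply: le_trans (ler_norm_sum _ _ _) _; apply: ler_sum.
  rewrite !sumr_const !card_ord.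
  rewrite [X in X <= _](_ : _ = (n.+1 * n.+1)%:R * (M * be ^+ n)); last by rewrite mulr_natl mulrnA.
  rewrite [(4 * be) ^+ n]exprMn.
  have p2 : n.+1%:R <= 2 ^+ n :> R.
    by rewrite -natrX ler_nat; apply: ltn_expl.
  have p4 : (n.+1 * n.+1)%:R <= 4 ^+ n :> R.
    have -> : 4 = 2 * 2 :> R by ring.
    by rewrite exprMn natrM; apply: ler_pM.
  have Mb : 0 <= M * be ^+ n by rewrite mulr_ge0 // exprn_ge0 // ltW.
  apply: le_trans (ler_wpM2r Mb p4) _.
  have : 0 <= 4 ^+ n * be ^+ n :> R by rewrite mulr_ge0 ?exprn_ge0 // ltW.
  have : 0 <= M * (4 ^+ n * be ^+ n) by rewrite mulr_ge0 // mulr_ge0 ?exprn_ge0 // ltW.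
  have -> : 4 ^+ n * (M * be ^+ n) = M * (4 ^+ n * be ^+ n) by ring.
  lra.
pose q := be * u.
have q0 : 0 < q by rewrite mulr_gt0.
have q2 : 2 * q <= 1 / 2 by move: ku; rewrite /q; lra.
have u1 : u <= 1.
  have : 1 * u <= be * u by rewrite ler_pM2r.
  by rewrite mul1r -/q; lra.
set x := u ^+ t.1 * c; set y := u ^+ t.2 * s.
have hxy : `|(x, y)| < rho.
  have up m : (0 < m)%N -> u ^+ m <= u.
    by move=> m0; rewrite -{2}[u]expr1; apply: ler_wiXn2l => //; exact: ltW.
  have uB : u * B1 < rho.
    have : u * B1 = q * r1 by rewrite /q /be; field; rewrite gt_eqF.
    have : q * r1 <= q * rho by rewrite ler_pM2l // ge_min lexx.
    have : q * rho <= 1 / 4 * rho by rewrite ler_pM2r //; lra.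
    lra.
  rewrite prod_normE /= gt_max !normrM !normrX (ger0_norm (ltW u0)).
  apply/andP; split; apply: le_lt_trans uB; apply: ler_pM => //;
    by [rewrite exprn_ge0 // ltW | exact: up].
have htail N : (n <= N)%N -> `|\sum_(i < N) \sum_(j < N) a i j * x ^+ i * y ^+ j -
     (\poly_(i < n) wcoef t a c s i).[u]| <= 4 * M * (2 * q) ^+ n.
  move=> nN; rewrite horner_poly (@sum_wcoef t a c s u n N) // -sumrB.
  apply: le_trans (ler_norm_sum _ _ _) _.
  apply: (@le_trans _ _ (\sum_(i < N) \sum_(j < N)
     (M * (2 * q) ^+ n) * ((1 / 2) ^+ i * (1 / 2) ^+ j))); last first.
    have -> : 4 * M * (2 * q) ^+ n = (M * (2 * q) ^+ n) * 4 by ring.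
    under eq_bigr do rewrite -mulr_sumr.
    rewrite -mulr_sumr ler_wpM2l //; last exact: double_geo_sum.
    by rewrite mulr_ge0 // exprn_ge0 // mulr_ge0 // ltW.
  apply: ler_sum => i _; rewrite -sumrB; apply: le_trans (ler_norm_sum _ _ _) _.
  apply: ler_sum => j _; have hp : 0 <= M * (2 * q) ^+ n * ((1 / 2) ^+ i * (1 / 2) ^+ j).
    have hf m : 0 <= (1 / 2 : R) ^+ m by apply: exprn_ge0; lra.
    by apply: mulr_ge0; [rewrite mulr_ge0 // exprn_ge0 // mulr_ge0 // ltW | exact: mulr_ge0].
  case: ltnP => hw; first by rewrite subrr normr0.
  rewrite subr0 !normrM !normrX /x /y !normrM !normrX (ger0_norm (ltW u0)).
  rewrite (exprMn _ (u ^+ t.1)) (exprMn _ (u ^+ t.2)) -!exprM.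
  set w := (t.1 * i + t.2 * j)%N in hw.
  have -> : `|a i j| * (u ^+ (t.1 * i) * `|c| ^+ i) * (u ^+ (t.2 * j) * `|s| ^+ j) =
     (`|a i j| * `|c| ^+ i * `|s| ^+ j) * u ^+ w by rewrite /w exprD; ring.
  have ijw : (i + j <= w)%N by exact: weight_ge.
  apply: (@le_trans _ _ (M * q ^+ w)).
    rewrite /q [(be * u) ^+ w]exprMn mulrA; apply: ler_wpM2r; first by rewrite exprn_ge0 // ltW.
    by apply: le_trans (term i j) _; rewrite ler_wpM2l // bew.
  rewrite -[M * (2 * q) ^+ n * _]mulrA; apply: ler_wpM2l => //.
  have -> : q ^+ w = (2 * q) ^+ w * (1 / 2) ^+ w.
    by rewrite -exprMn; congr (_ ^+ w); field.
  have q20 : 0 <= 2 * q by lra.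
  have h2 : 0 <= 1 / 2 :> R by lra.
  rewrite -exprD; apply: ler_pM; rewrite ?exprn_ge0 //.
    by apply: ler_wiXn2l => //; lra.
  by apply: ler_wiXn2l => //; lra.
have hlim : `|g (x, y) - (\poly_(i < n) wcoef t a c s i).[u]| <= 4 * M * (2 * q) ^+ n.
  apply/ler_addgt0Pr => e e0.
  have /cvgrPdist_lt/(_ e e0)[N _ hN] := hg (x, y) hxy.
  have h1 := hN (maxn n N) (leq_maxr _ _); have h2 := htail (maxn n N) (leq_maxl _ _).
  set S := \sum_(i < maxn n N) _ in h1 h2.
  have -> : g (x, y) - (\poly_(i < n) wcoef t a c s i).[u] =
     (g (x, y) - S) + (S - (\poly_(i < n) wcoef t a c s i).[u]) by ring.
  apply: le_trans (ler_normD _ _) _.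
  have : `|g (x, y) - S| <= e by exact: ltW.
  lra.
apply: le_trans hlim _.
have h4 : (2 * q) ^+ n <= (4 * be * u) ^+ n.
  have -> : 4 * be * u = 4 * q by rewrite /q; ring.
  by apply: lerXn2r; rewrite ?nnegrE; lra.
have h5 : 4 * M * (2 * q) ^+ n <= 4 * M * (4 * be * u) ^+ n.
  by apply: ler_wpM2l => //; rewrite mulr_ge0.
have h6 : 0 <= (4 * be * u) ^+ n by apply: exprn_ge0; apply: mulr_ge0 (ltW u0); apply: mulr_ge0 (ltW be0).
lra.
Qed.

Lemma wcoef_cont t a (C S : R -> R) n : continuous C -> continuous S ->
  continuous (fun s => wcoef t a (C s) (S s) n).
Proof.
move=> cC cS; apply: continuous_bigsum => i; apply: continuous_bigsum => j.
case: eqP => _; last by move=> s; exact: cst_continuous.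
move=> s; apply: (@contM R (fun s => a i j * C s ^+ i) (fun s => S s ^+ j)).
  apply: (@contM R (fun=> a i j) (fun s => C s ^+ i)); first exact: cont_cst.
  by apply: (@contX R C); exact: cC.
by apply: (@contX R S); exact: cS.
Qed.

Lemma wcoef_whomog t (p : {poly {poly R}}) c s n : (0 < t.1)%N -> (0 < t.2)%N ->
  whomog t n p -> wcoef t (fps_of_poly p) c s n = p.[c, s].
Proof.
move=> t1 t2 hp; have [N hN] := bipoly_bound p.
have [_ _ ->] := hN (maxn N n.+1) (leq_maxl _ _).
rewrite (@wcoef_widen t _ c s n (maxn N n.+1)) //; last by rewrite leq_max leqnn orbT.
apply: eq_bigr => i _; apply: eq_bigr => j _; rewrite /fps_of_poly.
case: eqP => // /eqP hw; have [->|/hp e] := eqVneq p`_i`_j 0; first by rewrite !mul0r.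
by rewrite e eqxx in hw.
Qed.

(** * Operations on expansions *)

Lemma expands_lin C k (x b1 b2 : nat -> R) (y f g : R -> R) (al ga M : R) : 0 <= C -> 0 <= k ->
  expands C k b1 f -> expands C k b2 g -> `|al| <= M -> `|ga| <= M ->
  x = (fun n => al * b1 n + ga * b2 n) -> y = (fun u => al * f u + ga * g u) ->
  expands (2 * M * C) k x y.
Proof.
move=> C0 k0 [h1 h2] [h3 h4] hal hga -> ->.
have M0 : 0 <= M by apply: le_trans hal.
split=> [n|u n u0 ku].
  apply: le_trans (ler_normD _ _) _; rewrite !normrM.
  have e1 := ler_pM (normr_ge0 _) (normr_ge0 _) hal (h1 n).
  have e2 := ler_pM (normr_ge0 _) (normr_ge0 _) hga (h3 n).
  have -> : 2 * M * C * k ^+ n = M * (C * k ^+ n) + M * (C * k ^+ n) by ring.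
  exact: lerD.
have -> : al * f u + ga * g u - (\poly_(i < n) (al * b1 i + ga * b2 i)).[u] =
    al * (f u - (\poly_(i < n) b1 i).[u]) + ga * (g u - (\poly_(i < n) b2 i).[u]).
  rewrite !horner_poly !mulrBr !mulr_sumr.
  have -> : \sum_(i < n) (al * b1 i + ga * b2 i) * u ^+ i =
    \sum_(i < n) al * (b1 i * u ^+ i) + \sum_(i < n) ga * (b2 i * u ^+ i).
    by rewrite -big_split /=; apply: eq_bigr => i _; ring.
  ring.
apply: le_trans (ler_normD _ _) _; rewrite !normrM.
have e1 := ler_pM (normr_ge0 _) (normr_ge0 _) hal (h2 u n u0 ku).
have e2 := ler_pM (normr_ge0 _) (normr_ge0 _) hga (h4 u n u0 ku).
have -> : 2 * M * C * (k * u) ^+ n = M * (C * (k * u) ^+ n) + M * (C * (k * u) ^+ n) by ring.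
exact: lerD.
Qed.

Lemma expands_shift C k b (f : R -> R) m : 0 < k -> expands C k b f ->
  (forall i, (i < m)%N -> b i = 0) ->
  expands (C * k ^+ m) k (fun n => b (n + m)%N) (fun u => f u / u ^+ m).
Proof.
move=> k0 [h1 h2] b0; split=> [n|u n u0 ku].
  by rewrite -mulrA -exprD addnC; exact: h1.
have um : 0 < u ^+ m by rewrite exprn_gt0.
have -> : f u / u ^+ m - (\poly_(i < n) b (i + m)%N).[u] =
   (f u - (\poly_(i < m + n) b i).[u]) / u ^+ m.
  rewrite mulrBl; congr (_ - _); rewrite !horner_poly big_split_ord /=.
  rewrite [X in (X + _) / _]big1 ?add0r.
    rewrite mulr_suml; apply: eq_bigr => i _.
    by rewrite exprD addnC; field; rewrite gt_eqF.
  by move=> i _; rewrite b0 ?mul0r.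
rewrite normrM normfV (gtr0_norm um) ler_pdivrMr //.
apply: le_trans (h2 u (m + n)%N u0 ku) _; rewrite exprD exprMn.
by rewrite [X in X <= _](_ : _ = C * k ^+ m * (k * u) ^+ n * u ^+ m) //; ring.
Qed.

Lemma expands_mulX C k b (f : R -> R) : 0 < C -> 0 < k -> expands C k b f ->
  expands (C / k) k (fun n => if n is n'.+1 then b n' else 0) (fun u => u * f u).
Proof.
move=> C0 k0 [h1 h2]; have Ck : 0 < C / k by rewrite divr_gt0.
split=> [[|n]|u [|n] u0 ku].
- by rewrite normr0 expr0 mulr1 ltW.
- apply: le_trans (h1 n) _.
  by rewrite [X in _ <= X](_ : _ = C * k ^+ n) // exprS; field; rewrite gt_eqF.
- rewrite horner_poly big_ord0 subr0 normrM (gtr0_norm u0) expr0 mulr1.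
  have := h2 u 0%N u0 ku; rewrite horner_poly big_ord0 subr0 expr0 mulr1 => h.
  rewrite ler_pdivlMr // mulrAC [u * k]mulrC.
  by apply: le_trans (ler_pM _ _ ku h) _; rewrite ?mul1r // mulr_ge0 // ltW.
- have -> : u * f u - (\poly_(i < n.+1) (if (i : nat) is n'.+1 then b n' else 0)).[u] =
     u * (f u - (\poly_(i < n) b i).[u]).
    rewrite mulrBr; congr (_ - _); rewrite !horner_poly big_ord_recl /= mul0r add0r mulr_sumr.
    by apply: eq_bigr => i _; rewrite /bump /= add1n exprS; ring.
  rewrite normrM (gtr0_norm u0).
  apply: le_trans (ler_wpM2l (ltW u0) (h2 u n u0 ku)) _.
  by rewrite [X in _ <= X](_ : _ = u * (C * (k * u) ^+ n)) // exprS; field; rewrite gt_eqF.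
Qed.

Lemma expands_scale C k b (f : R -> R) al M : 0 <= C -> 0 <= k ->
  expands C k b f -> `|al| <= M ->
  expands (M * C) k (fun n => al * b n) (fun u => al * f u).
Proof.
move=> C0 k0 [h1 h2] hal; have M0 : 0 <= M by apply: le_trans hal.
split=> [n|u n u0 ku].
  by rewrite normrM -mulrA; apply: ler_pM.
have -> : al * f u - (\poly_(i < n) (al * b i)).[u] = al * (f u - (\poly_(i < n) b i).[u]).
  rewrite mulrBr !horner_poly mulr_sumr; congr (_ - _).
  by apply: eq_bigr => i _; ring.
by rewrite normrM -mulrA; apply: ler_pM => //; exact: h2.
Qed.

Lemma expands_weak C k b (f : R -> R) C' k' : 0 <= C -> 0 <= k -> C <= C' -> k <= k' ->
  expands C k b f -> expands C' k' b f.
Proof.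
move=> C0 k0 CC kk [h1 h2]; split=> [n|u n u0 ku].
  apply: le_trans (h1 n) _; apply: ler_pM => //; first by rewrite exprn_ge0.
  by apply: lerXn2r => //; rewrite nnegrE; apply: le_trans kk.
have ku' : k * u <= k' * u by rewrite ler_pM2r.
apply: le_trans (h2 u n u0 (le_trans ku' ku)) _.
have u0' := ltW u0.
apply: ler_pM => //; first by rewrite exprn_ge0 // mulr_ge0.
by apply: lerXn2r => //; rewrite nnegrE mulr_ge0 //; apply: le_trans kk.
Qed.

(** Partial sums are jointly continuous and approximate uniformly. *)
Lemma expands_cont C k (b : nat -> R -> R) (f : R -> R -> R) (v : R -> R) s :
  0 < C -> 0 < k -> (forall s, expands C k (b^~ s) (f s)) ->
  (forall n, continuous (b n)) -> {for s, continuous v} ->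
  0 < v s -> k * v s < 1 / 2 -> {for s, continuous (fun s => f s (v s))}.
Proof.
move=> C0 k0 hf cb cv v0 kv; apply/contP => e e0.
have e1 : 0 < e / (4 * C) by rewrite divr_gt0 // mulr_gt0.
have [n hn] := half_exp_small e1.
pose p s := \sum_(i < n) b i s * v s ^+ i.
have cp : {for s, continuous p}.
  rewrite /p; elim: n {hn p} => [|n IH].
    have -> : (fun s => \sum_(i < 0) b i s * v s ^+ i) = fun=> 0.
      by apply/funext => y; rewrite big_ord0.
    exact: cont_cst.
  have -> : (fun s => \sum_(i < n.+1) b i s * v s ^+ i) =
     fun s => (\sum_(i < n) b i s * v s ^+ i) + b n s * v s ^+ n.
    by apply/funext => y; rewrite big_ord_recr.
  apply: contD; first exact: IH.
  by apply: contM; [exact: cb | exact: contX].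
have e2 : 0 < e / 4 by rewrite divr_gt0.
have [d d0 hd] := (contP _ _).1 cp _ e2.
pose d1 := Num.min (v s) ((1 / 2 - k * v s) / k).
have d10 : 0 < d1 by rewrite lt_min v0 divr_gt0 //; lra.
have [d2 d20 hd2] := (contP _ _).1 cv _ d10.
exists (Num.min d d2); first by rewrite lt_min d0.
have hb y : 0 < v y -> k * v y <= 1 / 2 -> `|f y (v y) - p y| < e / 4 + e / 16.
  move=> y0 ky; have ky1 : k * v y <= 1 by lra.
  have := (hf y).2 (v y) n y0 ky1; rewrite horner_poly => h; apply: le_lt_trans h _.
  have kv0 : 0 <= k * v y by rewrite mulr_ge0 ?ltW.
  apply: (@le_lt_trans _ _ (C * (e / (4 * C)))).
    rewrite ler_pM2l //; apply: le_trans hn.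
    by apply: lerXn2r => //; rewrite nnegrE; lra.
  by rewrite (_ : C * (e / (4 * C)) = e / 4); [lra | field; rewrite gt_eqF].
move=> y; rewrite lt_min => /andP[yd yd2].
have := hd2 y yd2; rewrite lt_min => /andP[vu vk].
have y0 : 0 < v y by move: vu; rewrite ltr_norml; lra.
have ky : k * v y <= 1 / 2.
  move: vk; rewrite ltr_pdivlMr // => vk.
  have : (v y - v s) * k <= `|v y - v s| * k by rewrite ler_pM2r // ler_norm.
  lra.
have g1 := hb y y0 ky; have g2 := hb s v0 (ltW kv); have g3 := hd y yd.
move: g1 g2 g3; rewrite !ltr_norml; lra.
Qed.
End WeightedExpansion.

(** * The polar equation *)

Section PolarEquation.
Variables (R : realType) (t : nat * nat) (k : nat) (h : {poly {poly R}}).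
Variables (e : R) (C S lam E : R -> R) (f : fvf R) (F : R * R -> R * R).
Hypothesis t1 : (0 < t.1)%N.
Hypothesis t2 : (0 < t.2)%N.
Hypothesis hk : (t.1 + t.2 <= k)%N.
Hypothesis hh : whomog t k h.
Hypothesis he : e = 1 \/ e = -1.
Hypothesis pf : polar_frame t h e C S lam E.
Hypothesis hF : has_taylor F f.
Hypothesis hf : qhhot t (k%:Z - (wt t)%:Z) f (Xh h).

Definition wr := (k - (t.1 + t.2))%N.

Definition polar_pt (u s : R) : R * R := (u ^+ t.1 * C s, u ^+ t.2 * S s).

(** The components of F, divided by the powers of u which they contain. *)
Definition comp1 (s u : R) := (F (polar_pt u s)).1 / u ^+ (k - t.2).
Definition comp2 (s u : R) := (F (polar_pt u s)).2 / u ^+ (k - t.1).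
(** The radial and the angular components of F, up to the factor k h = k. *)
Definition num (s u : R) :=
  (dX h).[C s, S s] * comp1 s u + (dY h).[C s, S s] * comp2 s u.
Definition den (s u : R) :=
  (- (t.2%:R * S s)) * comp1 s u + t.1%:R * C s * comp2 s u.
Definition polar_rhs (s u : R) := lam s * (u * (num s u / den s u)).
(** The derivative of the time with respect to the angle along the orbits of e F. *)
Definition slowness (s u : R) := e * lam s * k%:R / (u ^+ wr * den s u).

Lemma frame_cont : continuous C /\ continuous S.
Proof.
by split=> s; [exact: der_cont (pf_C pf s) | exact: der_cont (pf_S pf s)].
Qed.

Lemma frame_bounded : exists2 B, 0 < B & forall s,
  [/\ `|C s| <= B, `|S s| <= B, `|(dX h).[C s, S s]| <= B,
      `|(dY h).[C s, S s]| <= B & `|lam s| <= B].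
Proof.
have p0 : 0 < 2 * pi :> R by rewrite mulr_gt0 // pi_gt0.
have [cC cS] := frame_cont.
have [B1 B10 h1] := periodic_bounded p0 (pf_perC pf) cC.
have [B2 B20 h2] := periodic_bounded p0 (pf_perS pf) cS.
have [B3 B30 h3] := ev_bounded (dX h) (B1 + B2).
have [B4 B40 h4] := ev_bounded (dY h) (B1 + B2).
have [B5 B50 h5] := periodic_bounded p0 (pf_perl pf) (pf_lam pf).
exists (B1 + B2 + B3 + B4 + B5); first lra.
move=> s; have := h1 s; have := h2 s; have := h5 s.
have c1 : `|C s| <= B1 + B2 by have := h1 s; lra.
have c2 : `|S s| <= B1 + B2 by have := h2 s; lra.
have := h3 _ _ c1 c2; have := h4 _ _ c1 c2.
by split; lra.
Qed.

Lemma wcoef_low (a : fps R) (p : {poly {poly R}}) m c s n :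
  whomog t m p -> (forall i j, (t.1 * i + t.2 * j <= m)%N -> a i j = fps_of_poly p i j) ->
  ((n < m)%N -> wcoef t a c s n = 0) /\ wcoef t a c s m = p.[c, s].
Proof.
move=> hp ha; have ext n' : (n' <= m)%N -> wcoef t a c s n' = wcoef t (fps_of_poly p) c s n'.
  move=> n'm; apply: eq_bigr => i _; apply: eq_bigr => j _.
  by case: eqP => // ew; rewrite ha // ew.
split=> [nm|]; last by rewrite ext // (wcoef_whomog _ _ t1 t2 hp).
rewrite ext; last exact: ltnW.
rewrite /wcoef big1 // => i _; rewrite big1 // => j _; case: eqP => // ew.
have [->|/hp e'] := eqVneq (fps_of_poly p i j) 0; first by rewrite !mul0r.
have em : m = n by rewrite -e' ew.
by rewrite em ltnn in nm.
Qed.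

Lemma euler_frame s : t.1%:R * C s * (dX h).[C s, S s] + t.2%:R * S s * (dY h).[C s, S s] = k%:R.
Proof. by rewrite (euler _ _ hh) (pf_level pf) mulr1. Qed.

(** X_h gathers the terms of least weight of F: it fixes the powers of u which can be
   divided out and the values at u = 0. *)
Lemma comp_expansions : exists C0 k0, [/\ 0 < C0, 0 < k0 & exists a b : nat -> R -> R,
  [/\ forall n, continuous (a n), forall n, continuous (b n),
      forall s, expands C0 k0 (a^~ s) (comp1 s) /\ expands C0 k0 (b^~ s) (comp2 s)
    & forall s, a 0%N s = - (dY h).[C s, S s] /\ b 0%N s = (dX h).[C s, S s]]].
Proof.
have [B B0 hB] := frame_bounded; have [cC cS] := frame_cont.
have [h1 h2] := hF.
have [C1 [k1 [C10 k10 e1]]] := weighted_expansion B t1 t2 h1.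
have [C2 [k2 [C20 k20 e2]]] := weighted_expansion B t1 t2 h2.
have hY : whomog t (k - t.2) (- dY h).
  move=> i j; rewrite !coefN oppr_eq0 => p0.
  have hk' : whomog t (k - t.2 + t.2) h by rewrite subnK //; move: hk; clear; lia.
  exact: (whomog_dY hk').
have hX : whomog t (k - t.1) (dX h).
  have hk' : whomog t (k - t.1 + t.1) h by rewrite subnK //; move: hk; clear; lia.
  exact: (whomog_dX hk').
have lowY i j : (t.1 * i + t.2 * j <= k - t.2)%N -> f.1 i j = fps_of_poly (- dY h) i j.
  move=> hw; apply: (hf i j).1; rewrite /wt; move: hw hk; clear; lia.
have lowX i j : (t.1 * i + t.2 * j <= k - t.1)%N -> f.2 i j = fps_of_poly (dX h) i j.
  move=> hw; apply: (hf i j).2; rewrite /wt; move: hw hk; clear; lia.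
pose D1 := C1 * k1 ^+ (k - t.2); pose D2 := C2 * k2 ^+ (k - t.1).
have D10 : 0 < D1 by rewrite mulr_gt0 // exprn_gt0.
have D20 : 0 < D2 by rewrite mulr_gt0 // exprn_gt0.
exists (D1 + D2), (k1 + k2); split; [exact: addr_gt0 | exact: addr_gt0 |].
exists (fun n s => wcoef t f.1 (C s) (S s) (n + (k - t.2))%N),
       (fun n s => wcoef t f.2 (C s) (S s) (n + (k - t.1))%N); split.
- by move=> n; exact: wcoef_cont.
- by move=> n; exact: wcoef_cont.
- move=> s; have [b1 b2 _ _ _] := hB s; split.
  + have := expands_shift k10 (e1 _ _ b1 b2)
      (fun i ik => (wcoef_low (C s) (S s) i hY lowY).1 ik).
    by apply: expands_weak; rewrite ?ltW // ?ltrDl ?ltrDr.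
  + have := expands_shift k20 (e2 _ _ b1 b2)
      (fun i ik => (wcoef_low (C s) (S s) i hX lowX).1 ik).
    by apply: expands_weak; rewrite ?ltW // ?ltrDl ?ltrDr.
- move=> s; rewrite !add0n; split.
    by rewrite (wcoef_low (C s) (S s) 0%N hY lowY).2 evN.
  exact: (wcoef_low (C s) (S s) 0%N hX lowX).2.
Qed.

Lemma t_le_natr : t.1%:R <= k%:R :> R /\ t.2%:R <= k%:R :> R.
Proof. by rewrite !ler_nat; split; move: hk; clear; lia. Qed.

(** At u = 0 the field is X_h, whose radial component is 0 and whose angular component
   is k by Euler's identity. *)
Lemma polar_expansions : exists C0 k0, [/\ 0 < C0, 0 < k0 & exists a d : nat -> R -> R,
  [/\ forall n, continuous (a n), forall n, continuous (d n),
      forall s, expands C0 k0 (a^~ s) (num s) /\ expands C0 k0 (d^~ s) (den s)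
    & forall s, a 0%N s = 0 /\ d 0%N s = k%:R]].
Proof.
have [B B0 hB] := frame_bounded; have [cC cS] := frame_cont.
have [C0 [k0 [C00 k00 [a [b [ca cb hab ab0]]]]]] := comp_expansions.
have kR : 0 < k%:R :> R by rewrite ltr0n; move: hk t1; clear; lia.
pose M := B + k%:R * B; have M0 : 0 < M by rewrite addr_gt0 ?mulr_gt0.
exists (2 * M * C0), k0; split; [by rewrite !mulr_gt0 | by [] |].
have [tk1 tk2] := t_le_natr.
exists (fun n s => (dX h).[C s, S s] * a n s + (dY h).[C s, S s] * b n s),
       (fun n s => (- (t.2%:R * S s)) * a n s + t.1%:R * C s * b n s); split.
- move=> n s; apply: (@contD R (fun s => (dX h).[C s, S s] * a n s) (fun s => (dY h).[C s, S s] * b n s)).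
    apply: (@contM R (fun s => (dX h).[C s, S s]) (a n)); last exact: ca.
    by apply: continuous_ev; [exact: cC | exact: cS].
  apply: (@contM R (fun s => (dY h).[C s, S s]) (b n)); last exact: cb.
  by apply: continuous_ev; [exact: cC | exact: cS].
- move=> n s; apply: (@contD R (fun s => (- (t.2%:R * S s)) * a n s) (fun s => t.1%:R * C s * b n s)).
    apply: (@contM R (fun s => - (t.2%:R * S s)) (a n)); last exact: ca.
    apply: (@contN R (fun s => t.2%:R * S s)).
    by apply: (@contM R (fun=> t.2%:R) S); [exact: cont_cst | exact: cS].
  apply: (@contM R (fun s => t.1%:R * C s) (b n)); last exact: cb.
  by apply: (@contM R (fun=> t.1%:R) C); [exact: cont_cst | exact: cC].
- move=> s; have [h1 h2] := hab s; have [b1 b2 b3 b4 _] := hB s.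
  have kB : 0 <= k%:R * B by rewrite mulr_ge0 ?ltW.
  split.
    apply: (@expands_lin R C0 k0 _ (a^~ s) (b^~ s) _ (comp1 s) (comp2 s)
      (dX h).[C s, S s] (dY h).[C s, S s]) => //; rewrite ?ltW //; rewrite /M.
    + by apply: le_lt_trans b3 _; rewrite ltrDl mulr_gt0.
    + by apply: le_lt_trans b4 _; rewrite ltrDl mulr_gt0.
  apply: (@expands_lin R C0 k0 _ (a^~ s) (b^~ s) _ (comp1 s) (comp2 s)
      (- (t.2%:R * S s)) (t.1%:R * C s)) => //; rewrite ?(ltW C00) ?(ltW k00) //; rewrite /M.
  + rewrite normrN normrM normr_nat.
    have := ler_pM (ler0n R t.2) (normr_ge0 (S s)) tk2 b2; lra.
  + rewrite normrM normr_nat.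
    have := ler_pM (ler0n R t.1) (normr_ge0 (C s)) tk1 b1; lra.
- move=> s; have [-> ->] := ab0 s; split; first by ring.
  by rewrite -(euler_frame s); ring.
Qed.

(** Euler's identity recombines the radial and the angular components into F. *)
Lemma orbit_der (v : R -> R) s : der v s (polar_rhs s (v s)) -> 0 < v s ->
  den s (v s) != 0 ->
  der (fun s => v s ^+ t.1 * C s) s
      (slowness s (v s) * (e * (F (polar_pt (v s) s)).1)) /\
  der (fun s => v s ^+ t.2 * S s) s
      (slowness s (v s) * (e * (F (polar_pt (v s) s)).2)).
Proof.
move=> dv v0 d0; have ee : e * e = 1 by case: he => ->; rewrite ?mulr1 ?mulrNN ?mulr1.
have vn m : v s ^+ m != 0 by rewrite expf_neq0 // gt_eqF.
have eu := euler_frame s.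
set hx := (dX h).[_, _] in eu; set hy := (dY h).[_, _] in eu.
set A := comp1 s (v s); set B := comp2 s (v s).
have e1 : (F (polar_pt (v s) s)).1 = v s ^+ (k - t.2) * A.
  by rewrite mulrC /A /comp1 divfK.
have e2 : (F (polar_pt (v s) s)).2 = v s ^+ (k - t.1) * B.
  by rewrite mulrC /B /comp2 divfK.
have w1 : (k - t.2 = wr + t.1)%N by rewrite /wr; move: hk; clear; lia.
have w2 : (k - t.1 = wr + t.2)%N by rewrite /wr; move: hk; clear; lia.
have D : den s (v s) = - (t.2%:R * S s) * A + t.1%:R * C s * B by [].
have N : num s (v s) = hx * A + hy * B by [].
have pw n : (0 < n)%N -> v s ^+ n.-1 * v s = v s ^+ n by move=> n0; rewrite mulrC -exprS prednK.
split.
- have dvt := der_X t.1 dv.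
  apply: der_eq (der_M dvt (pf_C pf s)) _.
  rewrite e1 w1 exprD /slowness /polar_rhs N -/hy.
  have -> : t.1%:R * v s ^+ t.1.-1 * (lam s * (v s * ((hx * A + hy * B) / den s (v s)))) * C s =
    t.1%:R * (v s ^+ t.1.-1 * v s) * (lam s * ((hx * A + hy * B) / den s (v s))) * C s by ring.
  rewrite pw //.
  have -> : e * lam s * k%:R / (v s ^+ wr * den s (v s)) * (e * (v s ^+ wr * v s ^+ t.1 * A)) =
    (e * e) * (lam s * k%:R / den s (v s) * v s ^+ t.1 * A) by field; rewrite d0 vn.
  rewrite ee mul1r -eu.
  apply: (mulIf d0); rewrite mulrDl.
  have -> : t.1%:R * v s ^+ t.1 * (lam s * ((hx * A + hy * B) / den s (v s))) * C s * den s (v s) =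
    t.1%:R * v s ^+ t.1 * lam s * (hx * A + hy * B) * C s by field.
  rewrite [X in _ = X](_ : _ = lam s * (t.1%:R * C s * hx + t.2%:R * S s * hy) * v s ^+ t.1 * A).
    by rewrite D; ring.
  by field.
- have dvt := der_X t.2 dv.
  apply: der_eq (der_M dvt (pf_S pf s)) _.
  rewrite e2 w2 exprD /slowness /polar_rhs N -/hx.
  have -> : t.2%:R * v s ^+ t.2.-1 * (lam s * (v s * ((hx * A + hy * B) / den s (v s)))) * S s =
    t.2%:R * (v s ^+ t.2.-1 * v s) * (lam s * ((hx * A + hy * B) / den s (v s))) * S s by ring.
  rewrite pw //.
  have -> : e * lam s * k%:R / (v s ^+ wr * den s (v s)) * (e * (v s ^+ wr * v s ^+ t.2 * B)) =
    (e * e) * (lam s * k%:R / den s (v s) * v s ^+ t.2 * B) by field; rewrite d0 vn.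
  rewrite ee mul1r -eu.
  apply: (mulIf d0); rewrite mulrDl.
  have -> : t.2%:R * v s ^+ t.2 * (lam s * ((hx * A + hy * B) / den s (v s))) * S s * den s (v s) =
    t.2%:R * v s ^+ t.2 * lam s * (hx * A + hy * B) * S s by field.
  rewrite [X in _ = X](_ : _ = lam s * (t.1%:R * C s * hx + t.2%:R * S s * hy) * v s ^+ t.2 * B).
    by rewrite D; ring.
  by field.
Qed.

(** The hypotheses of [analytic_flow] hold because num / den starts at order 1, which the
   factor u of the polar equation raises to 2. *)
Lemma polar_flow (L : R) : 0 < L ->
  exists z1 K (U : R -> R -> R) (v : nat -> R -> R), [/\ 0 < z1 <= 1, 0 < K,
      forall z s, 0 < z <= z1 -> `|s| < L -> der (U z) s (polar_rhs s (U z s)),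
      (forall z, 0 < z <= z1 -> U z 0 = z) /\
      (forall z s, 0 < z <= z1 -> `|s| <= L -> `|U z s - z| <= z / 2)
    & (forall s, `|s| <= L -> expands K z1^-1 (v^~ s) (U^~ s)) /\
      (forall s u, 0 < u <= 2 * z1 -> k%:R / 2 <= den s u <= 2 * k%:R) /\
      (forall (w : R -> R) s, {for s, continuous w} -> 0 < w s <= 2 * z1 ->
         [/\ {for s, continuous (fun s => slowness s (w s))},
             {for s, continuous (fun s => comp1 s (w s))}
           & {for s, continuous (fun s => comp2 s (w s))}])].
Proof.
move=> L0.
have [C0 [k0 [C00 k00 [a [d [ca cd had ad0]]]]]] := polar_expansions.
have [C3 [k3 [C30 k30 [a3 [b3 [ca3 cb3 hab3 _]]]]]] := comp_expansions.
have [B B0 hB] := frame_bounded.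
have kR : 0 < k%:R :> R by rewrite ltr0n; move: hk t1; clear; lia.
have [C1 [k1 [C10 k10 hq]]] := expands_quot C00 k00 kR.
have hq' s := hq _ _ _ _ (had s).1 (had s).2.
have kd s : k%:R <= `|d 0%N s| by rewrite (ad0 s).2 normr_nat.
pose q n s := quot_series (a^~ s) (d^~ s) n.
have cq n : continuous (q n).
  by apply: quot_series_cont => // s; rewrite (ad0 s).2 gt_eqF.
pose Rj n s := lam s * (if n is n'.+1 then q n' s else 0).
have cR n : continuous (Rj n).
  case: n => [|n] s.
    by apply: (@contM R lam (fun=> 0)); [exact: (pf_lam pf) | exact: cont_cst].
  by apply: (@contM R lam (q n)); [exact: (pf_lam pf) | exact: cq].
have q0 s : q 0%N s = 0.
  rewrite /q /quot_series quot_poly_coefS // (ad0 s).1 big_ord_recl big_ord0.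
  by rewrite mul0r addr0 subr0 mulr0.
have hR s : expands (B * (C1 / k1)) k1 (Rj^~ s) (polar_rhs s).
  apply: (@expands_scale R (C1 / k1) k1 (fun n => if n is n'.+1 then q n' s else 0)
    (fun u => u * (num s u / den s u)) (lam s) B); rewrite ?divr_ge0 ?(ltW C10) ?(ltW k10) //.
    exact: expands_mulX (hq' s (kd s)).1.
  by have [] := hB s.
have BC0 : 0 < B * (C1 / k1) by rewrite mulr_gt0 // divr_gt0.
have [||z1 [K [U [v [z10 K0 hU [hU0 hUz] hv]]]]] :=
  @analytic_flow R Rj polar_rhs (B * (C1 / k1)) k1 L BC0 k10 L0 cR _ _ hR.
- by move=> s; rewrite /Rj mulr0.
- by move=> s; rewrite /Rj q0 mulr0.
pose z2 := Num.min (Num.min z1 (Num.min 1 (1 / (8 * k3)))) (Num.min (1 / (8 * k0)) (k%:R / (4 * C0 * k0))).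
have z20 : 0 < z2 by rewrite !lt_min z10 ltr01 !divr_gt0 ?mulr_gt0.
have [z21 z211 z22 z23 z24] : [/\ z2 <= z1, z2 <= 1, z2 <= 1 / (8 * k0),
    z2 <= k%:R / (4 * C0 * k0) & z2 <= 1 / (8 * k3)].
  by rewrite /z2 !ge_min !lexx !orbT.
have zz z : 0 < z <= z2 -> 0 < z <= z1.
  by move=> /andP[-> hz]; exact: le_trans hz z21.
have ku u : 0 < u <= 2 * z2 -> k0 * u <= 1 / 4.
  move=> /andP[u0 u2]; move: z22; rewrite ler_pdivlMr ?mulr_gt0 // => z22.
  have : k0 * u <= k0 * (2 * z2) by rewrite ler_pM2l.
  lra.
have Cku u : 0 < u <= 2 * z2 -> C0 * (k0 * u) <= k%:R / 2.
  move=> /andP[u0 u2]; move: z23; rewrite ler_pdivlMr ?mulr_gt0 // => z23.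
  have : C0 * k0 * u <= C0 * k0 * (2 * z2) by rewrite ler_pM2l ?mulr_gt0.
  lra.
have hden s u : 0 < u <= 2 * z2 -> k%:R / 2 <= den s u <= 2 * k%:R.
  move=> hu; have h1 := ku u hu; have h2 := Cku u hu; case/andP: hu => u0 u2.
  have ku1 : k0 * u <= 1 by lra.
  have := (had s).2.2 u 1%N u0 ku1; rewrite horner_poly big_ord1 (ad0 s).2 !expr1 expr0 mulr1.
  by rewrite ler_norml => /andP[]; lra.
exists z2, K, U, v; split => //.
- by rewrite z20.
- by move=> z s hz; apply: hU; exact: zz.
- split=> z; first by move=> hz; apply: hU0; exact: zz.
  by move=> s hz sL; have [] := hUz z s (zz z hz) sL.
- split=> [s sL|].
    apply: expands_weak (hv s sL) => //; rewrite ?(ltW K0) ?invr_ge0 ?(ltW z10) //.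
    by rewrite lef_pV2 ?posrE.
  split=> // w s cw hw.
  have w0 : 0 < w s by case/andP: hw.
  have w3 : k3 * w s < 1 / 2.
    case/andP: hw => _ hw; move: z24; rewrite ler_pdivlMr ?mulr_gt0 // => z24.
    have : k3 * w s <= k3 * (2 * z2) by rewrite ler_pM2l.
    lra.
  split; last 2 first.
  - exact: (expands_cont C30 k30 (fun s => (hab3 s).1) ca3 cw w0 w3).
  - exact: (expands_cont C30 k30 (fun s => (hab3 s).2) cb3 cw w0 w3).
  apply: (@contM R (fun s => e * lam s * k%:R) (fun s => (w s ^+ wr * den s (w s))^-1)).
    apply: (@contM R (fun s => e * lam s) (fun=> k%:R)); last exact: cont_cst.
    by apply: (@contM R (fun=> e) lam); [exact: cont_cst | exact: (pf_lam pf)].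
  apply: (@contV R (fun s => w s ^+ wr * den s (w s))).
    rewrite mulf_neq0 ?expf_neq0 ?gt_eqF //.
    by have /andP[+ _] := hden s (w s) hw; apply: lt_le_trans; rewrite divr_gt0.
  apply: (@contM R (fun s => w s ^+ wr) (fun s => den s (w s))); first exact: contX.
  apply: (expands_cont C00 k00 (fun s => (had s).2) cd cw w0).
  by have := ku _ hw; lra.
Qed.
End PolarEquation.

(** * Motion along the level curve *)

Section LevelFlow.
Variables (R : realType) (t : nat * nat) (k : nat) (h : {poly {poly R}}).
Variables (Cs Sn : R -> R) (T : R).
Hypothesis ht : is_type t.
Hypothesis hh : whomog t k h.
Hypothesis hpar : parameterizes_level1 h Cs Sn T.

(** Gronwall's inequality for the squared distance, X_h being Lipschitz on the bounded
   level curve. *)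
Lemma level_motion_unique (x1 y1 x2 y2 kap : R -> R) b K0 :
  (forall s, Num.min 0 b <= s <= Num.max 0 b ->
    [/\ der x1 s (- (kap s * (dY h).[x1 s, y1 s])), der y1 s (kap s * (dX h).[x1 s, y1 s]),
        der x2 s (- (kap s * (dY h).[x2 s, y2 s])), der y2 s (kap s * (dX h).[x2 s, y2 s])
      & [/\ h.[x1 s, y1 s] = 1, h.[x2 s, y2 s] = 1 & `|kap s| <= K0]]) ->
  x1 0 = x2 0 -> y1 0 = y2 0 -> x1 b = x2 b /\ y1 b = y2 b.
Proof.
move=> hyp ex0 ey0; have [B B0 hB] := level_bounded hpar.
have [L1 L10 hL1] := ev_lipschitz (dX h) B; have [L2 L20 hL2] := ev_lipschitz (dY h) B.
pose d s := (x1 s - x2 s) ^+ 2 + (y1 s - y2 s) ^+ 2.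
pose d' s := 2 * (x1 s - x2 s) * (- (kap s * (dY h).[x1 s, y1 s]) - - (kap s * (dY h).[x2 s, y2 s]))
           + 2 * (y1 s - y2 s) * (kap s * (dX h).[x1 s, y1 s] - kap s * (dX h).[x2 s, y2 s]).
have K00 : 0 <= K0.
  have [|_ _ _ _ [_ _ hk]] := hyp 0; last exact: le_trans hk.
  by rewrite ge_min lexx le_max lexx.
have d0 : d b = 0.
  apply: (@gronwall R d d' (2 * K0 * (2 * L1 + 2 * L2))).
  - by move=> s; rewrite addr_ge0 ?sqr_ge0.
  - move=> s /hyp[a1 a2 a3 a4 _].
    apply: der_eq (der_D (der_X 2 (der_B a1 a3)) (der_X 2 (der_B a2 a4))) _.
    by rewrite /d' /= !expr1.
  - move=> s /hyp[_ _ _ _ [l1 l2 hk]].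
    have [p1 p2] := hB _ _ l1; have [p3 p4] := hB _ _ l2.
    have := hL1 _ _ _ _ p1 p2 p3 p4; have := hL2 _ _ _ _ p1 p2 p3 p4.
    rewrite /d /d'; set X := x1 s - x2 s; set Y := y1 s - y2 s.
    set u := (dY h).[x1 s, y1 s] - (dY h).[x2 s, y2 s].
    set v := (dX h).[x1 s, y1 s] - (dX h).[x2 s, y2 s] => hu hv.
    have -> : - (kap s * (dY h).[x1 s, y1 s]) - - (kap s * (dY h).[x2 s, y2 s]) = - (kap s * u).
      by rewrite /u; ring.
    rewrite -mulrBr -/v.
    apply: le_trans (ler_normD _ _) _; rewrite !normrM normrN normrM.
    have -> : `|2 : R| = 2 by rewrite ger0_norm.
    rewrite -(real_normK (num_real X)) -(real_normK (num_real Y)).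
    move: (normr_ge0 X) (normr_ge0 Y) hu hv hk; move: `|X| `|Y| => a c a0 c0 hu hv hk.
    have s1 : a * (a + c) <= 2 * (a ^+ 2 + c ^+ 2).
      rewrite -subr_ge0; have -> : 2 * (a ^+ 2 + c ^+ 2) - a * (a + c) =
         (a - c / 2) ^+ 2 + 7 / 4 * c ^+ 2 by field.
      by rewrite addr_ge0 ?sqr_ge0 // mulr_ge0 ?sqr_ge0.
    have s2 : c * (a + c) <= 2 * (a ^+ 2 + c ^+ 2).
      rewrite -subr_ge0; have -> : 2 * (a ^+ 2 + c ^+ 2) - c * (a + c) =
         (c - a / 2) ^+ 2 + 7 / 4 * a ^+ 2 by field.
      by rewrite addr_ge0 ?sqr_ge0 // mulr_ge0 ?sqr_ge0.
    have q1 : `|kap s| * `|u| <= K0 * (L2 * (a + c)) by apply: ler_pM.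
    have q2 : `|kap s| * `|v| <= K0 * (L1 * (a + c)) by apply: ler_pM.
    have r1 : 2 * a * (`|kap s| * `|u|) <= 2 * a * (K0 * (L2 * (a + c))).
      by apply: ler_wpM2l => //; apply: mulr_ge0.
    have r2 : 2 * c * (`|kap s| * `|v|) <= 2 * c * (K0 * (L1 * (a + c))).
      by apply: ler_wpM2l => //; apply: mulr_ge0.
    have r3 : (2 * K0 * L2) * (a * (a + c)) <= (2 * K0 * L2) * (2 * (a ^+ 2 + c ^+ 2)).
      by apply: ler_wpM2l => //; rewrite !mulr_ge0.
    have r4 : (2 * K0 * L1) * (c * (a + c)) <= (2 * K0 * L1) * (2 * (a ^+ 2 + c ^+ 2)).
      by apply: ler_wpM2l => //; rewrite !mulr_ge0.
    have -> : 2 * K0 * (2 * L1 + 2 * L2) * (a ^+ 2 + c ^+ 2) =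
      (2 * K0 * L2) * (2 * (a ^+ 2 + c ^+ 2)) + (2 * K0 * L1) * (2 * (a ^+ 2 + c ^+ 2)) by ring.
    apply: le_trans (lerD r3 r4).
    apply: le_trans (lerD r1 r2) _.
    by rewrite [X in X <= _](_ : _ = 2 * K0 * L2 * (a * (a + c)) + 2 * K0 * L1 * (c * (a + c))) //; ring.
  - by rewrite /d ex0 ey0 !subrr expr0n addr0.
have : (x1 b - x2 b) ^+ 2 = 0 /\ (y1 b - y2 b) ^+ 2 = 0.
  have := sqr_ge0 (x1 b - x2 b); have := sqr_ge0 (y1 b - y2 b).
  by rewrite /d in d0; split; lra.
by move=> [/eqP + /eqP]; rewrite !sqrf_eq0 !subr_eq0 => /eqP -> /eqP ->.
Qed.

(** By uniqueness of the motion, b - a is a period of the parameterization, and T is the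
   least positive one. *)
Lemma level_angle_unique a b : Cs a = Cs b -> Sn a = Sn b ->
  exists m : int, b = a + m%:~R * T.
Proof.
move=> ec es; have T0 := level_T hpar.
have per s : Cs (a + s) = Cs (b + s) /\ Sn (a + s) = Sn (b + s).
  apply: (@level_motion_unique (fun s => Cs (a + s)) (fun s => Sn (a + s))
    (fun s => Cs (b + s)) (fun s => Sn (b + s)) (fun=> 1) s 1); rewrite ?addr0 //.
  move=> y _; have sh (g : R -> R) c d : der g (c + y) d -> der (fun s => g (c + s)) y d.
    move=> dg; apply: der_eq (@der_comp R g (fun s => c + s) y d 1 dg _) _; last by rewrite mulr1.
    by rewrite -[X in der _ _ X]add0r; apply: der_D; [exact: der_cst | exact: der_id].
  have [d1 d2] := level_der hpar (a + y); have [d3 d4] := level_der hpar (b + y).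
  by split; rewrite ?mul1r; try exact: sh; rewrite !(level_on hpar) normr1.
have perS s : Cs (s + (b - a)) = Cs s /\ Sn (s + (b - a)) = Sn s.
  have [e1 e2] := per (s - a).
  have -> : s + (b - a) = b + (s - a) by ring.
  by rewrite -e1 -e2 addrC subrK.
have [m m1 m2] := mod_period (b - a) T0.
exists m; apply/eqP; rewrite -subr_eq0; apply/eqP.
have -> : b - (a + m%:~R * T) = b - a - m%:~R * T by ring.
apply/le_anti; rewrite m1 andbT leNgt; apply/negP => S0.
case: hpar => _ _ _ hp /(_ (b - a - m%:~R * T)); rewrite S0 m2 => /(_ isT); apply => s.
have pC : forall s, Cs (s + T) = Cs s by move=> x; have [] := hp x.
have pS : forall s, Sn (s + T) = Sn s by move=> x; have [] := hp x.
rewrite -(periodic_int m _ pC) -(periodic_int m _ pS).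
by rewrite addrA subrK; exact: perS.
Qed.
End LevelFlow.

Section Potential.
Variable R : realType.

(** - ln x for n = 0, and 1 / (n x^n) otherwise. *)
Lemma radial_potential (n : nat) : exists2 p : R -> R,
  forall x, 0 < x -> der p x (- (x^-1 ^+ n.+1)) &
  forall A, exists2 x0, 0 < x0 & forall x, 0 < x < x0 -> A < p x.
Proof.
case: n => [|n].
  exists (fun x => - ln x).
    by move=> x x0; rewrite expr1; apply: der_N; exact: is_derive1_ln.
  move=> A; exists (expR (- A)); first exact: expR_gt0.
  move=> x /andP[x0 xA]; rewrite ltrNr -[- A]expRK ltr_ln ?posrE //; exact: expR_gt0.
have n0 : (n.+1%:R : R) != 0 by [].
exists (fun x => n.+1%:R^-1 * x^-1 ^+ n.+1).
  move=> x x0; have x0' : x != 0 by rewrite gt_eqF.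
  apply: der_eq (der_Z _ (der_X n.+1 (der_V x0' (der_id x)))) _.
  rewrite /= [in RHS]exprS [in RHS]exprS !exprVn expr2.
  by field; rewrite x0' expf_neq0 //= n0.
move=> A; pose x0 := (n.+1%:R * (`|A| + 1))^-1.
have x00 : 0 < x0 by rewrite invr_gt0 mulr_gt0 // ltr_wpDl.
have x01 : x0 <= 1.
  rewrite invf_le1 ?mulr_gt0 ?ltr_wpDl //.
  have h1 : 1 <= n.+1%:R :> R by rewrite ler1n.
  have h2 : 1 <= `|A| + 1 by rewrite lerDr.
  by have := ler_pM ler01 ler01 h1 h2; rewrite mulr1.
exists x0 => // x /andP[xp xx].
have x1 : 1 <= x^-1 by rewrite invf_ge1 //; lra.
apply: (@lt_le_trans _ _ (n.+1%:R^-1 * x^-1)).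
  have : x0^-1 < x^-1 by rewrite ltf_pV2 ?posrE.
  rewrite /x0 invrK mulrC => h; rewrite mulrC ltr_pdivlMr // .
  apply: le_lt_trans h; rewrite ler_pM2r //.
  by have := ler_norm A; lra.
rewrite ler_pM2l ?invr_gt0 // -{1}[x^-1]expr1.
exact: ler_weXn2l.
Qed.

Lemma Rintegral_primitive (f G : R -> R) b : 0 < b -> continuous f ->
  (forall x, der G x (f x)) ->
  Rintegral lebesgue_measure `[0, b] f = G b - G 0.
Proof.
move=> b0 cf dG; rewrite /Rintegral (@continuous_FTC2 R f G 0 b) //.
- exact: continuous_subspaceT.
- split.
  + by move=> x _; case: (dG x).
  + by apply: cvg_at_right_filter; exact: der_cont (dG 0).
  + by apply: cvg_at_left_filter; exact: der_cont (dG b).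
- by move=> x _; rewrite derive1E; case: (dG x).
Qed.
End Potential.

(** * The potential of the normal form *)

Section SpiralPotential.
Variables (R : realType) (t : nat * nat) (k N : nat) (h mu : {poly {poly R}}).
Variables (Cs Sn : R -> R) (T : R).
Hypothesis ht : is_type t.
Hypothesis hh : whomog t k h.
Hypothesis hpar : parameterizes_level1 h Cs Sn T.
Hypothesis hmu : whomog t (wr t k + N) mu.

Let r := wr t k.
Let hk : (t.1 + t.2 <= k)%N := level_k_ge ht hh hpar.
Let k0 : (0 < k)%N := level_k_gt0 ht hh hpar.
Let hpos := level_pos ht hh hpar.

(** The weighted radius h^(1/k); dir1 and dir2 project on the level curve along the
   weighted dilations. *)
Definition radius (x y : R) : R := expR (k%:R^-1 * ln h.[x, y]).

Lemma kR0 : (k%:R : R) != 0.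
Proof. by rewrite pnatr_eq0 -lt0n. Qed.

Lemma radius_gt0 x y : 0 < radius x y.
Proof. exact: expR_gt0. Qed.

Lemma radius_exp x y : (x, y) != (0, 0) -> radius x y ^+ k = h.[x, y].
Proof.
move=> xy; rewrite /radius -expRM_natl mulrA divff ?kR0 // mul1r lnK //.
by rewrite posrE hpos.
Qed.

Definition dir1 x y := (radius x y)^-1 ^+ t.1 * x.
Definition dir2 x y := (radius x y)^-1 ^+ t.2 * y.

Lemma dir_level x y : (x, y) != (0, 0) -> h.[dir1 x y, dir2 x y] = 1.
Proof.
move=> xy; rewrite (whomog_ev _ _ _ hh) -radius_exp // -exprMn mulVf ?expr1n //.
by rewrite gt_eqF // radius_gt0.
Qed.

Definition mean_speed : R := Rintegral lebesgue_measure `[0, T] (fun s => mu.[Cs s, Sn s]) / T.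

(** The derivatives of the radius, of the angle on the level curve and of the potential
   along a vector (v, w). *)
Definition dradius (x y v w : R) : R :=
  radius x y * ((dX h).[x, y] * v + (dY h).[x, y] * w) / (k%:R * h.[x, y]).
Definition dangle (x y v w : R) : R :=
  radius x y ^+ r * (t.1%:R * x * w - t.2%:R * y * v) / (k%:R * h.[x, y]).
Definition dpotential (x y v w : R) : R :=
  - ((radius x y)^-1 ^+ N.+1) * dradius x y v w +
  (mu.[x, y] * (radius x y)^-1 ^+ (r + N) - mean_speed) * dangle x y v w.

Lemma der_radius (x y : R -> R) s dx dy : (x s, y s) != (0, 0) ->
  der x s dx -> der y s dy ->
  der (fun s => radius (x s) (y s)) s (dradius (x s) (y s) dx dy).
Proof.
move=> xy hx hy; have hp := hpos xy.
apply: der_eq (@der_comp R (@expR R) (fun s => k%:R^-1 * ln h.[x s, y s]) s _ _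
  (is_derive_expR _) (der_Z _ (@der_comp R (@ln R) (fun s => h.[x s, y s]) s _ _
    (is_derive1_ln hp) (der_ev h hx hy)))) _.
by rewrite /dradius -/(radius (x s) (y s)); field; rewrite kR0 gt_eqF.
Qed.

(** The projection on the level curve moves along X_h, by Euler's identity. *)
Lemma der_dir (x y : R -> R) s dx dy : (x s, y s) != (0, 0) ->
  der x s dx -> der y s dy ->
  der (fun s => dir1 (x s) (y s)) s
    (- (dangle (x s) (y s) dx dy * (dY h).[dir1 (x s) (y s), dir2 (x s) (y s)])) /\
  der (fun s => dir2 (x s) (y s)) s
    (dangle (x s) (y s) dx dy * (dX h).[dir1 (x s) (y s), dir2 (x s) (y s)]).
Proof.
move=> xy hx hy; have hp := hpos xy; have hn0 : h.[x s, y s] != 0 by rewrite gt_eqF.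
have r0 : radius (x s) (y s) != 0 by rewrite gt_eqF // radius_gt0.
have dn := der_radius xy hx hy; have dv := @der_V R (fun s => radius (x s) (y s)) s _ r0 dn.
have eu := euler (x s) (y s) hh.
have [w1 w2] : (k - t.1 = r + t.2)%N /\ (k - t.2 = r + t.1)%N.
  by rewrite /r /wr; move: hk; clear; lia.
have hX : whomog t (r + t.2) (dX h).
  by apply: whomog_dX; rewrite (_ : (r + t.2 + t.1)%N = k) // /r /wr; move: hk; clear; lia.
have hY : whomog t (r + t.1) (dY h).
  by apply: whomog_dY; rewrite (_ : (r + t.1 + t.2)%N = k) // /r /wr; move: hk; clear; lia.
have pw n v : v != 0 -> n%:R * v^-1 ^+ n.-1 * (- (dradius (x s) (y s) dx dy) / v ^+ 2) =
    - (n%:R * v^-1 ^+ n * (dradius (x s) (y s) dx dy / v)) :> R.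
  move=> v0; case: n => [|n] /=; first by rewrite !mul0r oppr0.
  by rewrite [v^-1 ^+ n.+1]exprS; move: (v^-1 ^+ n) (n.+1%:R : R) (dradius _ _ _ _) => A c d; field.
have re n : (radius (x s) (y s))^-1 ^+ n * radius (x s) (y s) ^+ n = 1.
  by rewrite -exprMn mulVf // expr1n.
split.
- apply: der_eq (der_M (der_X t.1 dv) hx) _.
  rewrite pw // (whomog_ev _ _ _ hY) /dangle /dradius.
  move: (re r) eu; rewrite exprD.
  set n := radius _ _ in r0 *; move: (n^-1 ^+ r) (n ^+ r) (n^-1 ^+ t.1) => A B P AB eu.
  rewrite [RHS](_ : _ = - ((A * B) * P * (dY h).[x s, y s] *
     (t.1%:R * x s * dy - t.2%:R * y s * dx) / (k%:R * h.[x s, y s]))); last first.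
    by ring.
  rewrite AB mul1r.
  have -> : P * dx = P * dx * (t.1%:R * x s * (dX h).[x s, y s] +
      t.2%:R * y s * (dY h).[x s, y s]) / (k%:R * h.[x s, y s]).
    by rewrite eu; field; rewrite kR0 hn0.
  by field; rewrite kR0 hn0 ?r0.
- apply: der_eq (der_M (der_X t.2 dv) hy) _.
  rewrite pw // (whomog_ev _ _ _ hX) /dangle /dradius.
  move: (re r) eu; rewrite exprD.
  set n := radius _ _ in r0 *; move: (n^-1 ^+ r) (n ^+ r) (n^-1 ^+ t.2) => A B P AB eu.
  rewrite [RHS](_ : _ = ((A * B) * P * (dX h).[x s, y s] *
     (t.1%:R * x s * dy - t.2%:R * y s * dx) / (k%:R * h.[x s, y s]))); last first.
    by ring.
  rewrite AB mul1r.
  have -> : P * dy = P * dy * (t.1%:R * x s * (dX h).[x s, y s] +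
      t.2%:R * y s * (dY h).[x s, y s]) / (k%:R * h.[x s, y s]).
    by rewrite eu; field; rewrite kR0 hn0.
  by field; rewrite kR0 hn0 ?r0.
Qed.

Lemma angular_part : exists2 Mh : R -> R,
  forall s, der Mh s (mu.[Cs s, Sn s] - mean_speed) & forall s, Mh (s + T) = Mh s.
Proof.
have [c1 c2] := level_cont hpar; have T0 := level_T hpar.
have cf : continuous (fun s => mu.[Cs s, Sn s]).
  by move=> s; apply: continuous_ev; [exact: c1 | exact: c2].
have [G G0 dG] := primitive cf.
have eI : mean_speed = G T / T by rewrite /mean_speed (Rintegral_primitive T0 cf dG) G0 subr0.
have dM s : der (fun s => G s - mean_speed * s) s (mu.[Cs s, Sn s] - mean_speed).
  by apply: der_B => //; apply: der_eq (der_Z _ (der_id s)) _; rewrite mulr1.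
exists (fun s => G s - mean_speed * s) => // s.
have per : G (s + T) - G s = G (0 + T) - G 0.
  apply: (@is_derive_0_is_cst R (fun s => G (s + T) - G s)) => y.
  have [e1 e2] := level_periodic hpar y.
  apply: der_eq (der_B (@der_comp R G (fun s => s + T) y _ 1 (dG _) _) (dG y)) _.
    by rewrite -[X in der _ _ X]addr0; apply: der_D; [exact: der_id | exact: der_cst].
  by rewrite e1 e2 mulr1 subrr.
rewrite add0r G0 subr0 in per.
have : mean_speed * T = G T by rewrite eI divfK // gt_eqF.
by rewrite mulrDr; lra.
Qed.

Lemma cont_dangle (x y dx dy : R -> R) s : (x s, y s) != (0, 0) ->
  der x s (dx s) -> der y s (dy s) -> {for s, continuous dx} -> {for s, continuous dy} ->
  {for s, continuous (fun s => dangle (x s) (y s) (dx s) (dy s))}.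
Proof.
move=> xy hx hy cdx cdy; have hp := hpos xy.
have cx := der_cont hx; have cy := der_cont hy.
apply: contM.
  apply: contM.
    by apply: contX; exact: der_cont (der_radius xy hx hy).
  by apply: contB; apply: contM => //; apply: contM => //; exact: cont_cst.
apply: contV; first by rewrite mulf_neq0 ?kR0 ?gt_eqF.
by apply: contM; [exact: cont_cst | exact: continuous_ev].
Qed.

(** W is the sum of a radial potential and of the primitive M of the mean zero part of
   mu on the level curve: it averages out the oscillation of mu. The angle need not be
   continuous since M is periodic. *)
Lemma spiral_potential : exists W : R -> R -> R,
  (forall A, exists2 d, 0 < d & forall x y, (x, y) != (0, 0) -> h.[x, y] < d -> A < W x y) /\
  (forall (x y dx dy : R -> R) b, 0 < b ->
    (forall s, - 1 <= s <= b + 1 -> [/\ (x s, y s) != (0, 0), der x s (dx s), der y s (dy s),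
       {for s, continuous dx} & {for s, continuous dy}]) ->
    exists2 s, 0 <= s <= b &
      W (x b) (y b) - W (x 0) (y 0) = dpotential (x s) (y s) (dx s) (dy s) * b).
Proof.
have [p dp hp] := radial_potential R N; have [Mh dM perM] := angular_part.
have T0 := level_T hpar.
(* Any determination of the angle. *)
have [th hth] : exists th : R * R -> R, forall q, q != (0, 0) ->
    dir1 q.1 q.2 = Cs (th q) /\ dir2 q.1 q.2 = Sn (th q).
  suff /choice[th hth] : forall q : R * R, exists s, q != (0, 0) ->
    dir1 q.1 q.2 = Cs s /\ dir2 q.1 q.2 = Sn s by exists th.
  move=> q; have [->|q0] := eqVneq q (0, 0); first by exists 0; rewrite ?eqxx.
  have := @dir_level q.1 q.2; rewrite -surjective_pairing => /(_ q0) hl.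
  by have [s hs] := level_surj hpar hl; exists s.
exists (fun x y => p (radius x y) + Mh (th (x, y))); split.
- move=> A.
  have cM : continuous Mh by move=> s; exact: der_cont (dM s).
  have [B B0 hB] := periodic_bounded T0 perM cM.
  have [x0 x00 hx0] := hp (A + B); exists (x0 ^+ k); first by rewrite exprn_gt0.
  move=> x y xy hxy; have := hB (th (x, y)); rewrite ler_norml => /andP[hB1 _].
  suff : A + B < p (radius x y) by lra.
  apply: hx0; rewrite radius_gt0 /=; rewrite -radius_exp // in hxy.
  by move: hxy; rewrite ltr_pXn2r // nnegrE ltW // radius_gt0.
- move=> x y dx dy b b0 hyp.
  pose kap s := dangle (x s) (y s) (dx s) (dy s).
  pose cl s := Num.max (- 1) (Num.min s (b + 1)).
  have cl_in s : -1 <= cl s <= b + 1.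
    by rewrite /cl le_max lexx /= ge_max ge_min lexx orbT andbT; lra.
  have cl_id s : -1 <= s <= b + 1 -> cl s = s.
    by move=> /andP[s1 s2]; rewrite /cl (min_l s2) (max_r s1).
  have cl_cont : continuous cl.
    move=> s; apply/contP => e e0; exists e => // y'.
    apply: le_lt_trans; rewrite /cl.
    case: (leP s (b + 1)) => h1; case: (leP y' (b + 1)) => h2;
    repeat match goal with |- context [Num.max ?a ?c] => case: (leP a c) => ? end;
    rewrite ?subrr ?normr0 // ler_norml;
    have := ler_norm (y' - s); have := ler_norm (- (y' - s)); rewrite normrN => n1 n2;
    apply/andP; split; lra.
  have ck : continuous (fun s => kap (cl s)).
    move=> s; have [a1 a2 a3 a4 a5] := hyp _ (cl_in s).
    by apply: (@cont_comp R kap cl); [exact: cl_cont | exact: cont_dangle].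
  have [Kp Kp0 dKp] := primitive ck.
  pose Th s := th (x 0, y 0) + Kp s.
  have in1 s : 0 <= s <= b -> -1 <= s <= b + 1 by move=> /andP[s1 s2]; apply/andP; split; lra.
  have dTh s : 0 <= s <= b -> der Th s (kap s).
    move=> /in1 sb; rewrite -[X in der _ _ X]add0r; apply: der_D; first exact: der_cst.
    by have := dKp s; rewrite cl_id.
  have [K0 K00 hK0] := EVTbound (ltW b0) (fun s sb =>
     cont_dangle (let: And5 a _ _ _ _ := hyp _ (in1 _ sb) in a)
       (let: And5 _ a _ _ _ := hyp _ (in1 _ sb) in a)
       (let: And5 _ _ a _ _ := hyp _ (in1 _ sb) in a)
       (let: And5 _ _ _ a _ := hyp _ (in1 _ sb) in a)
       (let: And5 _ _ _ _ a := hyp _ (in1 _ sb) in a)).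
  have lift s : 0 <= s <= b -> dir1 (x s) (y s) = Cs (Th s) /\ dir2 (x s) (y s) = Sn (Th s).
    move=> /andP[s0 sb].
    have o0 : (x 0, y 0) != (0, 0) by have [] := hyp 0 (in1 0 ltac:(rewrite lexx ltW)).
    apply: (@level_motion_unique R h Cs Sn T hpar (fun s => dir1 (x s) (y s))
      (fun s => dir2 (x s) (y s)) (fun s => Cs (Th s)) (fun s => Sn (Th s)) kap s K0).
    + move=> z; rewrite (min_l s0) (max_r s0) => /andP[z0 zs].
      have zb : 0 <= z <= b by rewrite z0 (le_trans zs).
      have [a1 a2 a3 a4 a5] := hyp z (in1 z zb).
      have [d1 d2] := der_dir a1 a2 a3; have [l1 l2] := level_der hpar (Th z).
      split=> //.
      * by apply: der_eq (@der_comp R Cs Th z _ _ l1 (dTh z zb)) _; ring.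
      * by apply: der_eq (@der_comp R Sn Th z _ _ l2 (dTh z zb)) _; ring.
      * by split; [exact: dir_level | exact: (level_on hpar) | exact: hK0].
    + by rewrite /Th Kp0 addr0; have [] := hth (x 0, y 0) o0.
    + by rewrite /Th Kp0 addr0; have [] := hth (x 0, y 0) o0.
  have same s : 0 <= s <= b -> Mh (th (x s, y s)) = Mh (Th s).
    move=> sb; have [a1 _ _ _ _] := hyp s (in1 s sb).
    have [e1 e2] := lift s sb; have /= [e3 e4] := hth (x s, y s) a1.
    have [||m em] := @level_angle_unique R h Cs Sn T hpar (Th s) (th (x s, y s)).
    * by rewrite -e1 -e3.
    * by rewrite -e2 -e4.
    by rewrite em periodic_int.
  rewrite (same b); last by rewrite lexx ltW.
  rewrite (same 0); last by rewrite lexx ltW.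
  pose Fn s := p (radius (x s) (y s)) + Mh (Th s).
  have [|s sb e] := @der_MVT R Fn (fun s => dpotential (x s) (y s) (dx s) (dy s)) 0 b (ltW b0).
    move=> s sb; have [a1 a2 a3 a4 a5] := hyp s (in1 s sb).
    apply: der_eq (der_D (@der_comp R p (fun s => radius (x s) (y s)) s _ _ (dp _ (radius_gt0 _ _))
       (der_radius a1 a2 a3)) (@der_comp R Mh Th s _ _ (dM _) (dTh s sb))) _.
    have [<- <-] := lift s sb; rewrite (whomog_ev _ _ _ hmu) /dpotential /kap -/r.
    by rewrite [mu.[_, _] * _]mulrC.
  by exists s => //; move: e; rewrite subr0.
Qed.

(** On X_h + mu D_0 the variation of M cancels the oscillation of mu in the radial part,
   and only the mean of mu remains; dpotential is linear in the vector, so that the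
   error (e1, e2) enters separately. *)
Lemma dpotential_perturbed : exists2 B, 0 < B & forall x y q e1 e2,
  (x, y) != (0, 0) -> `|x| <= 1 -> `|y| <= 1 -> radius x y <= 1 ->
  exists2 er, dpotential x y (q * (- (dY h).[x, y] + mu.[x, y] * (t.1%:R * x) + e1))
                  (q * ((dX h).[x, y] + mu.[x, y] * (t.2%:R * y) + e2)) =
         q * (- mean_speed * radius x y ^+ r + er)
    & `|er| <= B * (`|e1| + `|e2|) * (radius x y)^-1 ^+ (N + k).
Proof.
have [B1 B10 h1] := ev_bounded (dX h) 1; have [B2 B20 h2] := ev_bounded (dY h) 1.
have [B3 B30 h3] := ev_bounded mu 1.
have kp : 0 < k%:R :> R by rewrite ltr0n.
pose D : R := (t.1 + t.2)%N%:R.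
have D0 : 0 <= D by rewrite ler0n.
pose B := (B1 + B2) + (B3 + `|mean_speed|) * D + 1.
have B0 : 0 < B by rewrite ltr_wpDl // addr_ge0 ?addr_ge0 // mulr_ge0 // addr_ge0.
exists B => // x y q e1 e2 xy x1 y1 n1.
have hp := hpos xy; have hn0 : h.[x, y] != 0 by rewrite gt_eqF.
have eu := euler x y hh.
have n0 := radius_gt0 x y; have n0' : radius x y != 0 by rewrite gt_eqF.
have hrk := radius_exp xy.
set n := radius x y in n1 n0 n0' hrk *.
pose a := (dX h).[x, y] * e1 + (dY h).[x, y] * e2.
pose b := t.1%:R * x * e2 - t.2%:R * y * e1.
pose er := - (n^-1 ^+ N) * (a / (k%:R * h.[x, y])) +
  (mu.[x, y] * n^-1 ^+ (r + N) - mean_speed) * (n ^+ r * b / (k%:R * h.[x, y])).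
exists er.
  have nr m : n^-1 ^+ m * n ^+ m = 1 by rewrite -exprMn mulVf // expr1n.
  have e3 : dradius x y (q * (- (dY h).[x, y] + mu.[x, y] * (t.1%:R * x) + e1))
     (q * ((dX h).[x, y] + mu.[x, y] * (t.2%:R * y) + e2)) =
     n * q * (mu.[x, y] + a / (k%:R * h.[x, y])).
    rewrite /dradius -/n.
    have -> : mu.[x, y] + a / (k%:R * h.[x, y]) =
      (mu.[x, y] * (k%:R * h.[x, y]) + a) / (k%:R * h.[x, y]) by field; rewrite kR0 hn0.
    by rewrite -eu /a; ring.
  have e4 : dangle x y (q * (- (dY h).[x, y] + mu.[x, y] * (t.1%:R * x) + e1))
     (q * ((dX h).[x, y] + mu.[x, y] * (t.2%:R * y) + e2)) =
     q * n ^+ r * (1 + b / (k%:R * h.[x, y])).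
    rewrite /dangle -/n.
    have -> : 1 + b / (k%:R * h.[x, y]) = (k%:R * h.[x, y] + b) / (k%:R * h.[x, y]).
      by field; rewrite kR0 hn0.
    by rewrite -eu /b; ring.
  rewrite /dpotential -/n e3 e4 /er [n^-1 ^+ N.+1]exprS [n^-1 ^+ (r + N)]exprD.
  set P := n^-1 ^+ N; set Q := n^-1 ^+ r; have QR : Q * n ^+ r = 1 by exact: nr.
  have -> : - (n^-1 * P) * (n * q * (mu.[x, y] + a / (k%:R * h.[x, y]))) =
     - (P * q * (mu.[x, y] + a / (k%:R * h.[x, y]))) by field; rewrite kR0 hn0 n0'.
  have -> : (mu.[x, y] * (Q * P) - mean_speed) * (q * n ^+ r * (1 + b / (k%:R * h.[x, y]))) =
     q * (mu.[x, y] * P * (Q * n ^+ r) - mean_speed * n ^+ r) +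
     q * ((mu.[x, y] * (Q * P) - mean_speed) * (n ^+ r * b / (k%:R * h.[x, y]))) by ring.
  by rewrite QR; ring.
have aB : `|a| <= (B1 + B2) * (`|e1| + `|e2|).
  rewrite /a; apply: le_trans (ler_normD _ _) _; rewrite !normrM.
  have := ler_pM (normr_ge0 _) (normr_ge0 e1) (h1 _ _ x1 y1) (lexx `|e1|).
  have := ler_pM (normr_ge0 _) (normr_ge0 e2) (h2 _ _ x1 y1) (lexx `|e2|).
  have := mulr_ge0 B10 (normr_ge0 e2); have := mulr_ge0 B20 (normr_ge0 e1).
  by rewrite mulrDl !mulrDr; lra.
have bB : `|b| <= D * (`|e1| + `|e2|).
  rewrite /b; apply: le_trans (ler_normB _ _) _; rewrite !normrM !normr_nat.
  have := ler_pM (normr_ge0 x) (normr_ge0 e2) x1 (lexx `|e2|).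
  have := ler_pM (normr_ge0 y) (normr_ge0 e1) y1 (lexx `|e1|).
  rewrite !mul1r => g1 g2.
  have := ler_wpM2l (ler0n R t.1) g2; have := ler_wpM2l (ler0n R t.2) g1.
  have := mulr_ge0 (ler0n R t.1) (normr_ge0 e1); have := mulr_ge0 (ler0n R t.2) (normr_ge0 e2).
  by rewrite /D natrD !mulrDl !mulrDr !mulrA; lra.
have k1 : 1 <= k%:R * (1 : R) by rewrite mulr1 ler1n.
have inv1 : 1 <= n^-1 by rewrite invf_ge1.
have hden : (k%:R * h.[x, y])^-1 <= n^-1 ^+ k.
  rewrite -hrk exprVn lef_pV2 ?posrE ?mulr_gt0 ?exprn_gt0 //.
  by rewrite ler_peMl ?exprn_ge0 ?(ltW n0) // -[k%:R]mulr1.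
have den0 : 0 <= (k%:R * h.[x, y])^-1 by rewrite invr_ge0 mulr_ge0 // ltW.
have pk m : 0 <= n^-1 ^+ m by rewrite exprn_ge0 // invr_ge0 ltW.
set ee := `|e1| + `|e2| in aB bB *; have ee0 : 0 <= ee by rewrite addr_ge0.
rewrite /er; apply: le_trans (ler_normD _ _) _.
have p1 : `|- (n^-1 ^+ N) * (a / (k%:R * h.[x, y]))| <= (B1 + B2) * ee * n^-1 ^+ (N + k).
  rewrite normrM normrN (ger0_norm (pk N)) normrM (ger0_norm den0) exprD.
  rewrite [X in _ <= X](_ : _ = n^-1 ^+ N * ((B1 + B2) * ee * n^-1 ^+ k)); last by ring.
  by apply: ler_wpM2l => //; apply: ler_pM.
have p2 : `|(mu.[x, y] * n^-1 ^+ (r + N) - mean_speed) * (n ^+ r * b / (k%:R * h.[x, y]))| <=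
   ((B3 + `|mean_speed|) * n^-1 ^+ (r + N)) * (n ^+ r * (D * ee) * n^-1 ^+ k).
  rewrite normrM; apply: ler_pM => //.
    apply: le_trans (ler_normB _ _) _; rewrite normrM (ger0_norm (pk _)) mulrDl.
    apply: lerD; first by apply: ler_wpM2r => //; exact: h3.
    by rewrite ler_peMr // exprn_ege1.
  rewrite !normrM (ger0_norm den0) (ger0_norm (exprn_ge0 _ (ltW n0))).
  apply: ler_pM => //; first by rewrite mulr_ge0 // exprn_ge0 // ltW.
  by apply: ler_wpM2l => //; rewrite exprn_ge0 // ltW.
have p3 : ((B3 + `|mean_speed|) * n^-1 ^+ (r + N)) * (n ^+ r * (D * ee) * n^-1 ^+ k) =
   (B3 + `|mean_speed|) * D * ee * n^-1 ^+ (N + k).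
  rewrite !exprD; have nr : n^-1 ^+ r * n ^+ r = 1 by rewrite -exprMn mulVf // expr1n.
  rewrite [LHS](_ : _ = (n^-1 ^+ r * n ^+ r) * ((B3 + `|mean_speed|) * D * ee * (n^-1 ^+ N * n^-1 ^+ k))).
    by rewrite nr mul1r.
  by ring.
rewrite p3 in p2; have := mulr_ge0 ee0 (pk (N + k)%N).
have -> : B * ee * n^-1 ^+ (N + k) = (B1 + B2) * ee * n^-1 ^+ (N + k) +
  (B3 + `|mean_speed|) * D * ee * n^-1 ^+ (N + k) + ee * n^-1 ^+ (N + k) by rewrite /B; ring.
lra.
Qed.
End SpiralPotential.

(** * Jets of a formal equivalence *)

Section Jets.
Variable R : realType.
Implicit Types (p q P : {poly {poly R}}) (a b : fps R).

Definition ord2 K p := forall i j, (i + j < K)%N -> p`_i`_j = 0.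

(** Equality of the jets of order K - 1. *)
Definition eqK K a b := forall i j, (i + j < K)%N -> a i j = b i j.

Lemma eqK_trans K a b c : eqK K a b -> eqK K b c -> eqK K a c.
Proof. by move=> h1 h2 i j ij; rewrite h1 ?h2. Qed.

Lemma ord2_bound K p : ord2 K p -> exists2 C, 0 <= C &
  forall x y m, `|x| <= m -> `|y| <= m -> m <= 1 -> `|p.[x, y]| <= C * m ^+ K.
Proof.
move=> hp; have [N /(_ N (leqnn N))[_ _ hN]] := bipoly_bound p.
exists (\sum_(i < N) \sum_(j < N) `|p`_i`_j|).
  by apply: sumr_ge0 => i _; apply: sumr_ge0.
move=> x y m xm ym m1; have m0 : 0 <= m by apply: le_trans xm.
rewrite hN mulr_suml; apply: le_trans (ler_norm_sum _ _ _) _; apply: ler_sum => i _.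
rewrite mulr_suml; apply: le_trans (ler_norm_sum _ _ _) _; apply: ler_sum => j _.
case: (ltnP (i + j) K) => ij; first by rewrite hp // !mul0r normr0 mul0r.
rewrite !normrM -mulrA; apply: ler_wpM2l => //; rewrite !normrX.
apply: (@le_trans _ _ (m ^+ (i + j))).
  rewrite exprD; apply: ler_pM; rewrite ?exprn_ge0 //;
  by apply: lerXn2r => //; rewrite nnegrE.
exact: ler_wiXn2l.
Qed.

Lemma coefM2 p q i j : (p * q)`_i`_j =
  fps_mul (fps_of_poly p) (fps_of_poly q) i j.
Proof.
rewrite coefM coef_sum; apply: eq_bigr => a' _.
by rewrite coefM.
Qed.

Lemma eqK_mul K a a' b b' : eqK K a a' -> eqK K b b' -> eqK K (fps_mul a b) (fps_mul a' b').
Proof.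
move=> ha hb i j ij; apply: eq_bigr => c _; apply: eq_bigr => d _.
have := ltn_ord c; have := ltn_ord d; rewrite !ltnS => dj ci.
rewrite ha; last by apply: leq_ltn_trans ij; exact: leq_add.
by rewrite hb //; apply: leq_ltn_trans ij; apply: leq_add; exact: leq_subr.
Qed.

Lemma eqK_polyM K p q a b : eqK K (fps_of_poly p) a -> eqK K (fps_of_poly q) b ->
  eqK K (fps_of_poly (p * q)) (fps_mul a b).
Proof.
move=> hp hq; apply: eqK_trans (eqK_mul hp hq) => i j _.
by rewrite -coefM2.
Qed.

Lemma eqK_dx K p a : eqK K.+1 (fps_of_poly p) a -> eqK K (fps_of_poly (dX p)) (fps_dx a).
Proof. by move=> hp i j ij; rewrite /fps_of_poly dX_coef /fps_dx -hp ?addSn. Qed.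

Lemma eqK_dy K p a : eqK K.+1 (fps_of_poly p) a -> eqK K (fps_of_poly (dY p)) (fps_dy a).
Proof. by move=> hp i j ij; rewrite /fps_of_poly dY_coef /fps_dy -hp ?addnS. Qed.

Lemma eqK_le K K' a b : (K <= K')%N -> eqK K' a b -> eqK K a b.
Proof. by move=> KK h i j ij; apply: h; exact: leq_trans KK. Qed.

Lemma eqK_exp K p a n : eqK K (fps_of_poly p) a -> eqK K (fps_of_poly (p ^+ n)) (fps_exp a n).
Proof.
move=> hp; elim: n => [|n IH].
  move=> i j _; rewrite expr0 /fps_of_poly /fps_exp /= /fps_one.
  by case: i => [|i]; rewrite coef1 /= ?coef1 ?coef0.
by rewrite exprS; exact: eqK_polyM.
Qed.

Lemma ord2M m n p q : ord2 m p -> ord2 n q -> ord2 (m + n) (p * q).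
Proof.
move=> hp hq i j ij; rewrite coefM2 /fps_mul big1 // => c _; rewrite big1 // => d _.
have := ltn_ord c; have := ltn_ord d; rewrite !ltnS => dj ci.
case: (ltnP (c + d) m) => cd; first by rewrite /fps_of_poly hp // mul0r.
rewrite /fps_of_poly hq ?mulr0 //; move: ij cd dj ci; clear; lia.
Qed.

Lemma ord2_exp p n : ord2 1 p -> ord2 n (p ^+ n).
Proof.
move=> hp; elim: n => [|n IH]; first by [].
by rewrite exprS -add1n; exact: ord2M.
Qed.

Definition trunc2 K a : {poly {poly R}} :=
  \poly_(i < K) \poly_(j < K) (if (i + j < K)%N then a i j else 0).

Lemma trunc2_coef K a i j : (trunc2 K a)`_i`_j = if (i + j < K)%N then a i j else 0.
Proof.
rewrite /trunc2 coef_poly; case: (ltnP i K) => iK; last first.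
  by rewrite coef0 ltnNge (leq_trans iK) ?leq_addr.
rewrite coef_poly; case: (ltnP j K) => jK //.
by rewrite ltnNge (leq_trans jK) ?leq_addl.
Qed.

Lemma trunc2_eqK K a : eqK K (fps_of_poly (trunc2 K a)) a.
Proof. by move=> i j ij; rewrite /fps_of_poly trunc2_coef ij. Qed.

Definition comp2poly A P p q : {poly {poly R}} :=
  \sum_(c < A) \sum_(d < A) (P`_c`_d)%:P%:P * (p ^+ c * q ^+ d).

Lemma comp2poly_coef K A P p q a b : (K <= A)%N ->
  eqK K (fps_of_poly p) a -> eqK K (fps_of_poly q) b -> ord2 1 p -> ord2 1 q ->
  eqK K (fps_of_poly (comp2poly A P p q)) (fps_comp (fps_of_poly P) a b).
Proof.
move=> KA hp hq op oq i j ij; rewrite /fps_of_poly /comp2poly /fps_comp.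
have iA : (i + j < A)%N by exact: leq_trans KA.
pose F (c d : nat) := P`_c`_d * (p ^+ c * q ^+ d)`_i`_j.
have F0 c d : (i + j < c + d)%N -> F c d = 0.
  move=> h; rewrite /F (@ord2M c d) ?mulr0 //; exact: ord2_exp.
transitivity (\sum_(c < A) \sum_(d < A) F c d).
  rewrite coef_sum coef_sum; apply: eq_bigr => c _; rewrite coef_sum coef_sum.
  by apply: eq_bigr => d _; rewrite !coefCM.
transitivity (\sum_(c < (i + j).+1) \sum_(d < (i + j).+1) F c d).
  apply/esym; transitivity (\sum_(c < (i + j).+1) \sum_(d < A) F c d).
    apply: eq_bigr => c _; apply: (@sum_widen R (F c)) => // d hd.
    by apply: F0; rewrite (leq_trans hd) ?leq_addl.
  apply: (@sum_widen R (fun c => \sum_(d < A) F c d)) => // c hc.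
  by apply: big1 => d _; apply: F0; rewrite (leq_trans hc) ?leq_addr.
apply: eq_bigr => c _; apply: eq_bigr => d _; congr (_ * _).
exact: (eqK_polyM (eqK_exp c hp) (eqK_exp d hq)).
Qed.

Lemma comp2poly_ev P p q K : exists2 A, (K <= A)%N & forall x y,
  (comp2poly A P p q).[x, y] = P.[p.[x, y], q.[x, y]].
Proof.
have [N hN] := bipoly_bound P.
have [_ _ e] := hN (maxn N K) (leq_maxl _ _).
exists (maxn N K); first exact: leq_maxr.
move=> x y; rewrite e /comp2poly ev_sum; apply: eq_bigr => i _.
rewrite ev_sum; apply: eq_bigr => j _.
by rewrite !evM evC !evXn mulrA.
Qed.

Lemma taylor_estimate K a (g : R * R -> R) : power_series_at0 a g ->
  exists C d, [/\ 0 <= C, 0 < d & forall x y m, 0 < m <= d -> `|x| <= m -> `|y| <= m ->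
    `|g (x, y) - (trunc2 K a).[x, y]| <= C * m ^+ K].
Proof.
move=> hg.
have [C0 [k0 [C00 k00 hexp]]] := @weighted_expansion R (1, 1)%N a g 1 isT isT hg.
exists (C0 * k0 ^+ K), (k0^-1); split.
- by rewrite mulr_ge0 ?exprn_ge0 ?ltW.
- by rewrite invr_gt0.
- move=> x y m /andP[m0 mk] xm ym.
  have c1 : `|x / m| <= 1 by rewrite normrM normfV (gtr0_norm m0) ler_pdivrMr // mul1r.
  have c2 : `|y / m| <= 1 by rewrite normrM normfV (gtr0_norm m0) ler_pdivrMr // mul1r.
  have km : k0 * m <= 1 by rewrite mulrC -ler_pdivlMr // mul1r.
  have := (hexp _ _ c1 c2).2 m K m0 km.
  have mx z : m ^+ (1, 1)%N.1 * (z / m) = z by rewrite expr1 mulrC divfK // gt_eqF.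
  have mx2 z : m ^+ (1, 1)%N.2 * (z / m) = z by rewrite expr1 mulrC divfK // gt_eqF.
  rewrite mx mx2 horner_poly (@sum_wcoef R (1, 1)%N a _ _ m K K) // mx mx2 exprMn mulrA.
  suff -> : (trunc2 K a).[x, y] = \sum_(i < K) \sum_(j < K)
    (if (1 * i + 1 * j < K)%N then a i j * x ^+ i * y ^+ j else 0) by [].
  rewrite /trunc2 horner_poly horner_sum; apply: eq_bigr => i _.
  rewrite hornerM -polyC_exp hornerC horner_poly mulr_suml; apply: eq_bigr => j _.
  by rewrite !mul1n; case: ifP => _; rewrite ?mul0r // mulrAC.
Qed.

(** Cramer's rule for the linear part; the rest is quadratic. *)
Lemma linear_lower_bound p q : p`_0`_0 = 0 -> q`_0`_0 = 0 ->
  p`_1`_0 * q`_0`_1 - p`_0`_1 * q`_1`_0 != 0 ->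
  exists c d, [/\ 0 < c, 0 < d & forall x y, `|x| <= d -> `|y| <= d ->
    c * (`|x| + `|y|) <= `|p.[x, y]| + `|q.[x, y]|].
Proof.
move=> p0 q0; set a := p`_1`_0; set b := p`_0`_1; set c := q`_1`_0; set d := q`_0`_1.
set D := _ - _ => D0.
have lin (P : {poly {poly R}}) : P`_0`_0 = 0 ->
    ord2 2 (P - ((P`_1`_0)%:P%:P * 'X + (P`_0`_1)%:P%:P * 'Y)).
  move=> P0 i j ij; rewrite !coefB !coefD coefMX -polyCM !coefC.
  case: i ij => [|[|i]] /=; case: j => [|[|j]] //= _;
  by rewrite ?coef0 ?coefMX ?coefC /= ?P0 ?addr0 ?add0r ?subrr ?oppr0.
have [C1 C10 h1] := ord2_bound (lin p p0); have [C2 C20 h2] := ord2_bound (lin q q0).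
pose S := `|a| + `|b| + `|c| + `|d| + 1.
have S0 : 0 < S by rewrite ltr_wpDl // !addr_ge0.
have nD : 0 < `|D| by rewrite normr_gt0.
pose C := C1 + C2 + 1; have C0 : 0 < C by rewrite ltr_wpDl // addr_ge0.
pose del := Num.min (1 / 2) (`|D| / (8 * S * C)).
have SC : 0 < 8 * S * C by rewrite !mulr_gt0.
exists (`|D| / (4 * S)), del; split.
- by rewrite divr_gt0 // mulr_gt0.
- by rewrite lt_min divr_gt0 // divr_gt0.
move=> x y xd yd; pose w := `|x| + `|y|.
have w0 : 0 <= w by rewrite addr_ge0.
have xw : `|x| <= w by rewrite lerDl.
have yw : `|y| <= w by rewrite lerDr.
have [d1 d2] : del <= 1 / 2 /\ del <= `|D| / (8 * S * C) by rewrite /del !ge_min !lexx orbT.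
have w1 : w <= 1 by rewrite /w; lra.
have e1 := h1 x y w xw yw w1; have e2 := h2 x y w xw yw w1.
rewrite evB evD !evM !evC evX evY -/a -/b in e1.
rewrite evB evD !evM !evC evX evY -/c -/d in e2.
set P := p.[x, y] in e1 *; set Q := q.[x, y] in e2 *.
set u := a * x + b * y in e1; set v := c * x + d * y in e2.
have Dx : D * x = d * u - b * v by rewrite /D /u /v; ring.
have Dy : D * y = a * v - c * u by rewrite /D /u /v; ring.
have nx : `|D| * `|x| <= `|d| * `|u| + `|b| * `|v|.
  by rewrite -!normrM Dx; exact: ler_normB.
have ny : `|D| * `|y| <= `|a| * `|v| + `|c| * `|u|.
  by rewrite -!normrM Dy; exact: ler_normB.
have uv : `|u| + `|v| <= `|P| + `|Q| + C * w ^+ 2.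
  have g1 := ler_normB P (P - u); have g2 := ler_normB Q (Q - v).
  have -> : C * w ^+ 2 = C1 * w ^+ 2 + C2 * w ^+ 2 + w ^+ 2 by rewrite /C; ring.
  have := sqr_ge0 w.
  have eu : P - (P - u) = u by ring. have ev : Q - (Q - v) = v by ring.
  by rewrite eu in g1; rewrite ev in g2; lra.
have Dw : `|D| * w <= S * (`|u| + `|v|).
  have := mulr_ge0 (normr_ge0 a) (normr_ge0 u); have := mulr_ge0 (normr_ge0 b) (normr_ge0 u).
  have := mulr_ge0 (normr_ge0 c) (normr_ge0 v); have := mulr_ge0 (normr_ge0 d) (normr_ge0 v).
  have := normr_ge0 u; have := normr_ge0 v.
  by rewrite /w /S mulrDr !mulrDl !mulrDr; lra.
have Cw : S * (C * w ^+ 2) <= `|D| / 4 * w.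
  have wd : w <= 2 * del by rewrite /w; lra.
  have : w <= 2 * (`|D| / (8 * S * C)) by lra.
  have -> : 2 * (`|D| / (8 * S * C)) = `|D| / 4 / (S * C).
    by field; rewrite !gt_eqF.
  rewrite ler_pdivlMr ?mulr_gt0 // => hw.
  have -> : S * (C * w ^+ 2) = w * (S * C) * w by ring.
  by rewrite ler_wpM2r.
have SPQ : S * (`|u| + `|v|) <= S * (`|P| + `|Q| + C * w ^+ 2) by rewrite ler_pM2l.
rewrite mulrAC ler_pdivrMr ?mulr_gt0 // -/w.
have Dw0 : 0 <= `|D| * w by rewrite mulr_ge0.
rewrite mulrDr in SPQ.
have -> : (`|P| + `|Q|) * (4 * S) = 4 * (S * (`|P| + `|Q|)) by ring.
lra.
Qed.

(** The jet of order K of a formal diffeomorphism still satisfies the conjugation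
   equation up to order K, and F differs from its own jet by a term of order K. *)
Lemma equivalence_estimate K (f : fvf R) (F : R * R -> R * R) (P : {poly {poly R}} * {poly {poly R}}) :
  has_taylor F f -> formally_orbital_equivalent f (fvf_of_poly P) ->
  exists (p q g : {poly {poly R}}) C d c, [/\ [/\ 0 < d <= 1, 0 < C, 0 < c & 0 < g.[0, 0]],
    p.[0, 0] = 0 /\ q.[0, 0] = 0,
    forall x y, `|x| <= d -> `|y| <= d ->
      c * (`|x| + `|y|) <= `|p.[x, y]| + `|q.[x, y]|
  & forall x y m, 0 < m <= d -> `|x| <= m -> `|y| <= m ->
    exists e1 e2, [/\ `|e1| <= C * m ^+ K, `|e2| <= C * m ^+ K,
     g.[x, y] * ((dX p).[x, y] * (F (x, y)).1 + (dY p).[x, y] * (F (x, y)).2) =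
       P.1.[p.[x, y], q.[x, y]] + e1
   & g.[x, y] * ((dX q).[x, y] * (F (x, y)).1 + (dY q).[x, y] * (F (x, y)).2) =
       P.2.[p.[x, y], q.[x, y]] + e2]].
Proof.
move=> [hF1 hF2] [phi [eta [[phi10 phi20] det eta0 heq]]].
pose p := trunc2 K.+2 phi.1; pose q := trunc2 K.+2 phi.2; pose g := trunc2 K.+1 eta.
pose f1 := trunc2 K f.1; pose f2 := trunc2 K f.2.
have hp : eqK K.+2 (fps_of_poly p) phi.1 by exact: trunc2_eqK.
have hq : eqK K.+2 (fps_of_poly q) phi.2 by exact: trunc2_eqK.
have hg : eqK K (fps_of_poly g) eta by apply: eqK_le (@trunc2_eqK K.+1 eta).
have hf1 : eqK K (fps_of_poly f1) f.1 by exact: trunc2_eqK.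
have hf2 : eqK K (fps_of_poly f2) f.2 by exact: trunc2_eqK.
have op : ord2 1 p by move=> [|i] [|j] // _; rewrite trunc2_coef.
have oq : ord2 1 q by move=> [|i] [|j] // _; rewrite trunc2_coef.
have ev00 (s : {poly {poly R}}) : s.[0, 0] = s`_0`_0 by rewrite !horner_coef0.
have p00 : p`_0`_0 = 0 by exact: op.
have q00 : q`_0`_0 = 0 by exact: oq.
have lieE (s : {poly {poly R}}) a : eqK K.+2 (fps_of_poly s) a ->
  eqK K (fps_of_poly (dX s * (g * f1) + dY s * (g * f2)))
    (fps_lie (fps_mul eta f.1, fps_mul eta f.2) a).
  move=> hs i j ij; rewrite /fps_of_poly !coefD /fps_lie /fps_add /=.
  have hs' : eqK K.+1 (fps_of_poly s) a by apply: eqK_le hs.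
  congr (_ + _).
    exact: (eqK_polyM (eqK_dx hs') (eqK_polyM hg hf1)).
  exact: (eqK_polyM (eqK_dy hs') (eqK_polyM hg hf2)).
have [A1 KA1 ev1] := comp2poly_ev P.1 p q K.
have [A2 KA2 ev2] := comp2poly_ev P.2 p q K.
have hpK : eqK K (fps_of_poly p) phi.1 by apply: eqK_le hp; exact: leqW (leqnSn K).
have hqK : eqK K (fps_of_poly q) phi.2 by apply: eqK_le hq; exact: leqW (leqnSn K).
have o1 : ord2 K (dX p * (g * f1) + dY p * (g * f2) - comp2poly A1 P.1 p q).
  move=> i j ij; rewrite !coefB.
  have -> : (dX p * (g * f1) + dY p * (g * f2))`_i`_j = _ := lieE p phi.1 hp i j ij.
  have -> : (comp2poly A1 P.1 p q)`_i`_j = _ := comp2poly_coef P.1 KA1 hpK hqK op oq ij.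
  by rewrite (heq i j).1 subrr.
have o2 : ord2 K (dX q * (g * f1) + dY q * (g * f2) - comp2poly A2 P.2 p q).
  move=> i j ij; rewrite !coefB.
  have -> : (dX q * (g * f1) + dY q * (g * f2))`_i`_j = _ := lieE q phi.2 hq i j ij.
  have -> : (comp2poly A2 P.2 p q)`_i`_j = _ := comp2poly_coef P.2 KA2 hpK hqK op oq ij.
  by rewrite (heq i j).2 subrr.
have [B1 B10 b1] := ord2_bound o1; have [B2 B20 b2] := ord2_bound o2.
have [B3 [d3 [B30 d30 b3]]] := taylor_estimate K hF1.
have [B4 [d4 [B40 d40 b4]]] := taylor_estimate K hF2.
have [M1 M10 m1] := ev_bounded (g * dX p) 1; have [M2 M20 m2] := ev_bounded (g * dY p) 1.
have [M3 M30 m3] := ev_bounded (g * dX q) 1; have [M4 M40 m4] := ev_bounded (g * dY q) 1.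
have [|c [d5 [c0 d50 hlow]]] := @linear_lower_bound p q p00 q00.
  by rewrite !trunc2_coef.
pose d := Num.min 1 (Num.min d3 (Num.min d4 d5)).
have d0 : 0 < d by rewrite !lt_min ltr01 d30 d40.
have [dl1 dl3 dl4 dl5] : [/\ d <= 1, d <= d3, d <= d4 & d <= d5].
  by rewrite /d !ge_min !lexx !orbT.
pose C := B1 + B2 + (M1 + M3) * B3 + (M2 + M4) * B4 + 1.
have C0 : 0 < C by rewrite ltr_wpDl // !addr_ge0 // mulr_ge0 // addr_ge0.
exists p, q, g, C, d, c; split.
- by rewrite d0 dl1 c0 C0 ev00 trunc2_coef.
- by rewrite !ev00.
- by move=> x y xd yd; apply: hlow; [exact: le_trans dl5 | exact: le_trans dl5].
move=> x y m /andP[m0 md] xm ym.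
have mm1 : m <= 1 by lra.
have x1 : `|x| <= 1 by lra. have y1 : `|y| <= 1 by lra.
have g1 := b1 x y m xm ym mm1; have g2 := b2 x y m xm ym mm1.
have hm3 : 0 < m <= d3 by rewrite m0 (le_trans md).
have hm4 : 0 < m <= d4 by rewrite m0 (le_trans md).
have g3 := b3 x y m hm3 xm ym; have g4 := b4 x y m hm4 xm ym.
rewrite -/f1 in g3; rewrite -/f2 in g4.
have mK : 0 <= m ^+ K by rewrite exprn_ge0 // ltW.
have CE : C * m ^+ K = B1 * m ^+ K + B2 * m ^+ K + M1 * (B3 * m ^+ K) + M3 * (B3 * m ^+ K)
   + M2 * (B4 * m ^+ K) + M4 * (B4 * m ^+ K) + m ^+ K by rewrite /C; ring.
have pB1 : 0 <= B1 * m ^+ K by rewrite mulr_ge0.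
have pB2 : 0 <= B2 * m ^+ K by rewrite mulr_ge0.
have pB3 : 0 <= B3 * m ^+ K by rewrite mulr_ge0.
have pB4 : 0 <= B4 * m ^+ K by rewrite mulr_ge0.
have q1 := mulr_ge0 M10 pB3; have q2 := mulr_ge0 M20 pB4.
have q3 := mulr_ge0 M30 pB3; have q4 := mulr_ge0 M40 pB4.
exists ((dX p * (g * f1) + dY p * (g * f2) - comp2poly A1 P.1 p q).[x, y] +
  (g * dX p).[x, y] * ((F (x, y)).1 - f1.[x, y]) + (g * dY p).[x, y] * ((F (x, y)).2 - f2.[x, y])),
  ((dX q * (g * f1) + dY q * (g * f2) - comp2poly A2 P.2 p q).[x, y] +
  (g * dX q).[x, y] * ((F (x, y)).1 - f1.[x, y]) + (g * dY q).[x, y] * ((F (x, y)).2 - f2.[x, y])).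
split.
- apply: le_trans (ler_normD _ _) _; rewrite normrM.
  have := ler_normD (dX p * (g * f1) + dY p * (g * f2) - comp2poly A1 P.1 p q).[x, y]
    ((g * dX p).[x, y] * ((F (x, y)).1 - f1.[x, y])); rewrite normrM.
  have := ler_pM (normr_ge0 _) (normr_ge0 _) (m1 x y x1 y1) g3.
  have := ler_pM (normr_ge0 _) (normr_ge0 _) (m2 x y x1 y1) g4.
  by rewrite CE; lra.
- apply: le_trans (ler_normD _ _) _; rewrite normrM.
  have := ler_normD (dX q * (g * f1) + dY q * (g * f2) - comp2poly A2 P.2 p q).[x, y]
    ((g * dX q).[x, y] * ((F (x, y)).1 - f1.[x, y])); rewrite normrM.
  have := ler_pM (normr_ge0 _) (normr_ge0 _) (m3 x y x1 y1) g3.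
  have := ler_pM (normr_ge0 _) (normr_ge0 _) (m4 x y x1 y1) g4.
  by rewrite CE; lra.
- by rewrite evB evD !evM ev1; ring.
- by rewrite evB evD !evM ev2; ring.
Qed.
End Jets.

(** * Variation of the potential during one turn *)

Lemma mul_small (R : realFieldType) (M u v : R) :
  0 <= M -> 0 <= u -> u <= v / (M + 1) -> M * u <= v.
Proof.
move=> M0 u0; rewrite ler_pdivlMr ?ltr_wpDl // mulrDr mulr1 mulrC => h.
by apply: le_trans h; rewrite lerDl.
Qed.

Section Comparison.
Variables (R : realType) (t : nat * nat) (k N : nat) (h mu : {poly {poly R}}).
Variables (Cs Sn : R -> R) (T : R).
Variables (e : R) (C S lam E : R -> R) (f : fvf R) (F : R * R -> R * R).
Hypothesis ht : is_type t.
Hypothesis hh : whomog t k h.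
Hypothesis hpar : parameterizes_level1 h Cs Sn T.
Hypothesis hmu : whomog t (wr t k + N) mu.
Hypothesis he : e = 1 \/ e = -1.
Hypothesis pf : polar_frame t h e C S lam E.
Hypothesis hF : has_taylor F f.
Hypothesis hequiv : formally_orbital_equivalent f (fvf_of_poly (normal_form t h mu)).

Let r := wr t k.
Let c0 := mean_speed mu Cs Sn T.
Let t1 : (0 < t.1)%N := (level_t_gt0 ht hh hpar).1.
Let t2 : (0 < t.2)%N := (level_t_gt0 ht hh hpar).2.
Let k0 : (0 < k)%N := level_k_gt0 ht hh hpar.
Let hk : (t.1 + t.2 <= k)%N := level_k_ge ht hh hpar.
Let hpos := level_pos ht hh hpar.

Ltac drop_local_facts := clear - ht hh hpar hmu he pf hF hequiv r c0 t1 t2 k0 hk hpos.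

Lemma level_origin : h.[0, 0] = 0.
Proof.
have := whomog_ev 0 0 0 hh; rewrite !mulr0 => ->.
by rewrite expr0n gtn_eqF //= mul0r.
Qed.

Lemma small_exp (u : R) m n : 0 <= u <= 1 -> (m <= n)%N -> u ^+ n <= u ^+ m.
Proof. by move=> /andP[u0 u1] mn; apply: ler_wiXn2l. Qed.

Lemma frame_lower : exists2 c2, 0 < c2 & forall s, c2 <= `|C s| + `|S s|.
Proof.
have [B B0 hB] := frame_bounded pf.
have [L L0 hL] := ev_lipschitz h B.
have hl s : 1 <= (L + 1) * (`|C s| + `|S s|).
  have [b1 b2 _ _ _] := hB s; have b0 : `|0 : R| <= B by rewrite normr0 ltW.
  have := hL _ _ _ _ b1 b2 b0 b0; rewrite level_origin !subr0 (pf_level pf) normr1 => h1.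
  by rewrite mulrDl mul1r (le_trans h1) // lerDl addr_ge0.
exists (L + 1)^-1; first by rewrite invr_gt0 ltr_wpDl.
by move=> s; rewrite -[_^-1]mulr1 ler_pdivrMl ?ltr_wpDl.
Qed.

(** In weighted polar coordinates (x, y) is at most 2 B u and h is u^k. *)
Lemma h_lower : exists2 B, 1 <= B & (forall s, `|C s| <= B /\ `|S s| <= B) /\
  forall x y, `|x| <= 1 -> `|y| <= 1 -> ((`|x| + `|y|) / (2 * B)) ^+ k <= h.[x, y].
Proof.
have [B B0 hB] := frame_bounded pf.
pose D := B + 1; have D1 : 1 <= D by rewrite lerDr ltW.
have hD s : `|C s| <= D /\ `|S s| <= D by have [b1 b2 _ _ _] := hB s; rewrite /D; split; lra.
exists D => //; split=> // x y x1 y1.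
have [xy|xy] := eqVneq (x, y) (0, 0).
  by case: xy => -> ->; rewrite level_origin normr0 addr0 mul0r expr0n gtn_eqF.
have [u [s [u0 _ ex ey]]] := pf_surj pf xy.
have -> : h.[x, y] = u ^+ k by rewrite ex ey (whomog_ev _ _ _ hh) (pf_level pf) mulr1.
apply: lerXn2r; rewrite ?nnegrE ?divr_ge0 ?addr_ge0 ?mulr_ge0 ?(ltW u0) //; try lra.
rewrite ler_pdivrMr; last by rewrite mulr_gt0 //; lra.
have [u1|u1] := lerP u 1; last first.
  have : 1 * 1 <= u * D by apply: ler_pM => //; exact: ltW.
  lra.
have bx : `|x| <= u * D.
  rewrite ex normrM (ger0_norm (exprn_ge0 _ (ltW u0))).
  apply: ler_pM; rewrite ?exprn_ge0 ?(ltW u0) ?(hD s).1 //.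
  by rewrite -[X in _ <= X]expr1; apply: small_exp; rewrite ?(ltW u0).
have by' : `|y| <= u * D.
  rewrite ey normrM (ger0_norm (exprn_ge0 _ (ltW u0))).
  apply: ler_pM; rewrite ?exprn_ge0 ?(ltW u0) ?(hD s).2 //.
  by rewrite -[X in _ <= X]expr1; apply: small_exp; rewrite ?(ltW u0).
lra.
Qed.

(** W is transported by a jet of large order K. Under it h becomes at least a u^b, so
   the error of conjugation, O(u^K), is small with respect to radius^r and remains so
   after division by the powers of the radius and of u which occur. *)
Lemma spiral_comparison (n : nat) : exists (w : R -> R) d D,
  [/\ 0 < d <= 1, 0 < D,
   forall A, exists2 z3, 0 < z3 & forall z, 0 < z < z3 -> A < w z
 & forall u : R -> R, (forall s, -1 <= s <= 2 * pi + 1 ->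
     [/\ der u s (polar_rhs t k h C S lam F s (u s)), 0 < u s <= d,
         k%:R / 2 <= den t k C S F s (u s) <= 2 * k%:R,
         {for s, continuous (fun s => slowness t k e C S lam F s (u s))}
       & {for s, continuous (fun s => comp1 t k C S F s (u s))} /\
         {for s, continuous (fun s => comp2 t k C S F s (u s))}]) ->
   exists2 s, 0 <= s <= 2 * pi &
     (c0 = 0 -> `|w (u (2 * pi)) - w (u 0)| <= D * u s ^+ n) /\
     (c0 != 0 -> 0 < - (e * c0) * (w (u (2 * pi)) - w (u 0)))].
Proof.
have ee : e * e = 1 by case: he => ->; rewrite ?mulr1 ?mulrNN ?mulr1.
have [B B1 [hB hlow]] := h_lower.
have [c2 c20 hc2] := frame_lower.
have [Bf Bf0 hBf] := frame_bounded pf.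
have [W [hW1 hW2]] := spiral_potential ht hh hpar hmu.
have [Bp Bp0 hpert] := @dpotential_perturbed R t k N h mu Cs Sn T ht hh hpar.
pose tm := (t.1 + t.2)%N; pose b := (tm * k)%N.
(* The radius is at least a constant times u^b: the factor radius^-(N + k) of the error
   costs u^(b (N + k)), the slowness costs u^r, and radius^r is at least of size
   u^(b r). *)
pose K1 := (n + 1 + r + b * r)%N; pose K := (K1 + b * (N + k))%N.
have [p [q [g [Ce [d0 [c [[/andP[d00 d01] Ce0 cc0 g0] [p00 q00] hpq hest]]]]]]] :=
  equivalence_estimate K hF hequiv.
have [Lp Lp0 hLp] := ev_lipschitz p 1; have [Lq Lq0 hLq] := ev_lipschitz q 1.
have [Lh Lh0 hLh] := ev_lipschitz h 1; have [Lg Lg0 hLg] := ev_lipschitz g 1.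
set g00 := g.[0, 0] in g0.
have B0 : 0 < B by apply: lt_le_trans B1.
pose M1 := 2 * (Lp + Lq) * B; have M10 : 0 <= M1 by rewrite mulr_ge0 ?mulr_ge0 ?addr_ge0 ?(ltW B0).
have [a a0 aE] : exists2 a, 0 < a & a = (c * c2 / (2 * B)) ^+ k.
  by exists ((c * c2 / (2 * B)) ^+ k) => //; rewrite exprn_gt0 // divr_gt0 ?mulr_gt0.
have [A0 A00 A0E] : exists2 A0, 0 < A0 & A0 = Bp * (2 * Ce * B ^+ K) / a ^+ (N + k).
  exists (Bp * (2 * Ce * B ^+ K) / a ^+ (N + k)) => //.
  by rewrite divr_gt0 ?exprn_gt0 // !mulr_gt0 ?exprn_gt0.
pose dc := if c0 == 0 then 1 else `|c0| * a ^+ r / (2 * A0).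
have dc0 : 0 < dc.
  rewrite /dc; case: eqVneq => // c00; rewrite divr_gt0 ?mulr_gt0 ?exprn_gt0 //.
  by rewrite normr_gt0.
(* The point (p, q) must stay in the unit square with h <= 1, where the estimates on the
   potential hold, and g must stay above g00 / 2. *)
pose d := Num.min (Num.min (d0 / B) (Num.min 1 (1 / (M1 + 1))))
                  (Num.min (1 / (Lh * M1 + 1)) (Num.min (g00 / (4 * Lg * B + 1)) dc)).
have LhM0 : 0 <= Lh * M1 by rewrite mulr_ge0.
have LgB0 : 0 <= 4 * Lg * B by rewrite !mulr_ge0 // ltW.
have [M11 LhM1 LgB1] : [/\ 0 < M1 + 1, 0 < Lh * M1 + 1 & 0 < 4 * Lg * B + 1] by split; rewrite ltr_wpDl.
have dpos : 0 < d by rewrite !lt_min dc0 ltr01 !divr_gt0.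
have [dl1 dl2 dl3 [dl4 dl5 dl6]] : [/\ d <= d0 / B, d <= 1, d <= 1 / (M1 + 1) &
   [/\ d <= 1 / (Lh * M1 + 1), d <= g00 / (4 * Lg * B + 1) & d <= dc]].
  by rewrite /d !ge_min !lexx !orbT.
have p0 := @pi_gt0 R.
pose D := 2 * Bf * (2 / g00) * A0 * (2 * pi) + 1.
have D1 : 0 < 2 * Bf * (2 / g00) * A0 * (2 * pi).
  have g20 : 0 < 2 / g00 by rewrite divr_gt0.
  have Bf2 : 0 < 2 * Bf by rewrite mulr_gt0.
  by apply: mulr_gt0; [apply: mulr_gt0 A00; exact: mulr_gt0 | exact: mulr_gt0].
have D0 : 0 < D by rewrite /D ltr_wpDl // ltW.
(* Estimates at the point of polar coordinates (u, s). *)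
have point (u s : R) : 0 < u <= d ->
  let x := u ^+ t.1 * C s in let y := u ^+ t.2 * S s in
  [/\ [/\ (p.[x, y], q.[x, y]) != (0, 0), `|p.[x, y]| <= 1 & `|q.[x, y]| <= 1],
      `|p.[x, y]| + `|q.[x, y]| <= M1 * u, a * u ^+ b <= h.[p.[x, y], q.[x, y]] <= 1,
      g00 / 2 <= g.[x, y] & `|x| <= u * B /\ `|y| <= u * B /\ 0 < u * B <= d0].
  move=> /andP[u0 ud] x y.
  have u1 : 0 <= u <= 1 by rewrite ltW //=; exact: le_trans dl2.
  have [Cb Sb] := hB s.
  have up m : (0 < m)%N -> u ^+ m <= u by move=> m0; rewrite -[X in _ <= X]expr1; exact: small_exp.
  have xb : `|x| <= u * B.
    rewrite normrM (ger0_norm (exprn_ge0 _ (ltW u0))).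
    by apply: ler_pM; rewrite ?exprn_ge0 ?(ltW u0) //; exact: up.
  have yb : `|y| <= u * B.
    rewrite normrM (ger0_norm (exprn_ge0 _ (ltW u0))).
    by apply: ler_pM; rewrite ?exprn_ge0 ?(ltW u0) //; exact: up.
  have uB : 0 < u * B <= d0.
    rewrite mulr_gt0 //= -ler_pdivlMr //; exact: le_trans dl1.
  have /andP[uB0 uBd] := uB.
  have [x1 y1] : `|x| <= 1 /\ `|y| <= 1 by move: xb yb uBd d01; drop_local_facts; split; lra.
  have z1 : `|0 : R| <= 1 by rewrite normr0.
  have px := hLp _ _ _ _ x1 y1 z1 z1; rewrite p00 !subr0 in px.
  have qx := hLq _ _ _ _ x1 y1 z1 z1; rewrite q00 !subr0 in qx.
  have gx := hLg _ _ _ _ x1 y1 z1 z1; rewrite -/g00 !subr0 in gx.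
  have xyB : `|x| + `|y| <= 2 * (u * B) by move: xb yb; drop_local_facts; lra.
  have px' : `|p.[x, y]| <= Lp * (2 * (u * B)) by apply: le_trans px _; exact: ler_wpM2l.
  have qx' : `|q.[x, y]| <= Lq * (2 * (u * B)) by apply: le_trans qx _; exact: ler_wpM2l.
  have gx' : `|g.[x, y] - g00| <= Lg * (2 * (u * B)) by apply: le_trans gx _; exact: ler_wpM2l.
  have pqM : `|p.[x, y]| + `|q.[x, y]| <= M1 * u by rewrite /M1; move: px' qx'; drop_local_facts; lra.
  have M1u : M1 * u <= 1.
    by apply: mul_small => //; [exact: ltW | exact: le_trans dl3].
  have [P1 Q1] : `|p.[x, y]| <= 1 /\ `|q.[x, y]| <= 1.
    move: (normr_ge0 p.[x, y]) (normr_ge0 q.[x, y]) pqM M1u; drop_local_facts; split; lra.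
  have hx := hLh _ _ _ _ P1 Q1 z1 z1; rewrite level_origin !subr0 in hx.
  have h1 : h.[p.[x, y], q.[x, y]] <= 1.
    apply: le_trans (le_trans (ler_norm _) hx) _.
    apply: le_trans (ler_wpM2l Lh0 pqM) _; rewrite mulrA.
    by apply: mul_small => //; [exact: ltW | exact: le_trans dl4].
  have gl : g00 / 2 <= g.[x, y].
    have : 4 * Lg * B * u <= g00.
      by apply: mul_small => //; [exact: ltW | exact: le_trans dl5].
    by move: gx'; rewrite ler_norml => /andP[]; drop_local_facts; lra.
  have [xd yd] : `|x| <= d0 /\ `|y| <= d0 by move: xb yb uBd; drop_local_facts; split; lra.
  have low := hpq x y xd yd.
  have xylow : u ^+ tm * c2 <= `|x| + `|y|.
    rewrite !normrM !(ger0_norm (exprn_ge0 _ (ltW u0))).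
    apply: (@le_trans _ _ (u ^+ tm * (`|C s| + `|S s|))).
      by apply: ler_wpM2l; [rewrite exprn_ge0 // ltW | exact: hc2].
    rewrite mulrDr; apply: lerD; apply: ler_wpM2r => //; apply: small_exp => //;
    by rewrite /tm ?leq_addr ?leq_addl.
  have pqlow : u ^+ tm * (c * c2) <= `|p.[x, y]| + `|q.[x, y]|.
    apply: le_trans low; have -> : u ^+ tm * (c * c2) = c * (u ^+ tm * c2) by ring.
    by rewrite ler_pM2l.
  have pqpos : 0 < u ^+ tm * (c * c2) by rewrite !mulr_gt0 ?exprn_gt0.
  split=> //.
  - split=> //; apply/eqP => -[e1 e2]; move: pqlow pqpos; rewrite e1 e2 !normr0; drop_local_facts; lra.
  - rewrite h1 andbT; apply: le_trans (hlow _ _ P1 Q1).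
    have -> : a * u ^+ b = (u ^+ tm * (c * c2) / (2 * B)) ^+ k.
      by rewrite aE /b exprM -exprMn; congr (_ ^+ _); field; rewrite gt_eqF.
    apply: lerXn2r; rewrite ?nnegrE ?divr_ge0 ?addr_ge0 ?mulr_ge0 ?(ltW B0) ?exprn_ge0 ?(ltW u0) ?(ltW cc0) ?(ltW c20) //.
    by rewrite ler_pM2r // invr_gt0 mulr_gt0.
exists (fun z => W p.[z ^+ t.1 * C 0, z ^+ t.2 * S 0] q.[z ^+ t.1 * C 0, z ^+ t.2 * S 0]).
exists d, D; split=> //; first by rewrite dpos.
- move=> A; have [d1 d10 hd1] := hW1 A.
  pose z3 := Num.min d (d1 / 2 / (Lh * M1 + 1)).
  have z30 : 0 < z3 by rewrite lt_min dpos !divr_gt0.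
  exists z3 => // z /andP[z0 zz].
  have [zd zd1] : z <= d /\ z <= d1 / 2 / (Lh * M1 + 1).
    by move: zz; rewrite lt_min => /andP[/ltW -> /ltW ->].
  have zin : 0 < z <= d by rewrite z0.
  have [[n0 P1 Q1] pqM _ _ _] := point z 0 zin.
  apply: hd1 => //.
  have z1 : `|0 : R| <= 1 by rewrite normr0.
  have hx := hLh _ _ _ _ P1 Q1 z1 z1; rewrite level_origin !subr0 in hx.
  apply: le_lt_trans (le_trans (ler_norm _) hx) _.
  apply: le_lt_trans (ler_wpM2l Lh0 pqM) _; rewrite mulrA.
  have : Lh * M1 * z <= d1 / 2 by apply: mul_small => //; exact: ltW.
  by move: d10; drop_local_facts; lra.
move=> u hu.
pose g1 s := u s ^+ t.1 * C s; pose g2 s := u s ^+ t.2 * S s.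
pose sl s := slowness t k e C S lam F s (u s).
pose v1 s := sl s * (e * (u s ^+ (k - t.2) * comp1 t k C S F s (u s))).
pose v2 s := sl s * (e * (u s ^+ (k - t.1) * comp2 t k C S F s (u s))).
pose x s := p.[g1 s, g2 s]; pose y s := q.[g1 s, g2 s].
pose dx s := (dX p).[g1 s, g2 s] * v1 s + (dY p).[g1 s, g2 s] * v2 s.
pose dy s := (dX q).[g1 s, g2 s] * v1 s + (dY q).[g1 s, g2 s] * v2 s.
have den0 s : -1 <= s <= 2 * pi + 1 -> 0 < den t k C S F s (u s).
  move=> /hu[_ _ /andP[d1 _] _ _]; apply: lt_le_trans d1.
  by rewrite divr_gt0 // ltr0n.
have u0 s : -1 <= s <= 2 * pi + 1 -> 0 < u s by move=> /hu[_ /andP[]].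
have F1E s : -1 <= s <= 2 * pi + 1 ->
    u s ^+ (k - t.2) * comp1 t k C S F s (u s) = (F (g1 s, g2 s)).1.
  by move=> /u0 us; rewrite mulrC /comp1 divfK // expf_neq0 // gt_eqF.
have F2E s : -1 <= s <= 2 * pi + 1 ->
    u s ^+ (k - t.1) * comp2 t k C S F s (u s) = (F (g1 s, g2 s)).2.
  by move=> /u0 us; rewrite mulrC /comp2 divfK // expf_neq0 // gt_eqF.
have dg s : -1 <= s <= 2 * pi + 1 -> der g1 s (v1 s) /\ der g2 s (v2 s).
  move=> hs; have [a1 a2 a3 a4 [a5 a6]] := hu s hs.
  have dn : den t k C S F s (u s) != 0 by rewrite gt_eqF // den0.
  have := orbit_der t1 t2 hk hh he pf a1 (u0 s hs) dn.
  by rewrite /v1 /v2 F1E // F2E.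
have cv s : -1 <= s <= 2 * pi + 1 -> {for s, continuous v1} /\ {for s, continuous v2}.
  move=> hs; have [a1 a2 a3 a4 [a5 a6]] := hu s hs; have cu := der_cont a1.
  have ce : {for s, continuous (fun=> e)} by exact: cont_cst.
  by split; apply: contM a4 _; apply: contM ce _; apply: contM => //; exact: contX.
have p20 : 0 < 2 * pi :> R by rewrite mulr_gt0.
have [|s hs0 hs] := hW2 x y dx dy (2 * pi) p20.
  move=> s hs; have [d1 d2] := dg s hs; have [cv1 cv2] := cv s hs.
  have [a1 a2 a3 a4 [a5 a6]] := hu s hs.
  have [[n0 _ _] _ _ _ _] := point (u s) s a2.
  have cg1 := der_cont d1; have cg2 := der_cont d2.
  split=> //.
  - exact: der_ev.
  - exact: der_ev.
  - by apply: contD; apply: contM => //; exact: continuous_ev.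
  - by apply: contD; apply: contM => //; exact: continuous_ev.
have hs1 : -1 <= s <= 2 * pi + 1 by move: hs0 p0; drop_local_facts; lra.
exists s => //.
have [a1 a2 a3 a4 [a5 a6]] := hu s hs1.
have us0 := u0 s hs1.
have u1 : 0 <= u s <= 1.
  by rewrite ltW //=; case/andP: a2 => _ h1; exact: le_trans dl2.
have [[n0 P1 Q1] _ /andP[hlo hhi] gl [xb [yb uB]]] := point (u s) s a2.
rewrite -/(g1 s) -/(g2 s) -/(x s) -/(y s) in n0 P1 Q1 hlo hhi gl xb yb.
have [e1 [e2 [he1 he2 eq1 eq2]]] := hest (g1 s) (g2 s) (u s * B) uB xb yb.
have gp : 0 < g.[g1 s, g2 s] by apply: lt_le_trans gl; rewrite divr_gt0.
pose qq := sl s * e / g.[g1 s, g2 s].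
have dxE : dx s = qq * (- (dY h).[x s, y s] + mu.[x s, y s] * (t.1%:R * x s) + e1).
  have : (- (dY h).[x s, y s] + mu.[x s, y s] * (t.1%:R * x s) + e1) =
     g.[g1 s, g2 s] * ((dX p).[g1 s, g2 s] * (F (g1 s, g2 s)).1 + (dY p).[g1 s, g2 s] * (F (g1 s, g2 s)).2).
    by rewrite eq1 /= evD evN evM evMn evX mulr_natl.
  move=> ->; rewrite /dx /v1 /v2 F1E // F2E // /qq; field; exact: lt0r_neq0.
have dyE : dy s = qq * ((dX h).[x s, y s] + mu.[x s, y s] * (t.2%:R * y s) + e2).
  have : ((dX h).[x s, y s] + mu.[x s, y s] * (t.2%:R * y s) + e2) =
     g.[g1 s, g2 s] * ((dX q).[g1 s, g2 s] * (F (g1 s, g2 s)).1 + (dY q).[g1 s, g2 s] * (F (g1 s, g2 s)).2).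
    by rewrite eq2 /= evD evM evMn evY mulr_natl.
  move=> ->; rewrite /dy /v1 /v2 F1E // F2E // /qq; field; exact: lt0r_neq0.
have hr := radius_exp ht hh hpar n0.
set rho := radius k h (x s) (y s) in hr.
have rho0 : 0 < rho by exact: radius_gt0.
have rho1 : rho <= 1.
  rewrite leNgt; apply/negP => r1; move: hhi; rewrite -hr leNgt; apply/negP/negPn.
  by rewrite exprn_egt1 // -lt0n.
have [er dpE erB] := hpert (x s) (y s) qq e1 e2 n0 P1 Q1 rho1.
rewrite -/rho in dpE erB.
have wE : W (x (2 * pi)) (y (2 * pi)) - W (x 0) (y 0) =
    qq * (- c0 * rho ^+ r + er) * (2 * pi) by rewrite hs dxE dyE dpE.
have xy2 : x (2 * pi) = p.[u (2 * pi) ^+ t.1 * C 0, u (2 * pi) ^+ t.2 * S 0] /\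
           y (2 * pi) = q.[u (2 * pi) ^+ t.1 * C 0, u (2 * pi) ^+ t.2 * S 0].
  have := pf_perC pf 0; have := pf_perS pf 0; rewrite add0r => eS eC.
  by rewrite /x /y /g1 /g2 eS eC.
rewrite -xy2.1 -xy2.2 -/(x 0) -/(y 0) wE.
have au0 : 0 < a * u s ^+ b by rewrite mulr_gt0 ?exprn_gt0.
have rin1 : 1 <= rho^-1 by rewrite invf_ge1.
have rinv : rho^-1 ^+ (N + k) <= ((a * u s ^+ b)^-1) ^+ (N + k).
  apply: (@le_trans _ _ ((rho^-1 ^+ k) ^+ (N + k))).
    rewrite -exprM; apply: ler_weXn2l => //; rewrite leq_pmull //.
  apply: lerXn2r; rewrite ?nnegrE ?exprn_ge0 ?invr_ge0 ?(ltW rho0) ?(ltW au0) //.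
  by rewrite exprVn hr lef_pV2 ?posrE //; exact: lt_le_trans hlo.
have erA : `|er| <= A0 * u s ^+ K1.
  apply: le_trans erB _.
  have e12 : `|e1| + `|e2| <= 2 * Ce * (u s * B) ^+ K by move: he1 he2; drop_local_facts; lra.
  apply: (@le_trans _ _ (Bp * (2 * Ce * (u s * B) ^+ K) * ((a * u s ^+ b)^-1) ^+ (N + k))).
    apply: ler_pM => //.
    - by rewrite mulr_ge0 ?addr_ge0 ?(ltW Bp0).
    - by rewrite exprn_ge0 // invr_ge0 ltW.
    - by rewrite ler_pM2l.
  rewrite A0E /K exprVn !exprMn [u s ^+ (K1 + _)]exprD [b in u s ^+ (b * _)]lock -lock exprM.
  rewrite [X in X <= _](_ : _ = Bp * (2 * Ce * B ^+ (K1 + b * (N + k))) / a ^+ (N + k) * u s ^+ K1) //.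
  field; rewrite !expf_neq0 ?gt_eqF //; exact: exprn_gt0.
have sl0 : 0 < sl s.
  rewrite /sl /slowness; apply: divr_gt0.
    by apply: mulr_gt0; [exact: pf_lam0 pf s | rewrite ltr0n].
  by apply: mulr_gt0; [exact: exprn_gt0 | exact: den0].
split=> c00.
- rewrite c00 oppr0 mul0r add0r.
  have slB : `|sl s| <= 2 * Bf / u s ^+ r.
    rewrite (gtr0_norm sl0) /sl /slowness -/r.
    have ur0 : 0 < u s ^+ r by rewrite exprn_gt0.
    have dn := den0 s hs1.
    rewrite ler_pdivrMr ?mulr_gt0 //.
    have -> : 2 * Bf / u s ^+ r * (u s ^+ r * den t k C S F s (u s)) = Bf * (2 * den t k C S F s (u s)).
      by field; rewrite gt_eqF.
    apply: ler_pM; rewrite ?ler0n ?(ltW (pf_lam0 pf s)) //.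
    + apply: le_trans (ler_norm _) _; rewrite normrM.
      have -> : `|e| = 1 by case: he => ->; rewrite ?normrN normr1.
      by rewrite mul1r; have [] := hBf s.
    + by case/andP: a3; drop_local_facts; lra.
  have qB : `|qq| <= 2 * Bf / u s ^+ r * (2 / g00).
    rewrite /qq normrM [`|sl s * e|]normrM.
    have -> : `|e| = 1 by case: he => ->; rewrite ?normrN normr1.
    rewrite mulr1; apply: ler_pM => //.
    rewrite normfV (gtr0_norm gp) -[2 / g00]invrK invf_div lef_pV2 ?posrE //.
    by rewrite divr_gt0.
  have -> : `|qq * er * (2 * pi)| = `|qq| * `|er| * (2 * pi).
    by rewrite normrM normrM [`|2 * pi|]gtr0_norm.
  apply: (@le_trans _ _ ((2 * Bf / u s ^+ r * (2 / g00)) * (A0 * u s ^+ K1) * (2 * pi))).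
    by rewrite ler_pM2r //; apply: ler_pM.
  have -> : u s ^+ K1 = u s ^+ (n + 1 + b * r) * u s ^+ r.
    by rewrite -exprD; congr (_ ^+ _); rewrite /K1; clear; lia.
  have -> : 2 * Bf / u s ^+ r * (2 / g00) * (A0 * (u s ^+ (n + 1 + b * r) * u s ^+ r)) * (2 * pi) =
     (2 * Bf * (2 / g00) * A0 * (2 * pi)) * u s ^+ (n + 1 + b * r).
    by field; rewrite expf_neq0 gt_eqF.
  apply: ler_pM; rewrite ?exprn_ge0 ?(ltW us0) //.
  + exact: ltW.
  + by rewrite /D lerDl.
  + by apply: small_exp => //; clear; lia.
- have hdc : dc = `|c0| * a ^+ r / (2 * A0) by rewrite /dc (negPf c00).
  have nc0 : 0 < `|c0| by rewrite normr_gt0.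
  have rhor : a ^+ r * u s ^+ (b * r) <= rho ^+ r.
    rewrite exprM -exprMn; apply: lerXn2r; rewrite ?nnegrE ?(ltW au0) ?(ltW rho0) //.
    apply: le_trans hlo _; rewrite -hr -[X in _ <= X]expr1; apply: small_exp => //.
    by rewrite (ltW rho0).
  have er_small : `|er| < `|c0| * rho ^+ r.
    apply: le_lt_trans erA _.
    apply: (@lt_le_trans _ _ (`|c0| * (a ^+ r * u s ^+ (b * r)))); last by rewrite ler_pM2l.
    have ubr : 0 < u s ^+ (b * r) by rewrite exprn_gt0.
    apply: (@le_lt_trans _ _ (A0 * u s * u s ^+ (b * r))).
      rewrite -mulrA -exprS ler_pM2l //; apply: small_exp => //.
      by rewrite /K1; clear; lia.
    rewrite mulrA ltr_pM2r //.
    have : u s <= `|c0| * a ^+ r / (2 * A0).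
      by rewrite -hdc; case/andP: a2 => _ h1; exact: le_trans dl6.
    rewrite ler_pdivlMr ?mulr_gt0 //.
    have : 0 < A0 * u s by rewrite mulr_gt0.
    by drop_local_facts; lra.
  have -> : - (e * c0) * (qq * (- c0 * rho ^+ r + er) * (2 * pi)) =
     (e * e) * (sl s / g.[g1 s, g2 s] * (2 * pi) * (c0 * (c0 * rho ^+ r) - c0 * er)).
    by rewrite /qq; ring.
  rewrite ee mul1r; apply: mulr_gt0.
    by apply: mulr_gt0 p20; exact: divr_gt0.
  rewrite subr_gt0.
  apply: le_lt_trans (ler_norm _) _; rewrite normrM.
  have -> : c0 * (c0 * rho ^+ r) = `|c0| * (`|c0| * rho ^+ r).
    rewrite [LHS]mulrA [RHS]mulrA; congr (_ * _).
    by have := real_normK (num_real c0); rewrite !expr2.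
  by rewrite ltr_pM2l.
Qed.
End Comparison.

(** * The return map *)

Section ReturnMaps.
Variable R : realType.
Implicit Types (f w P : R -> R) (y : nat -> R).

(** The first nonzero coefficient dominates the remainder; if there is none, f is flat
   and its expansion is geometric. *)
Lemma expands_isolated C k (a : nat -> R) f : 0 < C -> 0 < k -> expands C k a f ->
  (exists2 d, 0 < d & forall z, 0 < z <= d -> f z = 0) \/
  exists n c d, [/\ c != 0, 0 < d &
    forall z, 0 < z <= d -> `|f z - c * z ^+ n| <= `|c| / 2 * z ^+ n].
Proof.
move=> C0 k0 [_ hf].
have [a0|] := pselect (forall n, a n = 0).
  left; exists (1 / (2 * k)); first by rewrite divr_gt0 ?mulr_gt0.
  move=> z /andP[z0]; rewrite ler_pdivlMr ?mulr_gt0 // => zk.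
  have kz : k * z <= 1 / 2 by lra.
  have kz1 : k * z <= 1 by lra.
  apply: (@half_exp_eq0 R _ C (ltW C0)) => n; have := hf z n z0 kz1.
  rewrite horner_poly big1 => [|i _]; last by rewrite a0 mul0r.
  rewrite subr0 => /le_trans; apply; rewrite ler_pM2l //.
  by apply: lerXn2r; rewrite ?nnegrE ?mulr_ge0 ?(ltW k0) ?(ltW z0).
move=> /existsNP ex; right.
have ex' : exists n, a n != 0 by case: ex => n /eqP; exists n.
have [n an nmin] := ex_minnP ex'.
have an0 i : (i < n)%N -> a i = 0.
  by move=> iln; apply/eqP; apply: contraTT iln => /nmin; rewrite -leqNgt.
have c0 : 0 < `|a n| / 2 by rewrite divr_gt0 ?normr_gt0.
have Ck : 0 < C * k ^+ n.+1 by rewrite mulr_gt0 ?exprn_gt0.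
exists n, (a n), (Num.min (1 / k) (`|a n| / 2 / (C * k ^+ n.+1))).
split=> //; first by rewrite lt_min !divr_gt0 ?normr_gt0.
move=> z /andP[z0]; rewrite le_min !ler_pdivlMr // => /andP[zk zc].
have kz : k * z <= 1 by rewrite mulrC.
have := hf z n.+1 z0 kz; rewrite horner_poly big_ord_recr /= big1 ?add0r => [|i _]; last first.
  by rewrite an0 ?mul0r.
move=> /le_trans; apply; rewrite exprMn [z ^+ n.+1]exprS.
have -> : C * (k ^+ n.+1 * (z * z ^+ n)) = (z * (C * k ^+ n.+1)) * z ^+ n by ring.
by rewrite ler_pM2r ?exprn_gt0 //; move: zc; lra.
Qed.

Lemma expands_id (k : R) : 0 < k -> expands k^-1 k (fun n => (n == 1%N)%:R) id.
Proof.
move=> k0; have k00 := lt0r_neq0 k0; split=> [[|[|n]]|u [|[|n]] u0 ku].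
- by rewrite normr0 mulr1 ltW // invr_gt0.
- by rewrite normr1 expr1 mulVf.
- by rewrite normr0 mulr_ge0 ?exprn_ge0 ?invr_ge0 // ltW.
- by rewrite poly_def big_ord0 horner0 subr0 gtr0_norm // mulr1 -(ler_pM2l k0) divff.
- by rewrite horner_poly big_ord1 mul0r subr0 gtr0_norm // expr1 mulKf.
- rewrite horner_poly big_ord_recl big_ord_recl /= big1 => [|i _]; last by rewrite mul0r.
  rewrite mul0r mul1r expr1 add0r addr0 subrr normr0.
  by rewrite mulr_ge0 ?exprn_ge0 ?invr_ge0 ?mulr_ge0 // ltW.
Qed.

(** The increments of w add up to at most D * y 0, whereas w tends to +oo along y. *)
Lemma no_blowup w y D : 0 <= D -> (forall A, exists2 z, 0 < z & forall x, 0 < x < z -> A < w x) ->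
  (forall n, 0 < y n) -> (forall d, 0 < d -> exists n, y n < d) ->
  (forall n, w (y n.+1) - w (y n) <= D * (y n - y n.+1)) -> False.
Proof.
move=> D0 hw y0 hy hD.
have bound n : w (y n) <= w (y 0%N) + D * (y 0%N - y n).
  elim: n => [|n IH]; first by rewrite subrr mulr0 addr0.
  by have := hD n; move: IH; rewrite !mulrBr; lra.
have [z z0 hz] := hw (w (y 0%N) + D * y 0%N); have [n nz] := hy z z0.
have := hz (y n); rewrite y0 nz => /(_ isT).
have := bound n; have := mulr_ge0 D0 (ltW (y0 n)); rewrite mulrBr; lra.
Qed.

(** Away from 0 the steps are bounded below, and there is room for finitely many. *)
Lemma steps_to_0 y : (forall e, 0 < e -> exists2 m, 0 < m &
    forall n, e <= y n -> e <= y n.+1 -> m <= y n - y n.+1) ->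
  forall e, 0 < e -> exists n, y n < e.
Proof.
move=> h e e0; apply: contrapT => /forallNP hn.
have he n : e <= y n by have /negP := hn n; rewrite -leNgt.
have [m m0 hm] := h e e0.
have lin n : y n <= y 0%N - m * n%:R.
  elim: n => [|n IH]; first by rewrite mulr0 subr0.
  by have := hm n (he _) (he _); rewrite -natr1 mulrDr mulr1; lra.
have y00 : 0 <= `|y 0%N| / m by rewrite divr_ge0 // ltW.
have := Num.Theory.archi_boundP y00; rewrite ltr_pdivrMr // => hb.
have := lin (Num.bound (`|y 0%N| / m)); have := he (Num.bound (`|y 0%N| / m)).
by have := ler_norm (y 0%N); rewrite [m * _]mulrC; lra.
Qed.

Section Iterates.
Variables (P : R -> R) (d : R).
Hypothesis cP : forall z, 0 < z <= d -> {for z, continuous P}.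

Let gap (sg : R) e : 0 < e -> (forall z, 0 < z <= d -> 0 < sg * (P z - z)) ->
  exists2 m, 0 < m & forall z, e <= z <= d -> m <= sg * (P z - z).
Proof.
move=> e0 h; have [ed|ed] := lerP e d; last first.
  by exists 1 => // z /andP[h1 /(le_trans h1)]; rewrite leNgt ed.
have pos z : e <= z <= d -> 0 < z <= d by move=> /andP[h1 ->]; rewrite (lt_le_trans e0).
apply: (@EVTpos R (fun z => sg * (P z - z))) => // z /pos zd; last exact: h.
apply: (@contM R (fun=> sg) (fun z => P z - z)); first exact: cont_cst.
by apply: (@contB R P id); [exact: cP | exact: cont_id].
Qed.

Lemma forward_iterates y : (forall z, 0 < z <= d -> 0 < P z < z) ->
  0 < y 0%N <= d -> (forall n, y n.+1 = P (y n)) ->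
  (forall n, 0 < y n <= d) /\ forall e, 0 < e -> exists n, y n < e.
Proof.
move=> hP y0 yS.
have hy n : 0 < y n <= d.
  elim: n => // n IH; have /andP[h1 h2] := hP _ IH; rewrite yS h1.
  by case/andP: IH => _; exact: le_trans (ltW h2).
split=> //; apply: steps_to_0 => e e0.
have [|m m0 hm] := @gap (-1) e e0; first by move=> z /hP/andP[]; lra.
exists m => // n en _; case/andP: (hy n) => _ yd.
by have := hm (y n); rewrite en yd yS => /(_ isT); lra.
Qed.

(** P (z / 2) < z < P z, so z has a preimage in its left neighborhood. *)
Lemma backward_iterates : 0 < d -> (forall z, 0 < z <= d -> z < P z) ->
  (forall z, 0 < z <= d -> P z <= 3 / 2 * z) ->
  exists y, [/\ forall n, 0 < y n <= d, forall n, P (y n.+1) = y n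
    & forall e, 0 < e -> exists n, y n < e].
Proof.
move=> d0 hP hP2.
have pre z : 0 < z <= d -> exists x, 0 < x <= d /\ P x = z.
  move=> /andP[z0 zd]; have hz : z / 2 <= z by lra.
  have [|| x /andP[x1 x2] e] := @IVTle R P (z / 2) z z hz.
  - by move=> x /andP[x1 x2]; apply: cP; apply/andP; split; lra.
  - have h1 : 0 < z / 2 <= d by apply/andP; split; lra.
    have h2 : 0 < z <= d by rewrite z0.
    by have := hP2 _ h1; have := hP _ h2; move=> *; apply/andP; split; lra.
  - by exists x; split=> //; apply/andP; split; lra.
have /choice[g hg] : forall z, exists x, 0 < z <= d -> 0 < x <= d /\ P x = z.
  move=> z; have [/pre[x hx]|nz] := pselect (0 < z <= d); first by exists x.
  by exists 0.
pose y n := iter n g d.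
have hy n : 0 < y n <= d.
  by elim: n => [|n IH]; [rewrite /y /= d0 lexx | exact: (hg _ IH).1].
exists y; split=> // [n|]; first exact: (hg _ (hy n)).2.
apply: steps_to_0 => e e0.
have [|m m0 hm] := @gap 1 e e0; first by move=> z /hP; lra.
exists m => // n _ en; case/andP: (hy n.+1) => _ yd.
have := hm (y n.+1); rewrite en yd => /(_ isT).
by have -> : P (y n.+1) = y n := (hg _ (hy n)).2; lra.
Qed.

End Iterates.
End ReturnMaps.

Section ReturnMap.
Variables (R : realType) (t : nat * nat) (k N : nat) (h mu : {poly {poly R}}).
Variables (Cs Sn : R -> R) (T : R).
Variables (e : R) (C S lam E : R -> R) (f : fvf R) (F : R * R -> R * R).
Hypothesis ht : is_type t.
Hypothesis hh : whomog t k h.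
Hypothesis hpar : parameterizes_level1 h Cs Sn T.
Hypothesis hmu : whomog t (wr t k + N) mu.
Hypothesis he : e = 1 \/ e = -1.
Hypothesis pf : polar_frame t h e C S lam E.
Hypothesis hF : has_taylor F f.
Hypothesis hf : qhhot t (k%:Z - (wt t)%:Z) f (Xh h).
Hypothesis hequiv : formally_orbital_equivalent f (fvf_of_poly (normal_form t h mu)).

Ltac drop_local_facts := clear - ht hh hpar hmu he pf hF hf hequiv.

(** The displacement P - id is analytic: it is 0 near 0, or it has the sign of c and
   exact order n. An impossible case is excluded by [no_blowup], applied to w along the
   iterates of P or along its backward iterates. *)
Lemma return_map : exists z0 (U : R -> R -> R), 0 < z0 <= 1 /\
  [/\ forall z s, 0 < z <= z0 -> `|s| < 6 * pi ->
        [/\ der (U z) s (polar_rhs t k h C S lam F s (U z s)),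
            `|U z s - z| <= z / 2 & {for z, continuous (U^~ s)}],
      forall z, 0 < z <= z0 -> U z 0 = z,
      forall (w : R -> R) s, {for s, continuous w} -> 0 < w s <= 2 * z0 ->
        {for s, continuous (fun s => slowness t k e C S lam F s (w s))} /\
        k%:R / 2 <= den t k C S F s (w s) <= 2 * k%:R,
      mean_speed mu Cs Sn T = 0 -> forall z, 0 < z <= z0 -> U z (2 * pi) = z
    & e * mean_speed mu Cs Sn T < 0 -> forall y : nat -> R, 0 < y 0%N <= z0 ->
        (forall n, y n.+1 = U (y n) (2 * pi)) ->
        (forall n, 0 < y n.+1 < y n) /\ forall d, 0 < d -> exists n, y n < d].
Proof.
have t1 := (level_t_gt0 ht hh hpar).1; have t2 := (level_t_gt0 ht hh hpar).2.
have hk := level_k_ge ht hh hpar.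
have p0 := @pi_gt0 R.
(* Three turns in both senses, so that successive arcs overlap when they are glued. *)
have L0 : 0 < 6 * pi :> R by rewrite mulr_gt0.
have [z1 [K [U [v [/andP[z10 z11] K0 hU [hU0 hUz] [hv [hden hcont]]]]]]] :=
  polar_flow t1 t2 hk hh pf hF hf L0.
set c0 := mean_speed mu Cs Sn T.
have s2pi : `|2 * pi : R| <= 6 * pi by rewrite gtr0_norm ?mulr_gt0 //; move: p0; drop_local_facts; lra.
have zi : 0 < z1^-1 by rewrite invr_gt0.
pose P z := U z (2 * pi).
have cU z s : 0 < z < z1 / 2 -> `|s| <= 6 * pi -> {for z, continuous (U^~ s)}.
  move=> /andP[zz zz1] hs.
  apply: (@expands_cont R K z1^-1 (fun n _ => v n s) (fun _ => U^~ s) id z K0 zi) => //.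
  - by move=> _; exact: hv.
  - by move=> n x; exact: cont_cst.
  - by rewrite mulrC ltr_pdivrMr // mulrC mulrA mulr1.
pose d0 := z1 / 4; have d00 : 0 < d0 by rewrite divr_gt0.
have cP z : 0 < z <= d0 -> {for z, continuous P}.
  by rewrite /d0 => /andP[a b]; apply: cU => //; apply/andP; split => //; lra.
have hP z : 0 < z <= d0 -> z / 2 <= P z <= 3 / 2 * z.
  rewrite /d0 => /andP[a b]; have : 0 < z <= z1 by rewrite a; move: b z10; drop_local_facts; lra.
  by move=> hz; have := hUz z _ hz s2pi; rewrite ler_norml /P => /andP[]; lra.
have P0 z : 0 < z <= d0 -> 0 < P z.
  by move=> hz; have /andP[+ _] := hP z hz; apply: lt_le_trans; case/andP: hz => ? _; rewrite divr_gt0.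
(* The comparison of the potential at both ends of one turn. *)
have compare n : exists w d D, [/\ 0 < d <= d0, 0 < D,
    forall A, exists2 z3, 0 < z3 & forall z, 0 < z < z3 -> A < w z
  & forall z, 0 < z <= d -> (c0 = 0 -> `|w (P z) - w z| <= D * z ^+ n) /\
      (c0 != 0 -> 0 < - (e * c0) * (w (P z) - w z))].
  have [w [d [D [/andP[dd d1] D0 hw hu]]]] :=
    spiral_comparison ht hh hpar hmu he pf hF hequiv n.
  have d20 : 0 < Num.min (d / 2) d0 by rewrite lt_min d00 divr_gt0.
  exists w, (Num.min (d / 2) d0), (D * (3 / 2) ^+ n).
  split=> //; first by rewrite d20 ge_min lexx orbT.
    by rewrite mulr_gt0 // exprn_gt0 // divr_gt0.
  move=> z /andP[zz]; rewrite le_min => /andP[zd zd0].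
  have zz1 : 0 < z <= z1 by rewrite zz; move: zd0 z10; rewrite /d0; drop_local_facts; lra.
  have Ub s : `|s| <= 6 * pi -> z / 2 <= U z s <= 3 / 2 * z.
    by move=> hs; have := hUz z s zz1 hs; rewrite ler_norml => /andP[]; drop_local_facts; lra.
  have [|s hs [h1 h2]] := hu (U z).
    move=> s hs; have sl : `|s| < 6 * pi.
      by have := @pi_ge2 R; rewrite ltr_norml; case/andP: hs => *; apply/andP; split; lra.
    have du := hU z s zz1 sl; have /andP[u1 u2] := Ub s (ltW sl).
    have U0 : 0 < U z s by apply: lt_le_trans u1; rewrite divr_gt0.
    have U2 : 0 < U z s <= 2 * z1.
      by rewrite U0; case/andP: zz1 => _ h1; move: h1 u2 zz; drop_local_facts; lra.
    have [q1 q2 q3] := hcont (U z) s (der_cont du) U2.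
    split=> //; [|exact: hden].
    by rewrite U0; move: u2 zd zz; drop_local_facts; lra.
  rewrite (hU0 z zz1) -/(P z) in h1 h2; split=> // /h1 hb; apply: le_trans hb _.
  have sl : `|s| <= 6 * pi.
    by rewrite ler_norml; case/andP: hs => *; apply/andP; split; move: p0; lra.
  have /andP[u1 u2] := Ub s sl; rewrite -mulrA -exprMn ler_pM2l //.
  apply: lerXn2r => //; rewrite nnegrE; last by rewrite mulr_ge0 // ltW.
  by apply: le_trans u1; rewrite divr_ge0 // ltW.
suff [z0 /andP[z00 z0d] [H4 H5]] : exists2 z0, 0 < z0 <= d0 &
    (c0 = 0 -> forall z, 0 < z <= z0 -> P z = z) /\
    (e * c0 < 0 -> forall z, 0 < z <= z0 -> P z < z).
  have z0z1 z : 0 < z <= z0 -> 0 < z <= z1 /\ 0 < z < z1 / 2.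
    move=> /andP[zz zz0]; rewrite zz /=.
    by move: zz0 z0d z10; rewrite /d0; drop_local_facts; split; lra.
  exists z0, U; split; first by rewrite z00 (le_trans z0d) // /d0; move: z11 z10; drop_local_facts; lra.
  split=> //.
  - move=> z s /z0z1[h1 h2] hs; split; [exact: hU | apply: hUz => //; exact: ltW |].
    by apply: cU => //; exact: ltW.
  - by move=> z /z0z1[h1 _]; exact: hU0.
  - move=> w s cw /andP[w0 wz]; have wz1 : 0 < w s <= 2 * z1.
      by rewrite w0; move: wz z0d z10; rewrite /d0; drop_local_facts; lra.
    by split; [have [] := hcont w s cw wz1 | exact: hden].
  - move=> ec y y0 yS.
    have PP z : 0 < z <= z0 -> 0 < P z < z.
      move=> hz; rewrite (H5 ec) // andbT; apply: P0.
      by case/andP: hz => -> h1; exact: le_trans z0d.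
    have cP' z : 0 < z <= z0 -> {for z, continuous P}.
      by move=> /andP[h1 h2]; apply: cP; rewrite h1 (le_trans h2).
    have [hy ?] := forward_iterates cP' PP y0 yS.
    by split=> // n; rewrite [y n.+1]yS; exact: PP.
(* Neither sense of motion is compatible with an unbounded w whose increments
   are controlled by those of the iterates. *)
have no_forward w d D : 0 < d <= d0 -> 0 <= D ->
    (forall A, exists2 z3, 0 < z3 & forall z, 0 < z < z3 -> A < w z) ->
    (forall z, 0 < z <= d -> P z < z /\ w (P z) - w z <= D * (z - P z)) -> False.
  move=> /andP[dd dd0] D0 hw hz.
  have sub z : 0 < z <= d -> 0 < z <= d0 by case/andP=> -> h1; exact: le_trans dd0.
  have [||hy y0] := @forward_iterates R P d (fun z zd => cP z (sub z zd)) (fun n => iter n P d) _ _ (fun=> erefl).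
  - by move=> z zd; rewrite (P0 _ (sub z zd)) (hz z zd).1.
  - by rewrite /= dd lexx.
  apply: (no_blowup D0 hw _ y0) => n; first by case/andP: (hy n).
  exact: (hz _ (hy n)).2.
have no_backward w d D : 0 < d <= d0 -> 0 <= D ->
    (forall A, exists2 z3, 0 < z3 & forall z, 0 < z < z3 -> A < w z) ->
    (forall z, 0 < z <= d -> z < P z /\ w z - w (P z) <= D * (P z - z)) -> False.
  move=> /andP[dd dd0] D0 hw hz.
  have sub z : 0 < z <= d -> 0 < z <= d0 by case/andP=> -> h1; exact: le_trans dd0.
  have [||y [hy yS y0]] := @backward_iterates R P d (fun z zd => cP z (sub z zd)) dd.
  - by move=> z zd; exact: (hz z zd).1.
  - by move=> z zd; have /andP[] := hP z (sub z zd).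
  apply: (no_blowup D0 hw _ y0) => n; first by case/andP: (hy n).
  by have := (hz _ (hy n.+1)).2; rewrite yS.
(* The displacement P - id is analytic, so that it vanishes or has a sign. *)
have [K1 K10 hD] : exists2 K1, 0 < K1 &
    expands K1 z1^-1 (fun n => 1 * v n (2 * pi) + (-1) * (n == 1%N)%:R)
      (fun z => 1 * P z + (-1) * z).
  exists (2 * 1 * (K + z1)); first by rewrite !mulr_gt0 // addr_gt0.
  have KK : 0 <= K + z1 by rewrite addr_ge0 // ltW.
  apply: (@expands_lin R (K + z1) z1^-1 _ (fun n => v n (2 * pi)) (fun n => (n == 1%N)%:R)
    _ P id 1 (-1) 1 KK (ltW zi)) => //; rewrite ?normrN ?normr1 //.
    apply: (@expands_weak R K z1^-1) (hv _ s2pi) => //; rewrite ?(ltW K0) ?(ltW zi) //.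
    by rewrite lerDl ltW.
  have := expands_id zi; rewrite invrK => hid.
  apply: (@expands_weak R z1 z1^-1) hid => //; rewrite ?(ltW z10) ?(ltW zi) //.
  by rewrite lerDr ltW.
have [d1 d10 [hd1|[n [c [cn0 hd1]]]]] : exists2 d1, 0 < d1 <= d0 &
    (forall z, 0 < z <= d1 -> P z = z) \/ exists n c, c != 0 /\
    forall z, 0 < z <= d1 -> `|P z - z - c * z ^+ n| <= `|c| / 2 * z ^+ n.
  have [[d d0' hd]|[n [c [d [cn d0' hd]]]]] := expands_isolated K10 zi hD;
  (exists (Num.min d d0); first by rewrite lt_min d0' d00 ge_min lexx orbT).
    left=> z /andP[zz]; rewrite le_min => /andP[zd _].
    by have := hd z; rewrite zz zd => /(_ isT); lra.
  right; exists n, c; split=> // z /andP[zz]; rewrite le_min => /andP[zd _].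
  by have := hd z; rewrite zz zd mul1r mulN1r => /(_ isT).
- exists d1 => //; split=> // ec; exfalso.
  have [w [d [D [/andP[dd _] _ _ hw]]]] := compare 0%N.
  have c00 : c0 != 0 by apply: contraTneq ec => ->; rewrite mulr0 ltxx.
  have dm : 0 < Num.min d d1 by rewrite lt_min dd; case/andP: d10.
  have := hd1 (Num.min d d1); rewrite dm ge_min lexx orbT => /(_ isT) Pm.
  have := hw (Num.min d d1); rewrite dm ge_min lexx => /(_ isT)[_ /(_ c00)].
  by rewrite Pm subrr mulr0 ltxx.
- have nc : 0 < `|c| by rewrite normr_gt0.
  have move_ z : 0 < z <= d1 -> (c < 0 -> P z < z) /\ (0 < c -> z < P z) /\
      z ^+ n <= 2 / `|c| * `|P z - z|.
    move=> hz; have zn : 0 < z ^+ n by rewrite exprn_gt0 //; case/andP: hz.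
    have := hd1 z hz; rewrite ler_norml => /andP[l1 l2].
    have cz : 0 < `|c| * z ^+ n by rewrite mulr_gt0.
    split; first by move=> c1; move: l1 l2 cz; rewrite ltr0_norm //; drop_local_facts; nra.
    split; first by move=> c1; move: l1 l2 cz; rewrite gtr0_norm //; drop_local_facts; nra.
    rewrite mulrAC ler_pdivlMr //.
    have : `|c * z ^+ n| <= `|P z - z| + `|c| / 2 * z ^+ n.
      have -> : c * z ^+ n = (P z - z) - (P z - z - c * z ^+ n) by ring.
      by apply: le_trans (ler_normB _ _) _; apply: lerD; [exact: lexx | exact: hd1].
    by rewrite normrM (gtr0_norm zn); drop_local_facts; lra.
  have sub d z : 0 < z <= Num.min d d1 -> 0 < z <= d /\ 0 < z <= d1.
    by move=> /andP[-> ]; rewrite le_min => /andP[-> ->].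
  have minP d : 0 < d -> 0 < Num.min d d1 <= d0.
    by move=> dd; case/andP: d10 => q1 q2; rewrite lt_min dd q1 ge_min q2 orbT.
  exists d1 => //; split=> [c00|ec].
  + exfalso; have [w [d [D [/andP[dd _] D0 hw hD1]]]] := compare n.
    have DD : 0 <= D * (2 / `|c|) by rewrite mulr_ge0 ?divr_ge0 // ltW.
    have incr z : 0 < z <= Num.min d d1 -> `|w (P z) - w z| <= D * (2 / `|c|) * `|P z - z|.
      move=> /sub[q1 q2]; apply: le_trans ((hD1 z q1).1 c00) _.
      by rewrite -mulrA ler_pM2l //; exact: (move_ z q2).2.2.
    have [cn|cn|cn0'] := ltgtP c 0; last by rewrite cn0' eqxx in cn0.
    * apply: (no_forward w (Num.min d d1) _ (minP _ dd) DD hw) => z hz.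
      have Pz := (move_ z (sub d z hz).2).1 cn; split=> //.
      apply: le_trans (ler_norm _) _; have := incr z hz.
      by rewrite [`|P z - z|]distrC [`|z - P z|]gtr0_norm // subr_gt0.
    * apply: (no_backward w (Num.min d d1) _ (minP _ dd) DD hw) => z hz.
      have Pz := (move_ z (sub d z hz).2).2.1 cn; split=> //.
      apply: le_trans (ler_norm _) _; rewrite distrC; have := incr z hz.
      by rewrite [`|P z - z|]gtr0_norm // subr_gt0.
  + have c00 : c0 != 0 by apply: contraTneq ec => ->; rewrite mulr0 ltxx.
    have [w [d [D [/andP[dd _] D0 hw hD1]]]] := compare 0%N.
    have [cn|cn|cn0'] := ltgtP c 0; last by rewrite cn0' eqxx in cn0.
      by move=> z hz; exact: (move_ z hz).1.
    exfalso; apply: (no_backward w (Num.min d d1) 0 (minP _ dd) (lexx 0) hw) => z hz.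
    have [q1 q2] := sub d z hz; split; first exact: (move_ z q2).2.1.
    have := (hD1 z q1).2 c00; rewrite pmulr_rgt0 ?oppr_gt0 // mul0r subr_gt0.
    by rewrite subr_le0 => /ltW.
Qed.
End ReturnMap.

(** * Concatenation of turns and polar angles *)

Section Turns.
Variable R : realType.
Implicit Types (P s : R) (U : R -> R -> R) (y : nat -> R) (g : R -> R -> R).

(** The arc U (y n) is followed during the n-th turn; the first arc also serves to the
   left of 0, where truncn is 0. *)
Definition chain P U y (s : R) : R :=
  U (y (Num.truncn (s / P))) (s - (Num.truncn (s / P))%:R * P).

Lemma chainE P U y n s : 0 < P -> n%:R * P <= s < n.+1%:R * P ->
  chain P U y s = U (y n) (s - n%:R * P).
Proof.
move=> P0 hs; rewrite /chain (@truncn_def R _ n) //.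
by rewrite ler_pdivlMr // ltr_pdivrMr.
Qed.

Lemma chain_itv P s : 0 < P -> 0 <= s ->
  (Num.truncn (s / P))%:R * P <= s < (Num.truncn (s / P)).+1%:R * P.
Proof.
move=> P0 s0; have := @truncn_itv R (s / P) (divr_ge0 s0 (ltW P0)).
by rewrite ler_pdivlMr // ltr_pdivrMr.
Qed.

Lemma chain0 P U y s : 0 < P -> s < P -> chain P U y s = U (y 0%N) s.
Proof.
move=> P0 sP; have [s0|s0] := lerP 0 s.
  by rewrite (@chainE _ _ _ 0) // ?mul0r ?subr0 ?mul1r ?s0.
rewrite /chain; have /eqP -> : Num.truncn (s / P) == 0%N.
  by rewrite -leqn0 leqNgt truncn_gt_nat ler_pdivlMr // mul1r -ltNge.
by rewrite mul0r subr0.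
Qed.

Lemma der_chain P g U y : 0 < P -> (forall s u, g (s + P) u = g s u) ->
  (forall n s, - (2 * P) < s < 3 * P -> der (U (y n)) s (g s (U (y n) s))) ->
  (forall n, U (y n) 0 = y n) -> (forall n, U (y n) P = y n.+1) ->
  forall s, - (2 * P) < s -> der (chain P U y) s (g s (chain P U y s)).
Proof.
move=> P0 gP hU hU0 hUP.
have gn n s u : g (s - n%:R * P) u = g s u.
  elim: n s => [|n IH] s; first by rewrite mul0r subr0.
  by rewrite -natr1 mulrDl mul1r opprD addrA -gP addrNK.
have piece n s : - (2 * P) < s - n%:R * P < 3 * P ->
    der (fun x => U (y n) (x - n%:R * P)) s (g s (U (y n) (s - n%:R * P))).
  move=> hs; rewrite -(gn n s).
  apply: der_eq (@der_comp R (U (y n)) (fun x => x - n%:R * P) s _ 1 (hU n _ hs) _) _; last first.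
    by rewrite mulr1.
  by rewrite -[1]subr0; apply: der_B; [exact: der_id | exact: der_cst].
move=> s sP; have [s1|s1] := ltrP s P.
  apply: (@der_local R (U (y 0%N)) _ _ _ (P - s)); first by rewrite subr_gt0.
    move=> x hx; rewrite chain0 //; have := ler_norm (x - s); move: hx; lra.
  by rewrite chain0 //; apply: hU; rewrite sP /=; lra.
have s0 : 0 <= s by apply: le_trans s1; exact: ltW.
have /andP[n1 n2] := chain_itv P0 s0.
set n := Num.truncn (s / P) in n1 n2.
have hn : chain P U y s = U (y n) (s - n%:R * P) by [].
have inn : - (2 * P) < s - n%:R * P < 3 * P.
  by move: n2; rewrite -natr1 mulrDl mul1r => n2; apply/andP; split; lra.
have := n1; rewrite le_eqVlt => /orP[/eqP ns|ns]; last first.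
  apply: (@der_local R (fun x => U (y n) (x - n%:R * P)) _ _ _ (Num.min (s - n%:R * P) (n.+1%:R * P - s))).
  - by rewrite lt_min !subr_gt0 ns n2.
  - move=> x; rewrite lt_min => /andP[]; rewrite !ltr_norml => /andP[a1 a2] /andP[a3 a4].
    by rewrite (@chainE _ _ _ n) //; apply/andP; split; lra.
  - by rewrite hn; exact: piece.
case: n => [|m] in n1 n2 hn inn ns; first by move: s1 P0; rewrite -ns mul0r; lra.
have msP : m.+1%:R * P = m%:R * P + P by rewrite -natr1 mulrDl mul1r.
have nsP : m.+2%:R * P = m%:R * P + P + P by rewrite -natr1 mulrDl mul1r msP.
have sE : chain P U y s = y m.+1 by rewrite hn -ns subrr hU0.
apply: (@der_local R (fun x => if x <= s then U (y m) (x - m%:R * P)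
                              else U (y m.+1) (x - m.+1%:R * P)) _ _ _ P P0).
  move=> x; rewrite ltr_norml => /andP[a1 a2].
  have [xs|xs] := lerP x s; last by rewrite (@chainE _ _ _ m.+1) //; apply/andP; split; lra.
  move: xs; rewrite le_eqVlt => /orP[/eqP ->|xs]; last first.
    by rewrite (@chainE _ _ _ m) //; apply/andP; split; lra.
  by rewrite sE -ns msP addrAC subrr add0r hUP.
apply: (@der_glue R _ (fun x => U (y m) (x - m%:R * P)) (fun x => U (y m.+1) (x - m.+1%:R * P)) s).
- by move=> x ->.
- move=> x sx; case: lerP => // xs; have -> : x = s by apply/le_anti; rewrite xs sx.
  by rewrite -ns subrr hU0 msP addrAC subrr add0r hUP.
- have := piece m s; rewrite sE -ns msP addrAC subrr add0r hUP; apply.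
  by apply/andP; split; lra.
- by have := piece m.+1 s inn; rewrite -hn.
Qed.

(** The argument of (a cos s, b sin s) relative to (cos s, sin s): their scalar product
   is the denominator, which is positive, and their determinant is the numerator. *)
Definition angle_shift (a b s : R) : R :=
  atan ((b - a) * sin s * cos s / (a * cos s ^+ 2 + b * sin s ^+ 2)).

Lemma angle_shift_den a b s : 0 < a -> 0 < b -> 0 < a * cos s ^+ 2 + b * sin s ^+ 2.
Proof.
move=> a0 b0; have cs := cos2Dsin2 s.
have [m m0 [ma mb]] : exists2 m, 0 < m & m <= a /\ m <= b.
  by exists (Num.min a b); rewrite ?lt_min ?a0 // !ge_min !lexx orbT.
apply: (@lt_le_trans _ _ m) => //; rewrite -[m]mulr1 -cs mulrDr.
by apply: lerD; apply: ler_wpM2r; rewrite ?sqr_ge0.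
Qed.

Lemma angle_shiftP a b s : 0 < a -> 0 < b -> exists2 rho, 0 < rho &
  a * cos s = rho * cos (s + angle_shift a b s) /\
  b * sin s = rho * sin (s + angle_shift a b s).
Proof.
move=> a0 b0; have d0 := angle_shift_den s a0 b0.
set q := angle_shift a b s; set d := a * _ + _ in d0.
have cq : 0 < cos q by apply: cos_gt0_pihalf; rewrite atan_gtNpi2 atan_ltpi2.
have cq0 := lt0r_neq0 cq; have dn := lt0r_neq0 d0.
have tq : sin q = (b - a) * sin s * cos s / d * cos q.
  have := atanK ((b - a) * sin s * cos s / d); rewrite -/q /tan => <-.
  by rewrite divfK.
have cs := cos2Dsin2 s.
exists (d / cos q); first exact: divr_gt0.
rewrite cosD sinD tq; split.
- have -> : d / cos q * (cos s * cos q - sin s * ((b - a) * sin s * cos s / d * cos q)) =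
    cos s * (d - (b - a) * sin s ^+ 2) by field; rewrite cq0 dn.
  have -> : d - (b - a) * sin s ^+ 2 = a * (cos s ^+ 2 + sin s ^+ 2) by rewrite /d; ring.
  by rewrite cs mulr1 mulrC.
- have -> : d / cos q * (sin s * cos q + cos s * ((b - a) * sin s * cos s / d * cos q)) =
    sin s * (d + (b - a) * cos s ^+ 2) by field; rewrite cq0 dn.
  have -> : d + (b - a) * cos s ^+ 2 = b * (cos s ^+ 2 + sin s ^+ 2) by rewrite /d; ring.
  by rewrite cs mulr1 mulrC.
Qed.

Lemma angle_shift_bound a b s : `|angle_shift a b s| < pi / 2.
Proof. by rewrite ltr_norml atan_gtNpi2 atan_ltpi2. Qed.

Lemma angle_shift_cont (a b c : R -> R) s : 0 < a s -> 0 < b s ->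
  {for s, continuous a} -> {for s, continuous b} -> {for s, continuous c} ->
  {for s, continuous (fun s => angle_shift (a s) (b s) (c s))}.
Proof.
move=> a0 b0 ca cb cc.
have ccos : {for s, continuous (fun s => cos (c s))}.
  by apply: cont_comp cc _; exact: continuous_cos.
have csin : {for s, continuous (fun s => sin (c s))}.
  by apply: cont_comp cc _; exact: continuous_sin.
apply: (@cont_comp R (@atan R) (fun s => (b s - a s) * sin (c s) * cos (c s) /
   (a s * cos (c s) ^+ 2 + b s * sin (c s) ^+ 2))); last exact: continuous_atan.
apply: (@contM R (fun s => (b s - a s) * sin (c s) * cos (c s))
  (fun s => (a s * cos (c s) ^+ 2 + b s * sin (c s) ^+ 2)^-1)).
  apply: (@contM R (fun s => (b s - a s) * sin (c s)) (fun s => cos (c s))) => //.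
  by apply: (@contM R (fun s => b s - a s) (fun s => sin (c s))) => //; exact: contB.
apply: (@contV R (fun s => a s * cos (c s) ^+ 2 + b s * sin (c s) ^+ 2)).
  by rewrite lt0r_neq0 // angle_shift_den.
apply: (@contD R (fun s => a s * cos (c s) ^+ 2) (fun s => b s * sin (c s) ^+ 2)).
  by apply: (@contM R a (fun s => cos (c s) ^+ 2)) => //; exact: contX.
by apply: (@contM R b (fun s => sin (c s) ^+ 2)) => //; exact: contX.
Qed.
End Turns.

(** * Orbits around the origin *)

Section Orbits.
Variables (R : realType) (t : nat * nat) (k : nat) (h : {poly {poly R}}).
Variables (e : R) (C S lam E : R -> R) (F : R * R -> R * R).
Hypothesis t1 : (0 < t.1)%N.
Hypothesis t2 : (0 < t.2)%N.
Hypothesis hk : (t.1 + t.2 <= k)%N.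
Hypothesis hh : whomog t k h.
Hypothesis he : e = 1 \/ e = -1.
Hypothesis pf : polar_frame t h e C S lam E.

Let k0 : (0 < k)%N.
Proof. by apply: leq_trans hk; rewrite addn_gt0 t1. Qed.

Lemma speed_lower : exists2 l, 0 < l & forall s, l <= e * lam s.
Proof.
have p0 : 0 < 2 * pi :> R by rewrite mulr_gt0 // pi_gt0.
have [|l l0 hl] := @EVTpos R (fun s => e * lam s) 0 (2 * pi) (ltW p0) _ (fun s _ => pf_lam0 pf s).
  by move=> s _; apply: (@contM R (fun=> e) lam); [exact: cont_cst | exact: (pf_lam pf)].
exists l => // s; have [m m1 m2] := mod_period s p0.
rewrite -(subrK (m%:~R * (2 * pi)) s) (@periodic_int R lam (2 * pi) m); last exact: (pf_perl pf).
by apply: hl; rewrite m1 ltW.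
Qed.

(** The time is the primitive of the slowness, which is bounded below since u is bounded
   above: the inverse of the time gives the angle at each date. *)
Lemma orbit_time (v : R -> R) (s0 M : R) : 0 <= s0 ->
  (forall s, -1 < s -> [/\ der v s (polar_rhs t k h C S lam F s (v s)), 0 < v s <= M,
     {for s, continuous (fun s => slowness t k e C S lam F s (v s))}
   & k%:R / 2 <= den t k C S F s (v s) <= 2 * k%:R]) ->
  exists psi : R -> R, [/\ psi 0 = s0, {homo psi : x y / x < y},
    forall A, exists x, psi x = A, continuous psi
  & forall x, 0 <= x ->
    der (fun x => (polar_pt t C S (v (psi x)) (psi x)).1) x (e * (F (polar_pt t C S (v (psi x)) (psi x))).1) /\
    der (fun x => (polar_pt t C S (v (psi x)) (psi x)).2) x (e * (F (polar_pt t C S (v (psi x)) (psi x))).2)].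
Proof.
move=> s00 hv.
pose kap s := slowness t k e C S lam F s (v s).
pose cl (s : R) := Num.max s (- (1 / 2)).
have clP s : -1 < cl s by rewrite lt_max; apply/orP; right; lra.
have ccl : continuous cl.
  move=> s; apply/contP => d d0; exists d => // y hy; apply: le_lt_trans hy.
  rewrite /cl; case: (lerP s (- (1 / 2))) => a1; case: (lerP y (- (1 / 2))) => a2;
  rewrite ?subrr ?normr0 // ler_norml;
  have := ler_norm (y - s); have := ler_norm (- (y - s)); rewrite normrN => n1 n2;
  apply/andP; split; lra.
have [l l0 hl] := speed_lower.
have kR : 0 < k%:R :> R by rewrite ltr0n.
have dpos s : -1 < s -> 0 < den t k C S F s (v s).
  by move=> /hv[_ _ _ /andP[a _]]; apply: lt_le_trans a; rewrite divr_gt0.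
have M0 : 0 < M.
  by have [|_ /andP[a b] _ _] := hv 0; [lra | exact: lt_le_trans b].
have kaplow s : -1 < s -> l * k%:R / (M ^+ wr t k * (2 * k%:R)) <= kap s.
  move=> hs; have [_ /andP[v0 vM] _ /andP[d1 d2]] := hv s hs; have d0 := dpos s hs.
  have vr : 0 < v s ^+ wr t k by rewrite exprn_gt0.
  have Mr : 0 < M ^+ wr t k by rewrite exprn_gt0.
  rewrite /kap /slowness; apply: ler_pM.
  - by rewrite mulr_ge0 // ltW.
  - by rewrite invr_ge0 mulr_ge0 // ?mulr_ge0 // ltW.
  - by rewrite ler_pM2r.
  - rewrite lef_pV2 ?posrE; last 2 first.
    + by apply: mulr_gt0 => //; exact: mulr_gt0.
    + exact: mulr_gt0.
    apply: ler_pM => //; [exact: ltW | exact: ltW |].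
    by apply: lerXn2r => //; rewrite nnegrE ltW.
have kl0 : 0 < l * k%:R / (M ^+ wr t k * (2 * k%:R)).
  apply: divr_gt0; first exact: mulr_gt0.
  by apply: mulr_gt0; [exact: exprn_gt0 | exact: mulr_gt0].
have ckap : continuous (fun s => kap (cl s)).
  by move=> s; apply: (@cont_comp R kap cl); [exact: ccl | have [] := hv (cl s) (clP s)].
have [tau tau0 dtau] := primitive ckap.
have [psi [tpsi psit hpsi dpsi]] := increasing_inverse kl0 (fun s => kaplow _ (clP s)) dtau.
have psi0 : psi (0 + tau s0) = s0 by rewrite add0r.
have ge x : 0 <= x -> s0 <= psi (x + tau s0).
  rewrite le_eqVlt => /orP[/eqP <-|x0]; first by rewrite psi0.
  by rewrite -[X in X <= _]psi0 ltW //; apply: hpsi; rewrite ltrD2r.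
have dpsi' x : der (fun x => psi (x + tau s0)) x (kap (cl (psi (x + tau s0))))^-1.
  apply: der_eq (@der_comp R psi (fun x => x + tau s0) x _ (1 + 0) (dpsi _) _) _.
    by apply: der_D; [exact: der_id | exact: der_cst].
  by rewrite addr0 mulr1.
exists (fun x => psi (x + tau s0)); split=> //.
- by move=> x y xy; apply: hpsi; rewrite ltrD2r.
- by move=> A; exists (tau A - tau s0); rewrite subrK psit.
- by move=> x; exact: der_cont (dpsi' x).
- move=> x x0; set s := psi (x + tau s0).
  have ss : s0 <= s by exact: ge.
  have s1 : -1 < s by lra.
  have cs : cl s = s by rewrite /cl max_l //; lra.
  have dp := dpsi' x; rewrite -/s cs in dp.
  have [a1 /andP[a2 _] _ _] := hv s s1; have d0 := dpos s s1.
  have k1 : kap s != 0 by rewrite gt_eqF // (lt_le_trans kl0) // kaplow.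
  have [ox oy] := orbit_der t1 t2 hk hh he pf a1 a2 (lt0r_neq0 d0).
  split.
  + apply: der_eq (@der_comp R (fun s => v s ^+ t.1 * C s) (fun x => psi (x + tau s0)) x _ _ ox dp) _.
    by rewrite -/(kap s); field.
  + apply: der_eq (@der_comp R (fun s => v s ^+ t.2 * S s) (fun x => psi (x + tau s0)) x _ _ oy dp) _.
    by rewrite -/(kap s); field.
Qed.

(** At p = (u^t1 C, u^t2 S) one has u^k = h(p), and h is Lipschitz near 0. *)
Lemma start_point (d : R) : 0 < d -> exists2 delta, 0 < delta &
  forall p : R * R, 0 < `|p| < delta -> exists u s,
    [/\ 0 < u < d, 0 <= s <= 2 * pi & p = polar_pt t C S u s].
Proof.
move=> d0; have [L L0 hL] := ev_lipschitz h 1.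
have dk : 0 < d ^+ k by rewrite exprn_gt0.
have L1 : 0 < 2 * L + 1 by rewrite ltr_wpDl // mulr_ge0.
exists (Num.min 1 (d ^+ k / (2 * L + 1))); first by rewrite lt_min ltr01 divr_gt0.
move=> [x y] /andP[p0]; rewrite lt_min => /andP[p1].
rewrite ltr_pdivlMr // => pd.
have xy : (x, y) != (0, 0) by rewrite -normr_gt0.
have [x1 y1] : `|x| <= `|(x, y)| /\ `|y| <= `|(x, y)|.
  by rewrite prod_normE /= !le_max !lexx orbT.
have [u [s [u0 hs ex ey]]] := pf_surj pf xy.
exists u, s; split=> //; last by rewrite /polar_pt -ex -ey.
rewrite u0 ltNge; apply/negP => du.
have z1 : `|0 : R| <= 1 by rewrite normr0.
have := hL _ _ _ _ (ltW (le_lt_trans x1 p1)) (ltW (le_lt_trans y1 p1)) z1 z1.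
rewrite (_ : h.[0, 0] = 0); last first.
  by have := whomog_ev 0 0 0 hh; rewrite !mulr0 => ->; rewrite expr0n gtn_eqF // mul0r.
rewrite !subr0 => hxy.
have hp : h.[x, y] = u ^+ k by rewrite ex ey (whomog_ev _ _ _ hh) (pf_level pf) mulr1.
have : d ^+ k <= u ^+ k by apply: lerXn2r; rewrite ?nnegrE // ltW.
rewrite -hp; have := ler_norm h.[x, y].
have : L * (`|x| + `|y|) <= L * (2 * `|(x, y)|) by apply: ler_wpM2l => //; lra.
lra.
Qed.

(** E^k is the inverse of h at (cos, sin), which is periodic. *)
Lemma frame_turn s : [/\ cos (e * (s + 2 * pi)) = cos (e * s),
  sin (e * (s + 2 * pi)) = sin (e * s) & E (s + 2 * pi) = E s].
Proof.
have [c1 s1] : cos (e * (s + 2 * pi)) = cos (e * s) /\ sin (e * (s + 2 * pi)) = sin (e * s).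
  case: he => ->; first by rewrite !mul1r mulr_natl cosD2pi sinD2pi.
  by rewrite !mulN1r !cosN !sinN mulr_natl cosD2pi sinD2pi.
split=> //.
have lev x : E x ^+ k * h.[cos (e * x), sin (e * x)] = 1.
  by rewrite -(whomog_ev _ _ _ hh) -(pf_polC pf) -(pf_polS pf) (pf_level pf).
have := lev (s + 2 * pi); rewrite c1 s1 -(lev s) => /mulIf ee.
have hn : h.[cos (e * s), sin (e * s)] != 0.
  by apply: contraTneq (oner_neq0 R) => h0; rewrite -(lev s) h0 mulr0 eqxx.
by apply: (pexpIrn k0); rewrite ?nnegrE ?(ltW (pf_E pf _)) //; exact: ee.
Qed.

End Orbits.

Section SpiralOrbits.
Variables (R : realType) (t : nat * nat) (k : nat) (h : {poly {poly R}}).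
Variables (e : R) (C S lam E : R -> R) (F : R * R -> R * R).
Hypothesis t1 : (0 < t.1)%N.
Hypothesis t2 : (0 < t.2)%N.
Hypothesis hk : (t.1 + t.2 <= k)%N.
Hypothesis hh : whomog t k h.
Hypothesis he : e = 1 \/ e = -1.
Hypothesis pf : polar_frame t h e C S lam E.

Variables (z0 : R) (U : R -> R -> R).
Hypothesis z01 : 0 < z0 <= 1.
Hypothesis hU : forall z s, 0 < z <= z0 -> `|s| < 6 * pi ->
  [/\ der (U z) s (polar_rhs t k h C S lam F s (U z s)),
      `|U z s - z| <= z / 2 & {for z, continuous (U^~ s)}].
Hypothesis hU0 : forall z, 0 < z <= z0 -> U z 0 = z.
Hypothesis hcont : forall (w : R -> R) s, {for s, continuous w} -> 0 < w s <= 2 * z0 ->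
  {for s, continuous (fun s => slowness t k e C S lam F s (w s))} /\
  k%:R / 2 <= den t k C S F s (w s) <= 2 * k%:R.
Hypothesis hret : forall z, 0 < z <= z0 -> U z (2 * pi) <= z.

Let P : R := 2 * pi.
Let P0 : 0 < P.
Proof. by rewrite mulr_gt0 // pi_gt0. Qed.

(** The successive radii of an orbit on the section of angle 0. *)
Definition returns z n := iter n (U^~ (2 * pi)) z.

Let v z := chain P U (returns z).
Definition orbit z (psi : R -> R) (x : R) := polar_pt t C S (v z (psi x)) (psi x).
(** The frame has angle e s, but its two coordinates are scaled by different powers. *)
Definition orbit_angle z (psi : R -> R) (x : R) := e * psi x +
  angle_shift ((v z (psi x) * E (psi x)) ^+ t.1) ((v z (psi x) * E (psi x)) ^+ t.2) (e * psi x).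

Lemma U_bounds z s : 0 < z <= z0 -> `|s| < 6 * pi -> z / 2 <= U z s <= 3 / 2 * z.
Proof. by move=> /hU h1 /h1[_]; rewrite ler_norml => /andP[]; lra. Qed.

Lemma returns_bounds z n : 0 < z <= z0 ->
  0 < returns z n <= z0 /\ returns z n.+1 <= returns z n.
Proof.
move=> hz; have p0 := @pi_gt0 R.
suff hn : 0 < returns z n <= z0 by split=> //; exact: hret.
elim: n => // n IH; have /andP[i1 i2] := IH; have h1 := hret IH.
have : `|2 * pi : R| < 6 * pi by rewrite gtr0_norm ?mulr_gt0 //; lra.
move=> /(U_bounds IH)/andP[h2 _]; apply/andP; split; last exact: le_trans h1 i2.
by apply: lt_le_trans h2; rewrite divr_gt0.
Qed.

Lemma returns_le z m n : 0 < z <= z0 -> (m <= n)%N -> returns z n <= returns z m.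
Proof.
move=> hz; elim: n => [|n IH]; first by rewrite leqn0 => /eqP ->.
rewrite leq_eqVlt => /orP[/eqP -> //|]; rewrite ltnS => /IH.
exact: le_trans (returns_bounds n hz).2.
Qed.

Lemma chain_bounds z s n : 0 < z <= z0 -> - (2 * P) < s -> (n == 0%N) || (n%:R * P <= s) ->
  0 < v z s <= 3 / 2 * returns z n.
Proof.
move=> hz sP hs; rewrite /v.
have p0 := @pi_gt0 R; have PE : P = 2 * pi by [].
have [s0|s0] := ltrP s 0.
  rewrite chain0 //; last exact: lt_trans P0.
  have -> : n = 0%N.
    case/orP: hs => [/eqP //|hs]; have h0 : 0 <= n%:R * P by rewrite mulr_ge0 // ltW.
    by have := le_lt_trans (le_trans h0 hs) s0; rewrite ltxx.
  have : `|s| < 6 * pi by rewrite ltr_norml; apply/andP; split; lra.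
  by move=> /(U_bounds hz)/andP[u1 u2]; rewrite /returns /= u2 andbT; case/andP: hz; lra.
have hi := chain_itv P0 s0; set m := Num.truncn _ in hi.
have nm : (n <= m)%N.
  case/orP: hs => [/eqP -> //|hs]; case/andP: hi => _ hi.
  by have := le_lt_trans hs hi; rewrite ltr_pM2r // ltr_nat ltnS.
rewrite (chainE _ _ P0 hi).
have [hm _] := returns_bounds m hz; have mn := returns_le hz nm.
have : `|s - m%:R * P| < 6 * pi.
  by move: hi; rewrite -natr1 mulrDl mul1r ltr_norml => /andP[i1 i2]; apply/andP; split; lra.
by move=> /(U_bounds hm)/andP[u1 u2]; case/andP: hm => m1 m2; apply/andP; split; lra.
Qed.

Lemma polar_rhs_turn s u : polar_rhs t k h C S lam F (s + P) u = polar_rhs t k h C S lam F s u.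
Proof.
rewrite /polar_rhs /num /den /comp1 /comp2 /polar_pt.
by rewrite (pf_perC pf) (pf_perS pf) (pf_perl pf).
Qed.

Lemma chain_motion z : 0 < z <= z0 -> forall s, -1 < s ->
  [/\ der (v z) s (polar_rhs t k h C S lam F s (v z s)), 0 < v z s <= 3 / 2 * z,
     {for s, continuous (fun s => slowness t k e C S lam F s (v z s))}
   & k%:R / 2 <= den t k C S F s (v z s) <= 2 * k%:R].
Proof.
move=> hz s s1; have p2 := @pi_ge2 R; have PE : P = 2 * pi by [].
have sP : - (2 * P) < s by lra.
have dv : der (v z) s (polar_rhs t k h C S lam F s (v z s)).
  apply: (der_chain P0 polar_rhs_turn _ _ _ sP) => [n x hx|n|n] //.
  - have [hn _] := returns_bounds n hz; case/andP: hx => x1 x2.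
    have : `|x| < 6 * pi by rewrite ltr_norml; apply/andP; split; lra.
    by move=> /(hU hn)[].
  - by apply: hU0; have [] := returns_bounds n hz.
have vb := @chain_bounds z s 0 hz sP isT; rewrite [returns z 0]/(iter _ _ _) /= in vb.
have [|c1 c2] := hcont (der_cont dv); last by split.
by case/andP: vb hz => -> h1 /andP[h3 h2] /=; lra.
Qed.

Lemma polar_pt_norm : exists2 B, 0 < B & forall u s, 0 < u <= 1 -> `|polar_pt t C S u s| <= B * u.
Proof.
have [B B0 hB] := frame_bounded pf; exists B => // u s /andP[u0 u1].
have up m : (0 < m)%N -> u ^+ m <= u.
  by move=> m0; rewrite -[X in _ <= X]expr1; apply: ler_wiXn2l => //; exact: ltW.
have [b1 b2 _ _ _] := hB s.
rewrite prod_normE /polar_pt /= ge_max !normrM !(ger0_norm (exprn_ge0 _ (ltW u0))).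
rewrite ![B * u]mulrC; apply/andP; split; apply: ler_pM => //;
by rewrite ?exprn_ge0 ?(ltW u0) //; exact: up.
Qed.

Lemma orbit_polar z (psi : R -> R) : 0 < z <= z0 -> continuous psi -> (forall x, 0 <= x -> 0 <= psi x) ->
  polar_angle `[0, +oo[ (orbit z psi) (orbit_angle z psi).
Proof.
move=> hz cpsi psi0.
have pos x : 0 <= x -> 0 < v z (psi x) * E (psi x).
  move=> /psi0 px; have px1 : -1 < psi x by lra.
  by apply: mulr_gt0; [have [_ /andP[] //] := chain_motion hz px1 | exact: pf_E pf _].
split.
- apply: continuous_in_subspaceT => x; rewrite inE /= in_itv /= andbT => x0.
  have px1 : -1 < psi x by have := psi0 x x0; lra.
  have cv : {for x, continuous (fun x => v z (psi x))}.
    by apply: (@cont_comp R (v z) psi); [exact: cpsi | have [/der_cont] := chain_motion hz px1].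
  have cE : {for x, continuous (fun x => E (psi x))}.
    by apply: (@cont_comp R E psi); [exact: cpsi | exact: (pf_Ec pf)].
  have cvE := contM cv cE.
  have ce : {for x, continuous (fun x => e * psi x)}.
    by apply: (@contM R (fun=> e) psi); [exact: cont_cst | exact: cpsi].
  apply: (@contD R (fun x => e * psi x)) => //.
  apply: angle_shift_cont => //; do ?[exact: contX].
  + by rewrite exprn_gt0 // pos.
  + by rewrite exprn_gt0 // pos.
- move=> x /=; rewrite in_itv /= andbT => x0.
  have [rho rho0 [e1 e2]] := @angle_shiftP R _ _ (e * psi x)
    (exprn_gt0 t.1 (pos x x0)) (exprn_gt0 t.2 (pos x x0)).
  exists rho => //; rewrite /orbit_angle -e1 -e2 /orbit /polar_pt.
  by rewrite (pf_polC pf) (pf_polS pf) !exprMn !mulrA.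
Qed.

(** The radius changes by a factor between 1/2 and 3/2 during a turn, so the intermediate
   value theorem provides an orbit through the polar coordinates of p. *)
Lemma nearby_orbits (eps : R) : 0 < eps -> exists2 delta, 0 < delta &
  forall p, 0 < `|p| < delta -> exists z psi,
  [/\ 0 < z <= z0, {homo psi : x y / x < y} /\ (forall A, exists x, psi x = A) /\ 0 <= psi 0,
      orbit z psi 0 = p,
      forall x, 0 <= x -> der (fun x => (orbit z psi x).1) x (e * (F (orbit z psi x)).1) /\
                          der (fun x => (orbit z psi x).2) x (e * (F (orbit z psi x)).2)
    & (forall x, 0 <= x -> `|orbit z psi x| < eps) /\
      polar_angle `[0, +oo[ (orbit z psi) (orbit_angle z psi)].
Proof.
move=> eps0; have [B B0 hB] := polar_pt_norm; have p0 := @pi_gt0 R.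
have PE : P = 2 * pi by [].
have /andP[z00 z01'] := z01.
pose d := Num.min (z0 / 4) (eps / (3 * B)).
have d0 : 0 < d by rewrite lt_min !divr_gt0 // mulr_gt0.
have [delta delta0 hd] := start_point t1 hk hh pf d0.
exists delta => // p /hd[u [s0 [/andP[u0 ud] /andP[s00 s01] ->]]].
move: ud; rewrite lt_min ltr_pdivlMr // ltr_pdivlMr ?mulr_gt0 // => /andP[uz ue].
have hs0 : `|s0| < 6 * pi by rewrite ger0_norm //; lra.
have zb z : u / 2 <= z <= 2 * u -> 0 < z <= z0.
  by move=> /andP[a b]; apply/andP; split; lra.
have u2 : u / 2 <= 2 * u by lra.
have [|| z zu zE] := @IVTle R (U^~ s0) (u / 2) (2 * u) u u2.
- by move=> z /zb hz; have [] := hU hz hs0.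
- have i1 : 0 < u / 2 <= z0 by apply: zb; apply/andP; split; lra.
  have i2 : 0 < 2 * u <= z0 by apply: zb; apply/andP; split; lra.
  have /andP[_ a] := U_bounds i1 hs0; have /andP[b _] := U_bounds i2 hs0.
  by apply/andP; split; lra.
have hz := zb z zu.
have [psi [psi0 hpsi psis cpsi dpsi]] := orbit_time t1 t2 hk hh he pf s00 (chain_motion hz).
have psi_ge x : 0 <= x -> 0 <= psi x.
  rewrite le_eqVlt => /orP[/eqP <-|x0]; first by rewrite psi0.
  by apply: ltW; apply: le_lt_trans (hpsi _ _ x0); rewrite psi0.
exists z, psi; split=> //; first by rewrite psi0.
- rewrite /orbit psi0; congr (polar_pt t C S _ _); rewrite -zE /v.
  have [sP|sP] := ltrP s0 P; first by rewrite chain0.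
  have -> : s0 = P by apply/le_anti; rewrite sP andbT.
  rewrite (@chainE _ _ _ _ 1%N) // ?mul1r ?lexx ?ltrnDl //; last first.
    by rewrite -natr1 mulrDl mul1r ltrDl.
  by rewrite subrr hU0 //; have [] := returns_bounds 1 hz.
- split; last exact: orbit_polar.
  move=> x /psi_ge px; have px1 : -1 < psi x by lra.
  have [_ /andP[v0 vz] _ _] := chain_motion hz px1.
  have hv : 0 < v z (psi x) <= 1 by rewrite v0; case/andP: zu; lra.
  apply: le_lt_trans (hB _ _ hv) _.
  apply: le_lt_trans (_ : B * (3 * u) < eps); last by lra.
  by rewrite ler_pM2l //; case/andP: zu; lra.
Qed.

(** As P = id the radius is periodic in the angle, so the point returns after one turn;
   the frame turns by e * 2 pi and the shift of angle is periodic. *)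
Lemma center_orbits (G : R * R -> R * R) : (forall p, G p = (e * (F p).1, e * (F p).2)) ->
  (forall z, 0 < z <= z0 -> U z (2 * pi) = z) -> is_center G.
Proof.
move=> hG hid eps eps0; have [delta delta0 hd] := nearby_orbits eps0.
exists delta => // p /hd[z [psi [hz [hpsi [psis psi0]] hp hder [hsmall hang]]]].
have [tau htau] := psis (psi 0 + P).
have tau0 : 0 < tau.
  rewrite ltNge; apply/negP => t0; have : psi tau <= psi 0.
    by move: t0; rewrite le_eqVlt => /orP[/eqP -> //|/hpsi/ltW].
  by rewrite htau; have := P0; lra.
have rz n : returns z n = z.
  by rewrite /returns; elim: n => //= n ->; exact: hid.
have vper : v z (psi 0 + P) = v z (psi 0).
  have hi := chain_itv P0 psi0; set m := Num.truncn _ in hi.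
  rewrite /v (chainE _ _ P0 hi) (@chainE _ _ _ _ m.+1) // ?rz.
    by congr (U z _); rewrite -natr1; ring.
  by move: hi; rewrite -[m.+2%:R]natr1 mulrDl mul1r -natr1 mulrDl mul1r => /andP[i1 i2]; apply/andP; split; lra.
have [cper sper Eper] := frame_turn t1 hk hh he pf (psi 0).
exists (orbit z psi), tau; split; [split=> // | ].
- move=> s /=; rewrite in_itv /= => /andP[s0 _]; rewrite hG /=; exact: hder.
- by move=> s /andP[s0 _]; exact: hsmall.
- exists (orbit_angle z psi).
    have [ca pa] := hang; split.
      apply: continuous_subspaceW ca => x /=; rewrite !in_itv /= andbT.
      by case/andP.
    by move=> s /=; rewrite in_itv /= => /andP[s0 _]; apply: pa; rewrite /= in_itv /= s0.
  rewrite /orbit_angle htau vper /angle_shift cper sper Eper.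
  rewrite opprD addrACA subrr addr0 -mulrBr addrAC subrr add0r.
  by case: he => ->; rewrite ?mul1r ?mulN1r ?normrN gtr0_norm.
- by rewrite -hp /orbit htau vper /polar_pt (pf_perC pf) (pf_perS pf).
Qed.

(** The radius is at most 3/2 times the last return, which tends to 0; the angle differs
   from e times the unbounded parameter by less than pi / 2. *)
Lemma focus_orbits (G : R * R -> R * R) : (forall p, G p = (e * (F p).1, e * (F p).2)) ->
  (forall z, 0 < z <= z0 -> forall d, 0 < d -> exists n, returns z n < d) -> stable_focus G.
Proof.
move=> hG hdec eps eps0; have [delta delta0 hd] := nearby_orbits eps0.
have [B B0 hB] := polar_pt_norm; have p0 := @pi_gt0 R.
exists delta => // p /hd[z [psi [hz [hpsi [psis psi0]] hp hder [hsmall hang]]]].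
have large A : exists2 X, 0 < X & forall x, X < x -> A < psi x.
  have [X hX] := psis A; exists (`|X| + 1); first by rewrite ltr_wpDl.
  move=> x hx; rewrite -hX; apply: hpsi; have := ler_norm X; lra.
exists (orbit z psi), (orbit_angle z psi); split=> //.
- move=> s /=; rewrite in_itv /= andbT => s0; rewrite hG /=; exact: hder.
- apply/cvgr0Pnorm_lt => d d0.
  have dd : 0 < Num.min (d / (2 * B)) (1 / 2) by rewrite lt_min !divr_gt0 // mulr_gt0.
  have [n hn] := hdec z hz _ dd.
  have [X X0 hX] := large (n%:R * P).
  near=> x.
  have xX : X < x by near: x; exact: nbhs_pinfty_gt (num_real _).
  have px := hX x xX.
  have ps0 : 0 <= n%:R * P by rewrite mulr_ge0 // ltW.
  have := @chain_bounds z (psi x) n hz; rewrite (ltW px) orbT => hb.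
  have /andP[v0 v1] : 0 < v z (psi x) <= 3 / 2 * returns z n by apply: hb => //; have := P0; lra.
  move: hn; rewrite lt_min ltr_pdivlMr ?mulr_gt0 // => /andP[r1 r2].
  have hv : 0 < v z (psi x) <= 1 by rewrite v0; lra.
  apply: le_lt_trans (hB _ (psi x) hv) _.
  apply: le_lt_trans (_ : B * (3 / 2 * returns z n) < d); first by rewrite ler_pM2l.
  by have [/andP[rp _] _] := returns_bounds n hz; have := mulr_gt0 B0 rp; lra.
- split=> //; apply/cvgryPge => A.
  have [X X0 hX] := large (`|A| + pi).
  near=> x.
  have xX : X < x by near: x; exact: nbhs_pinfty_gt (num_real _).
  have px := hX x xX; rewrite /orbit_angle; set q := angle_shift _ _ _.
  have hq : `|q| < pi / 2 by exact: angle_shift_bound.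
  have ep : `|e * psi x| = psi x.
    rewrite normrM; have -> : `|e| = 1 by case: he => ->; rewrite ?normrN normr1.
    by rewrite mul1r ger0_norm //; have := normr_ge0 A; lra.
  have := ler_normD (e * psi x + q) (- q); rewrite addrK normrN ep.
  by have := ler_norm A; lra.
Unshelve. all: by end_near.
Qed.

End SpiralOrbits.

(** * Center or focus *)

Section Center.
Variables (R : realType) (t : nat * nat) (k N : nat) (h mu : {poly {poly R}}).
Variables (Cs Sn : R -> R) (T : R) (f : fvf R) (F : R * R -> R * R).
Hypothesis ht : is_type t.
Hypothesis hh : whomog t k h.
Hypothesis hpar : parameterizes_level1 h Cs Sn T.
Hypothesis hmu : whomog t (wr t k + N) mu.
Hypothesis hF : has_taylor F f.
Hypothesis hf : qhhot t (k%:Z - (wt t)%:Z) f (Xh h).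
Hypothesis hequiv : formally_orbital_equivalent f (fvf_of_poly (normal_form t h mu)).

Lemma center_or_focus (e : R) (G : R * R -> R * R) : e = 1 \/ e = -1 ->
  (forall p, G p = (e * (F p).1, e * (F p).2)) ->
  (mean_speed mu Cs Sn T = 0 -> is_center G) /\
  (e * mean_speed mu Cs Sn T < 0 -> stable_focus G).
Proof.
move=> he hG.
have t1 := (level_t_gt0 ht hh hpar).1; have t2 := (level_t_gt0 ht hh hpar).2.
have hk := level_k_ge ht hh hpar; have k0 := level_k_gt0 ht hh hpar.
have [C [S [lam [E pf]]]] := polar_frame_exists t1 t2 k0 hh (fun x y => @level_pos _ _ _ _ _ _ _ ht hh hpar x y) he.
have [z0 [U [z01 [hU hU0 hcont hc hs]]]] := return_map ht hh hpar hmu he pf hF hf hequiv.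
split=> [/hc hid|/hs hdec].
  by apply: (center_orbits t1 t2 hk hh he pf z01 hU hU0 hcont _ hG) => // z hz; rewrite hid.
have ret z : 0 < z <= z0 -> (forall n, 0 < returns U z n.+1 < returns U z n) /\
    forall d, 0 < d -> exists n, returns U z n < d.
  by move=> hz; exact: (hdec (returns U z) hz (fun=> erefl)).
apply: (focus_orbits t1 t2 hk hh he pf z01 hU hU0 hcont _ hG) => z hz.
  by have [/(_ 0%N)/andP[_ /ltW]] := ret z hz.
exact: (ret z hz).2.
Qed.
End Center.

(** * Change of sign of the field *)

Section Scaling.
Variable R : realType.
Implicit Types (c : R) (h mu : {poly {poly R}}) (f : fvf R) (F : R * R -> R * R).

Definition scale_fvf c f : fvf R := (fun i j => c * f.1 i j, fun i j => c * f.2 i j).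

Lemma coef_scale c h i j : (c%:P *: h)`_i`_j = c * h`_i`_j.
Proof. by rewrite coefZ coefCM. Qed.

Lemma dX_scale c h : dX (c%:P *: h) = c%:P *: dX h.
Proof. by rewrite /dX derivZ. Qed.

Lemma dY_scale c h : dY (c%:P *: h) = c%:P *: dY h.
Proof. by apply: bipoly_eqP => i j; rewrite dY_coef !coef_scale dY_coef mulrnAr. Qed.

Lemma has_taylor_scale c f F : has_taylor F f ->
  has_taylor (fun p => (c * (F p).1, c * (F p).2)) (scale_fvf c f).
Proof.
have sc a (g : R * R -> R) : power_series_at0 a g ->
    power_series_at0 (fun i j => c * a i j) (fun p => c * g p).
  move=> [rho [M [rho0 hM hg]]]; exists rho, (`|c| * M); split=> // [i j|p hp].
    by rewrite normrM -mulrA ler_wpM2l.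
  have -> : (fun n : nat => \sum_(i < n) \sum_(j < n) c * a i j * p.1 ^+ i * p.2 ^+ j) =
            (fun n : nat => c * \sum_(i < n) \sum_(j < n) a i j * p.1 ^+ i * p.2 ^+ j).
    apply/funext => n; rewrite mulr_sumr; apply: eq_bigr => i _.
    by rewrite mulr_sumr; apply: eq_bigr => j _; rewrite !mulrA.
  exact: cvgMr (hg p hp).
by move=> [h1 h2]; split; exact: sc.
Qed.

Lemma qhhot_scale c t r f h : qhhot t r f (Xh h) -> qhhot t r (scale_fvf c f) (Xh (c%:P *: h)).
Proof.
move=> hf a b; have [h1 h2] := hf a b.
rewrite /fps_of_poly /= dX_scale dY_scale -scalerN !coef_scale.
by split=> [/h1 ->|/h2 ->].
Qed.

Lemma fps_mul_scale c (a b : fps R) i j :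
  fps_mul a (fun i j => c * b i j) i j = c * fps_mul a b i j.
Proof.
rewrite /fps_mul mulr_sumr; apply: eq_bigr => x _.
by rewrite mulr_sumr; apply: eq_bigr => y _; rewrite mulrCA.
Qed.

Lemma orbital_scale c t f h mu :
  formally_orbital_equivalent f (fvf_of_poly (normal_form t h mu)) ->
  formally_orbital_equivalent (scale_fvf c f)
    (fvf_of_poly (normal_form t (c%:P *: h) (c%:P *: mu))).
Proof.
move=> [phi [eta [h1 h2 h3 h4]]]; exists phi, eta; split=> // i j.
have mulE a : fps_mul eta (fun i j => c * a i j) = (fun i j => c * fps_mul eta a i j).
  by apply/funext => x; apply/funext => y; rewrite fps_mul_scale.
have lie g : fps_lie (fps_mul eta (scale_fvf c f).1, fps_mul eta (scale_fvf c f).2) g i j =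
    c * fps_lie (fps_mul eta f.1, fps_mul eta f.2) g i j.
  by rewrite /fps_lie /fps_add /= !mulE !fps_mul_scale mulrDr.
have comp (p : {poly {poly R}}) : fps_comp (fps_of_poly (c%:P *: p)) phi.1 phi.2 i j =
    c * fps_comp (fps_of_poly p) phi.1 phi.2 i j.
  rewrite /fps_comp mulr_sumr; apply: eq_bigr => a _.
  by rewrite mulr_sumr; apply: eq_bigr => b _; rewrite /fps_of_poly coef_scale mulrA.
have [e1 e2] := h4 i j.
have -> : normal_form t (c%:P *: h) (c%:P *: mu) =
    (c%:P *: (normal_form t h mu).1, c%:P *: (normal_form t h mu).2).
  by rewrite /normal_form /= dX_scale dY_scale !scalerDr !scalerAl scalerN.
by rewrite !lie /= !comp e1 e2.
Qed.
End Scaling.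

Theorem theorem4 (R : realType) (t : nat * nat) (r : int)
    (h : {poly {poly R}}) (f : fvf R) (F : R * R -> R * R)
    (Cor : int -> set {poly {poly R[i]}}) (N : nat) (mu : {poly {poly R}})
    (Cs Sn : R -> R) (T : R) :
  is_type t ->
  class_F t r (toC h) ->
  has_taylor F f ->
  f.1 0%N 0%N = 0 /\ f.2 0%N 0%N = 0 ->
  qhhot t r f (Xh h) ->
  monodromic F ->
  is_Cor t (toC h) r Cor ->
  Cor (r + N%:Z) (toC mu) -> mu != 0 ->
  ~ formally_integrable (fvf_of_poly (normal_form t (toC h) (toC mu))) ->
  formally_orbital_equivalent f (fvf_of_poly (normal_form t h mu)) ->
  parameterizes_level1 ((hsign h)%:P *: h) Cs Sn T ->
  let I := level_integral h mu Cs Sn T in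
  [/\ I = 0 -> is_center F,
      0 < hsign h * I -> unstable_focus F
    & hsign h * I < 0 -> stable_focus F].
Proof.
move=> ht [hqh [hn0 _] _] hF _ hf _ [hCor _] hmu _ _ hequiv hpar I.
have hs : hsign h = 1 \/ hsign h = -1 by rewrite /hsign; case: ifP; [left | right].
set s := hsign h in I hs hpar *.
have ss : s * s = 1 by case: hs => ->; rewrite ?mulr1 // mulrNN mulr1.
have s0 : s != 0 by apply: contraTneq (oner_neq0 R) => e0; rewrite -ss e0 mulr0 eqxx.
have hc := qhomog_coef (qhomog_toC hqh).
have [k kE] : exists k : nat, r + (wt t)%:Z = k%:Z.
  have [[i [j hij]]|hz] := pselect (exists i j, h`_i`_j != 0).
    by exists (t.1 * i + t.2 * j)%N; rewrite (hc i j).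
  case/eqP: hn0; suff -> : h = 0 by rewrite /toC map_poly0.
  apply: bipoly_eqP => i j; rewrite !coef0; apply/eqP.
  by apply: contrapT => /negP hij; apply: hz; exists i, j.
have rE : r = k%:Z - (wt t)%:Z by rewrite -kE addrK.
(* h' is positive, and F' = s F has the leading part X_h'. *)
pose h' := s%:P *: h; pose mu' := s%:P *: mu.
have hh : whomog t k h'.
  move=> i j; rewrite coef_scale mulf_eq0 (negPf s0) /= => /hc.
  by rewrite kE => /eqP; rewrite eqz_nat => /eqP.
have hk := level_k_ge ht hh hpar.
have hm' : whomog t (wr t k + N) mu'.
  have [_ sub _ _] := hCor (r + N%:Z).
  have hm := qhomog_coef (qhomog_toC (sub _ hmu)).
  move=> i j; rewrite coef_scale mulf_eq0 (negPf s0) /= => /hm.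
  by rewrite rE /wr /wt; move: hk; clear; lia.
have hf' : qhhot t (k%:Z - (wt t)%:Z) (scale_fvf s f) (Xh h').
  by rewrite -rE; exact: qhhot_scale.
pose F' p := (s * (F p).1, s * (F p).2).
have T0 : 0 < T by case: hpar.
have IE : mean_speed mu' Cs Sn T = I / T.
  rewrite /mean_speed /I /level_integral -/s; congr (_ / T).
  by apply: eq_Rintegral => x _; rewrite evZ.
have main e G := @center_or_focus R t k N h' mu' Cs Sn T (scale_fvf s f) F' ht hh hpar hm'
  (has_taylor_scale s hF) hf' (orbital_scale s hequiv) e G.
have GE p : F p = (s * (F' p).1, s * (F' p).2).
  by rewrite /F' /= !mulrA ss !mul1r -surjective_pairing.
(* The field e F' is F for e = s, and - F for e = - s. *)
have [c1 c2] := main s F hs GE.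
have hs' : - s = 1 \/ - s = -1 by case: hs => ->; [right | left; rewrite opprK].
have GE' p : - F p = (- s * (F' p).1, - s * (F' p).2).
  by rewrite {1}GE !mulNr.
have [_ c3] := main (- s) (fun p => - F p) hs' GE'.
rewrite IE in c1 c2 c3; split.
- by move=> I0; apply: c1; rewrite I0 mul0r.
- by move=> sI; apply: c3; rewrite mulNr oppr_lt0 mulrA divr_gt0.
- by move=> sI; apply: c2; rewrite mulrA pmulr_llt0 ?invr_gt0.
Qed.
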